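(* Assume $d\ge 3$. There are positive constants $\underline{\kappa}$, $\overline{\kappa}$ and $C$ such that for any positive integers $n$, $r$ and $L$ and any $\rho>0$ satisfying $$\rho\, r^{d-2}\ge C\log n\qquad\text{and}\qquad n\ge C\rho\, r^d L, \qquad (\ast)$$ one has $$\exp\big(-\underline{\kappa}\,\rho\, r^{d-2}L^{1-2/d}\big)\le \mathbb{P}\big(|\mathcal{C}_n(r,\rho)|>L\big)\le \exp\big(-\overline{\kappa}\,\rho\, r^{d-2}L^{1-2/d}\big).$$ In addition there exists $A>0$ such that $$\lim_{n\to\infty}\ \inf_{(r,\rho,L)}\ \mathbb{P}\Big(\mathrm{cap}(\mathcal{V}_n(r,\rho))\le A\,|\mathcal{V}_n(r,\rho)|^{1-2/d}\ \Big|\ |\mathcal{C}_n(r,\rho)|>L\Big)=1,$$ where the infimum is taken over all triples $(r,\rho,L)$ satisfying $(\ast)$.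
   Context: $(S_n)_{n\ge 0}$ is the simple random walk on $\mathbb{Z}^d$, $\mathbb{P}_x$ its law when started at $x$, and $\mathbb{P}=\mathbb{P}_0$. The local times up to time $n$ are $\ell_n(z)=\sum_{k=0}^n\mathbf{1}\{S_k=z\}$ for $z\in\mathbb{Z}^d$, and $\ell_n(\Lambda)=\sum_{z\in\Lambda}\ell_n(z)$ for $\Lambda\subset\mathbb{Z}^d$. For $r\ge 1$ and $x\in\mathbb{Z}^d$, $Q_r(x)=\big(x+[-r/2,r/2)^d\big)\cap\mathbb{Z}^d$. For $\rho>0$ and $n\ge 1$, $$\mathcal{C}_n(r,\rho)=\{x\in r\mathbb{Z}^d:\ \ell_n(Q_r(x))\ge\rho r^d\},\qquad \mathcal{V}_n(r,\rho)=\bigcup_{x\in\mathcal{C}_n(r,\rho)}Q_r(x).$$ $|\cdot|$ denotes cardinality. With $H^+_\Lambda=\inf\{n\ge 1:S_n\in\Lambda\}$ the return time to $\Lambda$, the capacity of a finite set $\Lambda\subset \mathbb{Z}^d$ is $\mathrm{cap}(\Lambda)=\sum_{x\in\Lambda}\mathbb{P}_x(H^+_\Lambda=\infty)$.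
   Formalization: The two tail bounds are stated for n ≥ 2 rather than all positive n: at n = 1, log n = 0 and with r = L = 1, 0 < ρ ≤ min(1, 1/C) condition (∗) holds while P(|C_1(r,ρ)| > L) = 1, so the upper bound fails for every choice of constants. *)

(* Defs.v *)
From HB Require Import structures.
From mathcomp Require Import all_boot all_order all_algebra.
From mathcomp Require Import finmap.
From mathcomp Require Import all_classical all_reals all_analysis.
Import Order.TTheory GRing.Theory Num.Theory numFieldNormedType.Exports.

Set Implicit Arguments.
Unset Strict Implicit.
Unset Printing Implicit Defensive.

Local Open Scope classical_set_scope.
Local Open Scope ring_scope.

(* The lattice Z^d is 'rV[int]_d. *)

(* One-step transition probability: the 2d vectors of l^1-norm 1 are the +-e_i. *)
Definition srw_step (R : realType) (d : nat) (y z : 'rV[int]_d) : R :=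
  if \sum_(i < d) `|z 0 i - y 0 i| == 1 then (2 * d)%N%:R^-1 else 0.

(* A realisation of the simple random walk on Z^d: a measurable space carrying
   the trajectory (S_k)_k, with one law P_x for each starting point x.  The law
   of S under P_x is given by its finite-dimensional distributions.  As Z^d is
   countable, measurability of S_k amounts to that of the events S_k = z. *)
Record simple_random_walk (R : realType) (d : nat) := SimpleRandomWalk {
  srw_display : measure_display ;
  srw_space : measurableType srw_display ;
  srw_law : 'rV[int]_d -> probability srw_space R ;
  srw_pos : nat -> srw_space -> 'rV[int]_d ;
  srw_measurable : forall (k : nat) (z : 'rV[int]_d),
    measurable (srw_pos k @^-1` [set z]) ;
  srw_fdd : forall (x : 'rV[int]_d) (n : nat) (p : nat -> 'rV[int]_d),
    srw_law x [set w | forall k, (k <= n)%N -> srw_pos k w = p k] =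
    ((p 0%N == x)%:R * \prod_(k < n) srw_step R (p k) (p k.+1))%:E }.

(* Only applied to finite sets; an infinite set would get cardinality 0. *)
Definition set_size (T : choiceType) (A : set T) : nat := #|` fset_set A|%fset.

Section LocalTimes.
Variables (R : realType) (d : nat) (W : simple_random_walk R d).
Implicit Types (w : srw_space W) (n r : nat) (rho : R).

Definition local_time n w (z : 'rV[int]_d) : nat :=
  (\sum_(0 <= k < n.+1) (srw_pos k w == z))%N.

(* The sum has finitely many nonzero terms, whatever Lambda is. *)
Definition local_time_set n w (Lambda : set 'rV[int]_d) : nat :=
  \sum_(z \in Lambda) local_time n w z.

Definition cube r (x : 'rV[int]_d) : set 'rV[int]_d :=
  [set y | forall i : 'I_d,
     - (r%:Q / 2) <= (y 0 i - x 0 i)%:~R < r%:Q / 2].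

(* Finite when r and rho are positive: each such cube contains one of the
   sites S_0, ..., S_n. *)
Definition heavy n r rho w : set 'rV[int]_d :=
  [set x | (exists y : 'rV[int]_d, x = r%:Z *: y) /\
           rho * r%:R ^+ d <= (local_time_set n w (cube r x))%:R].

Definition heavy_region n r rho w : set 'rV[int]_d :=
  \bigcup_(x in heavy n r rho w) cube r x.

Definition return_time (Lambda : set 'rV[int]_d) w : \bar R :=
  ereal_inf [set n%:R%:E | n in [set n | (1 <= n)%N /\ Lambda (srw_pos n w)]].

(* Meaningful for finite Lambda. *)
Definition capacity (Lambda : set 'rV[int]_d) : R :=
  \sum_(x \in Lambda)
    fine (srw_law W x [set w | return_time Lambda w = +oo%E]).

End LocalTimes.

(* P(A | B), with value 0 when P(B) = 0. *)
Definition cond_prob (R : realType) (disp : measure_display)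
    (T : measurableType disp) (P : probability T R) (A B : set T) : R :=
  fine (P (A `&` B)) / fine (P B).

(* For n = 1 one has ln n = 0, and the tail bounds cannot hold: with
   r = L = 1 and 0 < rho <= min(1, 1/C), the two sites S_0 <> S_1 are heavy
   almost surely.  Hence n >= 2 where these bounds are asserted. *)
Definition admissible (R : realType) (d : nat) (C : R) (n r : nat) (rho : R)
    (L : nat) : Prop :=
  [/\ (0 < r)%N, (0 < L)%N, 0 < rho,
      C * ln n%:R <= rho * r%:R ^+ (d - 2) &
      C * rho * r%:R ^+ d * L%:R <= n%:R].

(* Main.v *)
(** Write k(x) for the radial kernel (|x|^2 + b)^(-(d-2)/2).  For b large, k is superharmonic for
    the walk, and a difference of two such kernels is subharmonic away from a cube; these two
    functions replace the Green function throughout.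

    Upper bound.  Call a set U of cubes nice if the sum of k over the differences x - y, with y
    in U, is bounded uniformly in x in U.  Then the total time spent in the cubes of U is
    dominated by r^2 times an exponential variable (Khas'minskii), so that all cubes of U are
    heavy with probability at most exp(-c rho r^(d-2) |U|), and a union bound over U is
    affordable since rho r^(d-2) >= C log n.  Rounding a fractional solution extracts nice
    subsets: any N cubes contain a nice set of size at least c N^(1-2/d), which gives the
    upper tail, and the equilibrium measure of the union of the cubes provides a nice set of
    size at least c cap / r^(d-2), which bounds the probability that the capacity is too large.

    Lower bound.  Take a box of more than L cubes, of side Q proportional to r L^(1/d), and
    tilt the walk by a Gaussian of width Q: this confines it at cost exp(-C / Q^2) per step.
    For each cube of the box there is a supersolution, built from the subharmonic bump at
    the cube, showing that under the tilting the cube is visited at rate r^(d-2) / Q^d.  In time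
    of order rho Q^d all cubes of the box become heavy, at total cost rho Q^(d-2). *)

Require Import Defs.
From HB Require Import structures.
From mathcomp Require Import all_boot all_order all_algebra.
From mathcomp Require Import finmap.
From mathcomp Require Import all_classical all_reals all_analysis.
From mathcomp Require Import ring lra zify.
Import Order.TTheory GRing.Theory Num.Theory numFieldNormedType.Exports.

Set Implicit Arguments.
Unset Strict Implicit.
Unset Printing Implicit Defensive.

Local Open Scope classical_set_scope.
Local Open Scope ring_scope.

(** * The radial kernel s^(-(d-2)/2) *)

(** Asymptotics of the Green function are avoided because the kernel has an explicit Taylor
    expansion. With s = |x|^2 + b, the discretisation error and the effect of the shift b both have
    order k / s^2, so one large b settles the sign everywhere, even near the origin. The shift
    always pushes towards superharmonicity, which is why subharmonicity needs a difference of two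
    kernels.

    In the upper tail, choosing u cubes costs O(u log n), against a gain of order rho r^(d-2) per
    cube. For the capacity, the exponent of the bad event is proportional to A while that of the
    conditioning event is fixed, so a large A makes the conditional failure probability at most 1/n,
    uniformly.

    In the lower tail no tilted process is built: its density is a path weight of mean 1, bounded on
    good paths and controlled on bad ones by a union over light cubes. The obstacle is that the
    killing rate of the tilting changes sign at distance of order Q, so the supersolution must be
    global: the bump serves near the cubes, a narrower Gaussian minus a constant elsewhere. *)

Section Kernel.
Variable R : realType.

(** Equal to s^(-n/2) for s > 0. Here n stands for d - 2; later sections write the dimension as
    [n.+2]. *)
Definition ker (n : nat) (s : R) : R := (Num.sqrt s)^-1 ^+ n.

Lemma ker_gt0 n s : 0 < s -> 0 < ker n s.
Proof. by move=> s0; rewrite exprn_gt0// invr_gt0 sqrtr_gt0. Qed.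

Lemma ker_ge0 n s : 0 <= ker n s.
Proof. by rewrite exprn_ge0// invr_ge0 sqrtr_ge0. Qed.

Lemma le_ker n s t : 0 < s -> s <= t -> ker n t <= ker n s.
Proof.
move=> s0 st; rewrite lerXn2r ?nnegrE ?invr_ge0 ?sqrtr_ge0//.
rewrite lef_pV2 ?posrE ?sqrtr_gt0//; last exact: lt_le_trans st.
exact: ler_wsqrtr.
Qed.

Lemma kerM n s t : 0 <= s -> ker n (s * t) = ker n s * ker n t.
Proof. by move=> s0; rewrite /ker sqrtrM// invfM exprMn. Qed.

Lemma kerX2 n s : 0 <= s -> ker n (s ^+ 2) = s ^- n.
Proof. by move=> s0; rewrite /ker sqrtr_sqr ger0_norm// exprVn. Qed.

Lemma kerD m n s : ker (m + n) s = ker m s * ker n s.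
Proof. by rewrite /ker exprD. Qed.

Lemma ker2 s : 0 <= s -> ker 2 s = s^-1.
Proof. by move=> s0; rewrite /ker exprVn sqr_sqrtr. Qed.

Lemma ker1 n : ker n 1 = 1.
Proof. by rewrite /ker sqrtr1 invr1 expr1n. Qed.

(** No derivatives: [a] is the positive root of a^2 (1 + y) = 1, so (p - a)(p + a)(1 + y) is the
    polynomial p^2 (1 + y) - 1, divisible by y^4, and (p + a)(1 + y) is bounded below. *)
Lemma ker1_taylor (y : R) : `|y| <= 1/2 ->
  `|ker 1 (1 + y) - (1 - y/2 + 3/8 * y^+2 - 5/16 * y^+3)| <= 4 * y^+4.
Proof.
rewrite ler_norml => /andP[y1 y2].
set p := (X in _ - X); set a := ker 1 _.
have y0 : 0 < 1 + y by lra.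
have a0 : 0 < a by exact: ker_gt0.
have aE : a ^+ 2 * (1 + y) = 1.
  by rewrite /a -[ker 1 _ ^+ 2]kerD ker2 ?ltW// mulVf// gt_eqF.
have a2 : 1/2 <= a by nra.
have p0 : 0 <= p by rewrite /p; nra.
have pE : (p - a) * ((p + a) * (1 + y)) =
  y^+4 * (- (35/64) + 7/32*y - 35/256*y^+2 + 25/256*y^+3).
  transitivity (p ^+ 2 * (1 + y) - a ^+ 2 * (1 + y)); first by ring.
  by rewrite aE /p; field.
have y40 : 0 <= y^+4 by rewrite exprn_even_ge0.
have pB : `|p - a| * ((p + a) * (1 + y)) <= y ^+ 4.
  rewrite -[X in _ * X]ger0_norm; last by rewrite mulr_ge0//; lra.
  rewrite -normrM pE normrM (ger0_norm y40) ler_piMr// ler_norml.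
  by apply/andP; split; nra.
rewrite distrC.
have w : 1/4 <= (p + a) * (1 + y) by nra.
have := normr_ge0 (p - a); nra.
Qed.

(** Induction on n, multiplying by one more factor (1 + y)^(-1/2). The linear and quadratic
    coefficients are explicit because they must cancel in the Laplacian; the cubic term only enters
    the error. *)
Lemma ker_taylor n : exists c K : R, 0 <= K /\ forall y, `|y| <= 1/2 ->
  `|ker n (1 + y) - (1 - n%:R/2 * y + n%:R * (n%:R+2) / 8 * y^+2 - c * y^+3)|
     <= K * y^+4.
Proof.
elim: n => [|n [c [K [K0 IH]]]].
  exists 0, 0; split=> // y _.
  by rewrite (_ : _ - _ = 0) ?normr0 ?mul0r// /ker expr0; field.
set a : R := n%:R/2; set c2 : R := n%:R * (n%:R+2) / 8.
(* Coefficients of y^4, y^5 and y^6 in the product of the two cubic polynomials. *)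
pose e0 : R := a * (5/16) + c2 * (3/8) + c / 2.
pose e1 : R := - (c2 * (5/16)) - c * (3/8).
pose e2 : R := c * (5/16).
exists (5/16 + a * (3/8) + c2/2 + c),
  (2 * K + (1 + `|a| + `|c2| + `|c|) * 4 + (`|e0| + `|e1| + `|e2|)).
split; first by rewrite !(addr_ge0, mulr_ge0).
move=> y yh; rewrite -addn1 kerD natrD.
have y40 : 0 <= y^+4 by rewrite exprn_even_ge0.
have yB : forall u k, `|u * y ^+ k| <= `|u|.
  move=> u k; rewrite normrM ler_piMr// normrX exprn_ile1//.
  by apply: le_trans yh _; lra.
have := IH y yh; have := ker1_taylor yh.
set f := ker n _; set g := ker 1 _.
set q := (X in `|g - X|); set p := (X in `|f - X|) => gq fp.
have pB : `|p| <= 1 + `|a| + `|c2| + `|c|.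
  rewrite /p; apply: (le_trans (ler_normB _ _)).
  apply: lerD; last exact: yB.
  apply: (le_trans (ler_normD _ _)); apply: lerD; last exact: yB.
  apply: (le_trans (ler_normB _ _)); rewrite normr1 lerD2l.
  by rewrite -[y in a * y]expr1 yB.
have gB : `|g| <= 2.
  have y1 : 1/2 <= 1 + y by move: yh; rewrite ler_norml => /andP[]; lra.
  have g0 : 0 < g by apply: ker_gt0; lra.
  rewrite gtr0_norm//.
  have aE : g ^+ 2 * (1 + y) = 1.
    rewrite /g -[ker 1 _ ^+ 2]kerD ker2 ?ltW ?mulVf ?gt_eqF//; lra.
  by nra.
have -> : f * g - (1 - (n%:R + 1) / 2 * y +
     (n%:R + 1) * (n%:R + 1 + 2) / 8 * y ^+ 2 -
     (5/16 + a * (3/8) + c2/2 + c) * y ^+ 3) =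
   (f - p) * g + p * (g - q) + (e0 + e1 * y + e2 * y ^+ 2) * y ^+ 4.
  by rewrite /p /q /e0 /e1 /e2 /c2 /a; field.
rewrite [leRHS]mulrDl [X in _ <= X + _]mulrDl; apply: (le_trans (ler_normD _ _)); apply: lerD.
  apply: (le_trans (ler_normD _ _)); apply: lerD.
    rewrite normrM; apply: le_trans (ler_pM _ _ fp gB) _ => //.
    by rewrite le_eqVlt; apply/orP; left; apply/eqP; ring.
  by rewrite normrM -mulrA; exact: ler_pM.
rewrite normrM (ger0_norm y40) ler_wpM2r//.
apply: (le_trans (ler_normD _ _)); apply: lerD; last exact: yB.
apply: (le_trans (ler_normD _ _)); rewrite lerD2l.
by rewrite -[y in e1 * y]expr1 yB.
Qed.

End Kernel.

(** * The averaging operator of the walk and the squared norm *)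

Section Lattice.
Variables (R : realType) (d : nat).
Hypothesis d_gt0 : (0 < d)%N.
Local Notation V := 'rV[int]_d.
Implicit Types (f g : V -> R) (x y z : V).

Definition unit_step (e : 'I_d * bool) : V :=
  \row_j ((-1) ^+ e.2 *+ (j == e.1)).

Definition avg f x : R := (2 * d)%:R^-1 * \sum_e f (x + unit_step e).

Definition sqnorm x : R := \sum_i (x 0 i)%:~R ^+ 2.

Lemma sum_step (F : 'I_d * bool -> R) :
  \sum_e F e = \sum_i (F (i, false) + F (i, true)).
Proof.
rewrite (eq_bigr (fun e => F (e.1, e.2))) => [|[]//].
rewrite -(pair_bigA _ (fun i b => F (i, b)))/=; apply: eq_bigr => i _.
by rewrite big_bool/= addrC.
Qed.

Lemma avg_cst (c : R) x : avg (fun=> c) x = c.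
Proof.
rewrite /avg sumr_const card_prod card_ord card_bool -[X in _ * X]mulr_natl mulrA.
by rewrite mulnC mulVf ?mul1r// pnatr_eq0 muln_eq0 negb_or -!lt0n d_gt0.
Qed.

Lemma avgD f g x : avg (fun y => f y + g y) x = avg f x + avg g x.
Proof. by rewrite /avg big_split mulrDr. Qed.

Lemma avgZ (c : R) f x : avg (fun y => c * f y) x = c * avg f x.
Proof. by rewrite /avg -mulr_sumr mulrCA. Qed.

Lemma avgN f x : avg (fun y => - f y) x = - avg f x.
Proof. by rewrite /avg sumrN mulrN. Qed.

Lemma avgB f g x : avg (fun y => f y - g y) x = avg f x - avg g x.
Proof. by rewrite avgD avgN. Qed.

Lemma avg_sum I (r : seq I) (F : I -> V -> R) x :
  avg (fun y => \sum_(i <- r) F i y) x = \sum_(i <- r) avg (F i) x.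
Proof. by rewrite /avg exchange_big mulr_sumr. Qed.

Lemma le_avg f g x : (forall y, f y <= g y) -> avg f x <= avg g x.
Proof.
move=> fg; rewrite ler_wpM2l ?invr_ge0 ?ler0n//.
by apply: ler_sum => e _; exact: fg.
Qed.

Lemma eq_avg f g : f =1 g -> avg f =1 avg g.
Proof. by move=> fg x; rewrite /avg; under eq_bigr do rewrite fg. Qed.

Lemma avg_ge0 f x : (forall y, 0 <= f y) -> 0 <= avg f x.
Proof. by move=> f0; rewrite -[0](avg_cst 0 x); exact: le_avg. Qed.

Lemma avg_shift f (v : V) x : avg (fun y => f (y - v)) x = avg f (x - v).
Proof. by rewrite /avg; congr (_ * _); apply: eq_bigr => e _; rewrite addrAC. Qed.

Lemma sqnorm_ge0 x : 0 <= sqnorm x.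
Proof. by apply: sumr_ge0 => i _; rewrite sqr_ge0. Qed.

Lemma sqnorm0 : sqnorm 0 = 0.
Proof. by apply: big1 => i _; rewrite mxE expr0n. Qed.

Lemma sqnormN x : sqnorm (- x) = sqnorm x.
Proof. by apply: eq_bigr => i _; rewrite mxE rmorphN sqrrN. Qed.

Lemma sqnormB x y : sqnorm (x - y) = sqnorm (y - x).
Proof. by rewrite -sqnormN opprB. Qed.

Lemma sqnormZ (k : int) x : sqnorm (k *: x) = k%:~R ^+ 2 * sqnorm x.
Proof.
by rewrite /sqnorm mulr_sumr; apply: eq_bigr => i _; rewrite mxE rmorphM exprMn.
Qed.

Lemma sqnormD_le x y : sqnorm (x + y) <= 2 * sqnorm x + 2 * sqnorm y.
Proof.
rewrite /sqnorm !mulr_sumr -big_split/=; apply: ler_sum => i _.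
rewrite mxE rmorphD /=; set a := _%:~R; set b := _%:~R.
by have := sqr_ge0 (a - b); lra.
Qed.

Lemma sqr_coord_le x i : (x 0 i)%:~R ^+ 2 <= sqnorm x.
Proof.
rewrite /sqnorm (bigD1 i)//= lerDl; apply: sumr_ge0 => j _; exact: sqr_ge0.
Qed.

Lemma sqnorm_step x i b : sqnorm (x + unit_step (i, b)) =
  sqnorm x + (1 + 2 * (-1) ^+ b * (x 0 i)%:~R).
Proof.
rewrite /sqnorm !(bigD1 i (P := predT))//= -addrA (addrC _ (1 + _)) addrA.
congr (_ + _); last first.
  by apply: eq_bigr => j ji; rewrite !mxE /= (negbTE ji) mulr0n addr0.
rewrite !mxE eqxx mulr1n rmorphD; case: b; rewrite ?expr1 ?expr0 ?rmorphN /=; ring.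
Qed.

Lemma sqnorm_neq0 x : x != 0 -> exists i, 1 <= `|(x 0 i)%:~R : R|.
Proof.
move=> /eqP xn0; apply: contrapT => /forallNP h; apply: xn0.
apply/rowP => i; rewrite mxE; apply/eqP; apply/negPn/negP => xi.
by apply: (h i); rewrite -intr_norm ler1z -gtz0_ge1 normr_gt0.
Qed.

End Lattice.
Arguments sqnorm R {d}.

(** * Discrete Laplacian of the radial kernel *)

Section Laplacian.
Variables (R : realType) (n : nat).
Local Notation d := (n.+2).
Local Notation V := 'rV[int]_d.
Implicit Types x : V.
Local Notation sqnorm := (sqnorm R).

(* [s ^ (- n / 2)], with [s = |x|^2 + b], is harmonic for the continuous
   Laplacian when [b = 0]; the term in [b] dominates the discretisation error
   once [b] is large. *)
Lemma avg_ker : exists K B : R, [/\ 0 <= K, 1 <= B &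
  forall x b, B <= b ->
  `|(sqnorm x + b) ^+ 2 *
      (avg (fun y => ker n (sqnorm y + b)) x - ker n (sqnorm x + b))
    + n%:R / 2 * b * ker n (sqnorm x + b)| <= K * ker n (sqnorm x + b)].
Proof.
have [c3 [K [K0 tay]]] := ker_taylor R n.
pose c1 : R := n%:R / 2; pose c2 : R := n%:R * (n%:R + 2) / 8.
exists (c2 + 13 * `|c3| + 100 * K), 100; split; [|by lra|].
  have c20 : 0 <= c2.
    by rewrite /c2 divr_ge0// mulr_ge0 ?addr_ge0 ?ler0n.
  by rewrite !addr_ge0// mulr_ge0.
move=> x b b100; set s := sqnorm x + b.
have N0 := sqnorm_ge0 R x.
have s100 : 100 <= s by rewrite /s; lra.
have s0 : 0 < s by lra.
(* Increment of the squared norm along the step e; t^2 <= 10 s and s >= 100 keep t / s in the range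
   of the expansion. *)
pose t (e : 'I_d * bool) : R := 1 + 2 * (-1) ^+ e.2 * (x 0 e.1)%:~R.
have tE e : sqnorm (x + unit_step e) + b = s + t e.
  by case: e => i e; rewrite sqnorm_step /s /t /= addrAC.
have t2 e : t e ^+ 2 <= 10 * s.
  rewrite /t; have := sqr_coord_le R x e.1; set u := _%:~R => u2.
  have {}u2 : u ^+ 2 <= s by rewrite /s; lra.
  have := sqr_ge0 (u - 1); have := sqr_ge0 (u + 1).
  by case: e.2 => /=; rewrite ?expr1 ?expr0; lra.
have ts e : `|t e / s| <= 1/2.
  rewrite -ler_sqr ?nnegrE//.
  rewrite real_normK ?num_real// expr_div_n ler_pdivrMr ?exprn_gt0//.
  by apply: le_trans (t2 e) _; nra.
have kE e : ker n (sqnorm (x + unit_step e) + b) = ker n s * ker n (1 + t e / s).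
  rewrite tE -kerM ?ltW//; congr ker; field; lra.
have k0 : 0 < ker n s by exact: ker_gt0.
rewrite /avg (eq_bigr _ (fun e _ => kE e)) -mulr_sumr.
set S := \sum_e _.
pose p y : R := 1 - c1 * y + c2 * y ^+ 2 - c3 * y ^+ 3.
have dS : `|S - \sum_e p (t e / s)| <= (2 * d)%:R * (100 * K / s ^+ 2).
  rewrite -sumrB; apply: (le_trans (ler_norm_sum _ _ _)).
  apply: (@le_trans _ _ (\sum_(e : 'I_d * bool) (100 * K / s ^+ 2))); last first.
    by rewrite sumr_const card_prod card_ord card_bool [leRHS]mulr_natl mulnC.
  apply: ler_sum => e _; apply: le_trans (tay _ (ts e)) _.
  rewrite [100 * K]mulrC -mulrA ler_wpM2l// expr_div_n ler_pdivrMr ?exprn_gt0//.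
  have -> : 100 / s ^+ 2 * s ^+ 4 = (10 * s) ^+ 2 by field; lra.
  rewrite -[4%N]/(2 * 2)%N exprM lerXn2r ?nnegrE ?sqr_ge0//; nra.
(* Opposite steps are paired, so odd powers of the coordinates cancel. *)
have pS : \sum_e p (t e / s) = (2 * d)%:R * (1 - c1 / s + c2 / s^+2 - c3 / s^+3)
    + (8 * c2 / s ^+ 2 - 24 * c3 / s ^+ 3) * sqnorm x.
  rewrite sum_step /sqnorm mulr_sumr.
  have -> : (2 * d)%:R * (1 - c1 / s + c2 / s^+2 - c3 / s^+3) =
     \sum_(i < d) (2 * (1 - c1 / s + c2 / s^+2 - c3 / s^+3)).
    by rewrite sumr_const card_ord -[RHS]mulr_natl natrM; ring.
  rewrite -big_split; apply: eq_bigr => i _ /=.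
  by rewrite /p /t /= expr1 expr0; field; lra.
have d0 : (2 * d)%:R != 0 :> R by rewrite pnatr_eq0.
have d0' : (d%:R : R) != 0 by rewrite pnatr_eq0.
pose E := (S - \sum_e p (t e / s)) / (2 * d)%:R.
have SE : S = (2 * d)%:R * E + \sum_e p (t e / s).
  by rewrite /E mulrCA divff// mulr1 subrK.
have Eb : `|E| * s ^+ 2 <= 100 * K.
  rewrite /E normrM normfV (ger0_norm (ler0n _ _)) -ler_pdivlMr ?exprn_gt0//.
  by rewrite ler_pdivrMr ?ltr0n// mulrC.
have -> : s ^+ 2 * ((2 * d)%:R^-1 * (ker n s * S) - ker n s) + n%:R / 2 * b * ker n s
   = (s ^+ 2 * E + (c2 - c3 * ((1 + 12 * (sqnorm x / d%:R)) / s))) * ker n s.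
  rewrite SE pS natrM -/c1; have -> : b = s - sqnorm x by rewrite /s; ring.
  (* The relation d = n + 2 enters here: the leading terms - c1 / s and 4 c2 |x|^2 / (d s^2) add up
     to - c1 b / s^2. *)
  have -> : c2 = c1 * d%:R / 4 by rewrite /c2 /c1 -addn2 natrD; field.
  field; rewrite gt_eqF//=; have := ler0n R n; lra.
rewrite normrM (gtr0_norm k0) (ler_wpM2r (ltW k0))//.
apply: (le_trans (ler_normD _ _)); rewrite addrC; apply: lerD; last first.
  by rewrite normrM (ger0_norm (sqr_ge0 _)) mulrC.
have c20 : 0 <= c2 by rewrite /c2 divr_ge0// mulr_ge0 ?addr_ge0 ?ler0n.
apply: (le_trans (ler_normB _ _)); rewrite (ger0_norm c20) lerD2l normrM mulrC.
rewrite ler_wpM2r// ger0_norm; last first.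
  by apply: divr_ge0; [apply: addr_ge0 => //; apply: mulr_ge0 => //; exact: divr_ge0 | exact: ltW].
have Nd : sqnorm x / d%:R <= sqnorm x by rewrite ler_pdivrMr ?ltr0n// ler_peMr// ler1n.
have sN : sqnorm x <= s by rewrite /s; lra.
move: Nd; set u := sqnorm x / _ => Nd; rewrite ler_pdivrMr//. lra.
Qed.

End Laplacian.

(** * Superharmonic and subharmonic functions adapted to cubes *)

Section Cube.
Variables (R : realType) (d : nat).
Local Notation V := 'rV[int]_d.
Implicit Types x y : V.

Lemma cubeP r x y :
  cube r x y <-> forall i : 'I_d, (- r%:R <= 2 * ((y 0 i - x 0 i)%:~R : R) < r%:R)%R.
Proof.
split=> h i; have := h i => {h}; set z := (y 0 i - x 0 i) => /andP[h1 h2].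
  have {}h1 : - r%:Z <= 2 * z.
    by rewrite -(ler_int rat) rmorphM rmorphN /=; lra.
  have {}h2 : 2 * z < r%:Z by rewrite -(ltr_int rat) rmorphM /=; lra.
  rewrite -(ler_int R) rmorphM rmorphN /= in h1.
  by rewrite -(ltr_int R) rmorphM /= in h2; rewrite h1 h2.
have {}h1 : - r%:Z <= 2 * z by rewrite -(ler_int R) rmorphM rmorphN /=.
have {}h2 : 2 * z < r%:Z by rewrite -(ltr_int R) rmorphM /=.
by move: h1 h2; rewrite -(ler_int rat) -(ltr_int rat) rmorphM rmorphN /=; lra.
Qed.

Lemma cube_shift r x y : cube r x y <-> cube r 0 (y - x).
Proof. by split=> h i; have := h i; rewrite !mxE subr0. Qed.

Lemma cube0 r : (0 < r)%N -> cube r (0 : V) 0.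
Proof.
move=> r0; apply/cubeP => i; rewrite mxE subrr mulr0 ltr0n r0 andbT.
by rewrite oppr_le0 ler0n.
Qed.

Lemma sqnorm_cube r x : cube r 0 x -> sqnorm R x <= d%:R / 4 * r%:R ^+ 2.
Proof.
move=> /cubeP h; rewrite /sqnorm.
have -> : d%:R / 4 * r%:R ^+ 2 = \sum_(i < d) (r%:R ^+ 2 / 4 : R).
  by rewrite sumr_const card_ord -[RHS]mulr_natl; ring.
apply: ler_sum => i _; have := h i; rewrite mxE subr0.
by set u := _%:~R => /andP[]; nra.
Qed.

Lemma sqnorm_notin_cube r x : ~ cube r 0 x -> r%:R ^+ 2 / 4 <= sqnorm R x.
Proof.
move=> nh; have [i hi] : exists i, ~~ (- r%:R <= 2 * ((x 0 i)%:~R : R) < r%:R)%R.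
  apply: contrapT => /forallNP h; apply: nh; apply/cubeP => i.
  by have /negP := h i; rewrite negbK mxE subr0.
apply: le_trans (sqr_coord_le R x i); move: hi; set u := _%:~R.
have := ler0n R r; rewrite negb_and -ltNge -leNgt => r0 /orP[]; nra.
Qed.

End Cube.

Section SubSuper.
Variables (R : realType) (n : nat).
Hypothesis n_gt0 : (0 < n)%N.
Local Notation d := (n.+2).
Local Notation V := 'rV[int]_d.
Implicit Types x : V.
Local Notation sqnorm := (sqnorm R).
Local Notation f_ b := (fun x => ker n (sqnorm x + b)).

(** Once b >= 4 K, the error in [avg_ker] is at most half of the main term n b / 2, which leaves the
    constants n/4 and 3n/4. *)
Lemma avg_ker_bounds : exists B : R, 1 <= B /\ forall x b, B <= b ->
  f_ b x - 3 * n%:R / 4 * b * (f_ b x / (sqnorm x + b) ^+ 2) <= avg (f_ b) x /\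
  avg (f_ b) x <= f_ b x - n%:R / 4 * b * (f_ b x / (sqnorm x + b) ^+ 2).
Proof.
have [K [B [K0 B1 h]]] := avg_ker R n.
exists (Num.max B (4 * K)); split; first by rewrite le_max B1.
move=> x b; rewrite ge_max => /andP[Bb Kb]; have := h x b Bb.
set s := sqnorm x + b; set k := ker n s; set a := avg _ _.
have s0 : 0 < s by rewrite /s; have := sqnorm_ge0 R x; lra.
have k0 : 0 < k by exact: ker_gt0.
have n1 : (1 : R) <= n%:R by rewrite ler1n.
have aE : a = k + s ^+ 2 * (a - k) / s ^+ 2 by field; lra.
rewrite ler_norml => /andP[]; rewrite [in X in _ -> _ -> X]aE.
set u := s ^+ 2 * (a - k) => u1 u2.
have Kk : K * k <= n%:R / 4 * b * k by rewrite (ler_wpM2r (ltW k0))//; nra.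
split; rewrite !mulrA -?addrA lerD2l.
  rewrite lerNl -mulNr ler_wpM2r ?invr_ge0 ?sqr_ge0//.
  lra.
rewrite -mulNr ler_wpM2r ?invr_ge0 ?sqr_ge0//; lra.
Qed.

(** A shift proportional to r^2 makes s comparable to r^2 on the cube, so the loss r^2 f / s^2 there
    has order r^2 r^(-n) r^(-4) = r^(-d). *)
Lemma superharmonic_ker : exists b c : R, [/\ 1 <= b, 0 < c &
  forall r, (0 < r)%N ->
    let f x := ker n (sqnorm x + b * r%:R ^+ 2) in
    (forall x, avg f x <= f x - c * (f x / (sqnorm x + b * r%:R ^+ 2) ^+ 2)) /\
    (forall x, cube r 0 x -> avg f x <= f x - c / r%:R ^+ d)].
Proof.
have [b [b1 h]] := avg_ker_bounds.
have n1 : (1 : R) <= n%:R by rewrite ler1n.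
pose S : R := d%:R / 4 + b.
have S0 : 0 < S by rewrite /S; have := ler0n R d; lra.
have kS0 : 0 < ker n S by exact: ker_gt0.
pose c := Num.min (n%:R / 4 * b) (n%:R / 4 * b * (ker n S / S ^+ 2)).
have c0 : 0 < c.
  have A : 0 < n%:R / 4 * b by nra.
  by rewrite /c lt_min A mulr_gt0// divr_gt0// exprn_gt0.
exists b, c; split=> // r r0 f.
have r1 : (1 : R) <= r%:R by rewrite ler1n.
have r2 : (1 : R) <= r%:R ^+ 2 by rewrite exprn_ege1.
have br : b <= b * r%:R ^+ 2 by rewrite ler_peMr//; lra.
have nb x := (h x _ br).2.
split=> x.
  apply: le_trans (nb x) _; rewrite lerD2l lerN2 ler_wpM2r//.
    by rewrite divr_ge0 ?ker_ge0 ?sqr_ge0.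
  apply: (@le_trans _ _ (n%:R / 4 * b)); first by rewrite ge_min lexx.
  by rewrite ler_wpM2l ?divr_ge0 ?ler0n//.
move=> /(sqnorm_cube R) xr.
apply: le_trans (nb x) _; rewrite lerD2l lerN2 -/(f x).
set s := sqnorm x + _.
have sS : s <= r%:R ^+ 2 * S by rewrite /s /S; lra.
have s0 : 0 < s by rewrite /s; have := sqnorm_ge0 R x; lra.
have fk : ker n (r%:R ^+ 2 * S) <= f x by exact: le_ker.
rewrite kerM ?sqr_ge0// kerX2 ?ler0n// in fk.
have rS0 : 0 < r%:R ^+ 2 * S by nra.
have sV : (r%:R ^+ 2 * S) ^- 2 <= s ^- 2.
  by rewrite lef_pV2 ?posrE ?exprn_gt0// lerXn2r ?nnegrE ?(ltW s0) ?(ltW rS0).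
apply: (@le_trans _ _ (n%:R / 4 * b * (ker n S / S ^+ 2) / r%:R ^+ d)).
  by rewrite ler_wpM2r ?invr_ge0 ?exprn_ge0 ?ler0n// ge_min lexx orbT.
have -> : n%:R / 4 * b * (ker n S / S ^+ 2) / r%:R ^+ d =
  n%:R / 4 * (b * r%:R ^+ 2) * (r%:R ^- n * ker n S / (r%:R ^+ 2 * S) ^+ 2).
  rewrite -(addn2 n) exprD; field; rewrite gt_eqF//= ?expf_neq0//; lra.
rewrite ler_wpM2l//; first by rewrite mulr_ge0 ?divr_ge0 ?ler0n//; lra.
apply: ler_pM => //; last by rewrite invr_ge0 sqr_ge0.
by rewrite mulr_ge0 ?ker_ge0// invr_ge0 exprn_ge0// ler0n.
Qed.

End SubSuper.

(** * Functions that are subharmonic away from a cube *)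

Section SubharmonicBump.
Variables (R : realType) (n : nat).
Hypothesis n_gt0 : (0 < n)%N.
Local Notation d := (n.+2).
Local Notation V := 'rV[int]_d.
Implicit Types x : V.
Local Notation sqnorm := (sqnorm R).

Lemma avg_gauss (gam : R) x : avg (fun y => expR (- (gam * sqnorm y))) x =
  expR (- (gam * sqnorm x)) * (expR (- gam) / (2 * d)%:R *
    \sum_i (expR (- (2 * gam * (x 0 i)%:~R)) + expR (2 * gam * (x 0 i)%:~R))).
Proof.
rewrite /avg sum_step; under eq_bigr => i _.
  rewrite !sqnorm_step /= expr0 expr1.
  rewrite (_ : - (gam * (sqnorm x + (1 + 2 * 1 * (x 0 i)%:~R))) =
    - (gam * sqnorm x) + - gam + - (2 * gam * (x 0 i)%:~R)); last by ring.
  rewrite (_ : - (gam * (sqnorm x + (1 + 2 * -1 * (x 0 i)%:~R))) =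
    - (gam * sqnorm x) + - gam + (2 * gam * (x 0 i)%:~R)); last by ring.
  rewrite !expRD -mulrDr; over.
by rewrite -mulr_sumr; ring.
Qed.

(** Away from the origin some coordinate has modulus at least 1, and its term exp(2 gam) alone beats
    the prefactor exp(-gam) / (2d). The factor 2 leaves room to repair a bounded failure of
    subharmonicity. *)
Lemma avg_gauss_ge (gam : R) x : ln (4 * d)%:R <= gam -> x != 0 ->
  2 * expR (- (gam * sqnorm x)) <= avg (fun y => expR (- (gam * sqnorm y))) x.
Proof.
move=> gamd /(sqnorm_neq0 R)[i xi]; rewrite avg_gauss mulrC.
have gam0 : 0 <= gam by apply: le_trans gamd; rewrite ln_ge0// ler1n.
rewrite ler_wpM2l ?expR_ge0//.
have d0 : 0 < (2 * d)%:R :> R by rewrite ltr0n.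
rewrite mulrAC ler_pdivlMr// (bigD1 i)//=.
apply: (@le_trans _ _ (expR (- gam) *
  (expR (- (2 * gam * (x 0 i)%:~R)) + expR (2 * gam * (x 0 i)%:~R)))); last first.
  rewrite ler_wpM2l ?expR_ge0// lerDl; apply: sumr_ge0 => j _.
  by rewrite addr_ge0 ?expR_ge0.
apply: (@le_trans _ _ (expR (- gam) * expR (2 * gam))).
  rewrite -expRD (_ : - gam + 2 * gam = gam); last by ring.
  by rewrite -natrM -(@lnK R (2 * (2 * d))%:R) ?posrE ?ltr0n// ler_expR mulnA.
rewrite ler_wpM2l ?expR_ge0//.
have e1 := expR_ge0 (- (2 * gam * (x 0 i)%:~R)).
have e2 := expR_ge0 (2 * gam * (x 0 i)%:~R).
move: xi; rewrite ler_normr => /orP[xi|xi].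
  by rewrite -[leLHS]add0r lerD// ler_expR; nra.
by rewrite -[leLHS]addr0 lerD// ler_expR; nra.
Qed.

(* Scaling [b] by [J] makes the second term dominate the Laplacian of the
   difference outside the ball of squared radius [J * b]. *)
Lemma ker_difference : exists b J : R, [/\ 1 <= b, 24 <= J &
  forall b', b <= b' ->
  let f x := ker n (sqnorm x + b') in
  let G x := f x - ker n (sqnorm x + J * b') / 2 in
  [/\ forall x, f x / 2 <= G x <= f x,
     forall x, J * b' <= sqnorm x -> G x <= avg G x &
     forall x, G x - 3 * n%:R / 4 * (ker n b' / b') <= avg G x]].
Proof.
have [b [b1 h]] := avg_ker_bounds R n_gt0.
have n1 : (1 : R) <= n%:R by rewrite ler1n.
have k2 : 0 < ker n (2 : R) by exact: ker_gt0.
have k21 : ker n (2 : R) <= 1 by rewrite -[leRHS](ker1 R n); apply: le_ker; lra.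
(* As t <= 2 s outside the ball, half the wide kernel gains n J b' / 8 times at least (ker n 2 / 4)
   f / s^2; this J turns the product into 3 n b' / 4, the worst loss of the narrow kernel. *)
pose J : R := 24 / ker n 2.
have J24 : 24 <= J by rewrite /J ler_pdivlMr//; lra.
have N0 x : 0 <= sqnorm x by exact: sqnorm_ge0.
pose f b x := ker n (sqnorm x + b).
pose G b x := f b x - f (J * b) x / 2.
have fle b' x : b <= b' -> 0 <= f (J * b') x <= f b' x.
  by move=> bb; rewrite /f ker_ge0 le_ker//; have := N0 x; nra.
have Gge b' x : b <= b' -> f b' x / 2 <= G b' x <= f b' x.
  by move=> bb; have /andP[] := fle b' x bb; rewrite /G; lra.
have Gsub b' x : b <= b' -> J * b' <= sqnorm x -> G b' x <= avg (G b') x.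
  move=> bb Jx; rewrite /G avgB -/(f b').
  have -> : avg (fun y => f (J * b') y / 2) x = avg (f (J * b')) x / 2.
    by rewrite [RHS]mulrC -avgZ; apply: eq_avg => y; rewrite mulrC.
  have [l1 _] := h x b' bb.
  have bJ : b <= J * b' by nra.
  have [_ l2] := h x (J * b') bJ.
  rewrite -!/(f _ _) in l1 l2.
  set s := sqnorm x + b' in l1 *; set t := sqnorm x + J * b' in l2 *.
  have s0 : 0 < s by rewrite /s; have := N0 x; lra.
  have ts : t <= 2 * s by rewrite /s /t; lra.
  have t0 : 0 < t by rewrite /t; have := N0 x; lra.
  have key : ker n 2 / 4 * (f b' x / s ^+ 2) <= f (J * b') x / t ^+ 2.
    have -> : ker n 2 / 4 * (f b' x / s ^+ 2) = ker n (2 * s) / (2 * s) ^+ 2.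
      by rewrite kerM//; rewrite /f -/s; field; lra.
    apply: ler_pM; rewrite ?ker_ge0 ?invr_ge0 ?sqr_ge0//; first exact: le_ker.
    by rewrite lef_pV2 ?posrE ?exprn_gt0 ?mulr_gt0// lerXn2r ?nnegrE ?(ltW t0)//; lra.
  have A0 : 0 <= n%:R / 4 * (J * b') / 2 by nra.
  have := ler_wpM2l A0 key.
  have -> : n%:R / 4 * (J * b') / 2 * (ker n 2 / 4 * (f b' x / s ^+ 2)) =
     3 * n%:R / 4 * b' * (f b' x / s ^+ 2).
    by rewrite /J; field; rewrite !gt_eqF.
  move: l1 l2; rewrite -/(f b') -/(f (J * b')).
  set u1 := 3 * n%:R / 4 * b' * _; set u2 := n%:R / 4 * (J * b') * (_ / _).
  have -> : n%:R / 4 * (J * b') / 2 * (f (J * b') x / t ^+ 2) = u2 / 2.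
    by rewrite /u2; ring.
  lra.
have Gloss b' x : b <= b' ->
    G b' x - 3 * n%:R / 4 * (ker n b' / b') <= avg (G b') x.
  move=> bb; rewrite /G avgB -/(f b').
  have -> : avg (fun y => f (J * b') y / 2) x = avg (f (J * b')) x / 2.
    by rewrite [RHS]mulrC -avgZ; apply: eq_avg => y; rewrite mulrC.
  have [l1 _] := h x b' bb.
  have bJ : b <= J * b' by nra.
  have [_ l2] := h x (J * b') bJ.
  have l2' : avg (f (J * b')) x <= f (J * b') x.
    apply: le_trans l2 _; rewrite gerBl mulr_ge0//; first by nra.
    by rewrite divr_ge0 ?ker_ge0 ?sqr_ge0.
  set s := sqnorm x + b' in l1 *.
  have s0 : 0 < s by rewrite /s; have := N0 x; lra.
  have bs : b' <= s by rewrite /s; have := N0 x; lra.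
  have : 3 * n%:R / 4 * b' * (f b' x / s ^+ 2) <= 3 * n%:R / 4 * (ker n b' / b').
    have -> : 3 * n%:R / 4 * (ker n b' / b') = 3 * n%:R / 4 * b' * (ker n b' / b' ^+ 2).
      by field; lra.
    rewrite ler_wpM2l//; first by nra.
    apply: ler_pM; rewrite ?ker_ge0 ?invr_ge0 ?sqr_ge0//; first by apply: le_ker => //; lra.
    rewrite lef_pV2 ?posrE ?exprn_gt0//; try lra.
    by rewrite lerXn2r ?nnegrE//; lra.
  move: l1 l2'; rewrite -/(f b' x) -/(f b').
  lra.
exists b, J; split=> // b' bb; split=> x; first exact: Gge.
  exact: Gsub.
exact: Gloss.
Qed.

(** For r^2 >= q, [ker_difference] with b' = r^2 / (4 J) can fail to be subharmonic only in the ball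
    of radius r / 2, inside the cube. The remaining r are bounded: there b is fixed, and a steep
    Gaussian, subharmonic off the origin, compensates the failure in the ball of squared radius J
    b. *)
Lemma subharmonic_bump : exists C1 c2 C2 : R, [/\ 0 < C1, 0 < c2, 0 < C2 &
  forall r, (0 < r)%N -> exists g : V -> R,
    [/\ forall x, ~ cube r 0 x -> g x <= avg g x,
        forall x, g x - C1 / r%:R ^+ d <= avg g x,
        forall x, c2 * ker n (sqnorm x + r%:R ^+ 2) <= g x &
        forall x, g x <= C2 * ker n (sqnorm x + r%:R ^+ 2)]].
Proof.
have [b [J [b1 J24 h]]] := ker_difference.
have n1 : (1 : R) <= n%:R by rewrite ler1n.
have N0 x : 0 <= sqnorm x by exact: sqnorm_ge0.
pose f b x := ker n (sqnorm x + b).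
pose G b x := f b x - f (J * b) x / 2.
have Gge b' x : b <= b' -> f b' x / 2 <= G b' x <= f b' x.
  by move=> /h[Gge _ _]; exact: Gge.
have Gsub b' x : b <= b' -> J * b' <= sqnorm x -> G b' x <= avg (G b') x.
  by move=> /h[_ Gsub _]; exact: Gsub.
have Gloss b' x : b <= b' ->
    G b' x - 3 * n%:R / 4 * (ker n b' / b') <= avg (G b') x.
  by move=> /h[_ _ Gloss]; exact: Gloss.
pose J4 := 4 * J.
have J40 : 0 < J4 by rewrite /J4; lra.
have J41 : 1 <= J4 by rewrite /J4; lra.
have kJ : 0 < ker n J4^-1 by rewrite ker_gt0 ?invr_gt0.
have kb : 0 < ker n b by apply: ker_gt0; lra.
(* At least ln (4 d) for [avg_gauss_ge], and at least n so that the Gaussian stays below the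
   kernel. *)
pose gam : R := ln (4 * d)%:R + n%:R.
have gamd : ln (4 * d)%:R <= gam by rewrite /gam lerDl ler0n.
have gamn : n%:R <= gam by rewrite /gam lerDr ln_ge0// ler1n.
(* Makes M e at least n where |x|^2 < J b, more than the loss, which is at most 3 n / 4. *)
pose M : R := n%:R * expR (gam * (J * b)).
have M0 : 0 < M by rewrite mulr_gt0 ?expR_gt0//; lra.
pose e x := expR (- (gam * sqnorm x)).
pose q := J4 * b.
have q0 : 0 < q by rewrite /q /J4; nra.
have q1 : 1 <= q by rewrite /q /J4; nra.
pose C1 := Num.max (3 * n%:R * J * ker n J4^-1) ((3 * n%:R / 4 + M) * q ^+ d).
pose c2 := Num.min (1/2) (ker n b / 2).
pose C2 := Num.max (ker n J4^-1) (ker n q^-1 * (1 + M)).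
have kq : 0 < ker n q^-1 by rewrite ker_gt0 ?invr_gt0.
exists C1, c2, C2; split.
- by rewrite /C1 lt_max; apply/orP; left; apply: mulr_gt0 => //; apply: mulr_gt0; lra.
- by rewrite /c2 lt_min; apply/andP; split; lra.
- by rewrite /C2 lt_max kJ.
move=> r r0.
have r1 : (1 : R) <= r%:R by rewrite ler1n.
have rr1 : (1 : R) <= r%:R ^+ 2 by rewrite exprn_ege1.
have rd : 0 < (r%:R : R) ^+ d by rewrite exprn_gt0//; lra.
have [rbig|rsmall] := lerP q (r%:R ^+ 2).
  pose b' := r%:R ^+ 2 / J4.
  have bb : b <= b' by rewrite /b' ler_pdivlMr// mulrC.
  have b'r : b' <= r%:R ^+ 2 by rewrite /b' ler_pdivrMr// ler_peMr//; lra.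
  exists (G b'); split.
  - move=> x /(sqnorm_notin_cube R) xr; apply: Gsub => //.
    by have -> : J * b' = r%:R ^+ 2 / 4 by rewrite /b' /J4; field; lra.
  - move=> x; apply: le_trans (Gloss b' x bb); rewrite lerD2l lerN2.
    have -> : 3 * n%:R / 4 * (ker n b' / b') =
        3 * n%:R * J * ker n J4^-1 / r%:R ^+ d.
      rewrite /b' kerM ?sqr_ge0// kerX2 ?ler0n// -(addn2 n) exprD.
      by rewrite /J4; field; rewrite expf_neq0//=; lra.
    by rewrite ler_wpM2r ?invr_ge0 ?(ltW rd)// le_max lexx.
  - move=> x; have /andP[Gf _] := Gge b' x bb; apply: le_trans Gf.
    have : ker n (sqnorm x + r%:R ^+ 2) <= f b' x.
      by apply: le_ker; have := N0 x; lra.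
    have := ker_ge0 n (sqnorm x + r%:R ^+ 2 : R).
    have : c2 <= 1/2 by rewrite /c2 ge_min lexx.
    nra.
  - move=> x; have /andP[_ Gf] := Gge b' x bb; apply: le_trans Gf _.
    apply: (@le_trans _ _ (ker n J4^-1 * ker n (sqnorm x + r%:R ^+ 2))).
      rewrite -kerM ?invr_ge0 ?(ltW J40)//.
      apply: le_ker; have := N0 x; rewrite mulrC => Nx.
        by rewrite mulr_gt0 ?invr_gt0//; lra.
      by rewrite ler_pdivrMr// /b' mulrDl divfK ?gt_eqF//; nra.
    by rewrite ler_wpM2r ?ker_ge0// le_max lexx.
have rsq : r%:R <= q.
  by apply: le_trans _ (ltW rsmall); rewrite expr2 ler_peMl//; lra.
have fl x : f b x <= ker n (sqnorm x + 1).
  by apply: le_ker; have := N0 x; lra.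
have el x : e x <= ker n (sqnorm x + 1).
  rewrite /e expRN; set N := sqnorm x; have Nx : 0 <= N by exact: N0.
  have N1 : 1 <= N + 1 by lra.
  have s1 : 1 <= Num.sqrt (N + 1) by rewrite -[leLHS]sqrtr1 ler_wsqrtr.
  have sN : Num.sqrt (N + 1) <= N + 1.
    rewrite -[leRHS]ger0_norm ?(le_trans _ N1)// -sqrtr_sqr ler_wsqrtr//.
    by rewrite expr2 ler_peMl//; lra.
  rewrite /ker exprVn lef_pV2 ?posrE ?expR_gt0 ?exprn_gt0//; last by lra.
  apply: (@le_trans _ _ ((N + 1) ^+ n)); first by rewrite lerXn2r ?nnegrE//; lra.
  apply: (@le_trans _ _ (expR N ^+ n)).
    rewrite lerXn2r ?nnegrE ?expR_ge0 ?(le_trans _ N1)// addrC; exact: expR_ge1Dx.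
  by rewrite -expRM_natl ler_expR ler_wpM2r.
have kk x : ker n (sqnorm x + 1) <= ker n q^-1 * ker n (sqnorm x + r%:R ^+ 2).
  rewrite -kerM ?invr_ge0 ?(ltW q0)//; apply: le_ker; rewrite mulrC.
    by rewrite mulr_gt0 ?invr_gt0//; have := N0 x; lra.
  by rewrite ler_pdivrMr//; have := N0 x; nra.
have eG x : avg (fun y => G b y + M * e y) x = avg (G b) x + M * avg e x.
  by rewrite avgD avgZ.
have e0 x : 0 <= e x by exact: expR_ge0.
have e1 x : e x <= 1 by rewrite -expR0 ler_expR; have := N0 x; nra.
have kbb : ker n b / b <= 1.
  have kb1 : ker n b <= ker n 1 by exact: le_ker.
  by rewrite ker1 in kb1; rewrite ler_pdivrMr ?mul1r; lra.
have kbb0 : 0 <= ker n b / b by rewrite divr_ge0 ?ker_ge0//; lra.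
exists (fun x => G b x + M * e x); split.
- move=> x xr; rewrite eG.
  have x0 : x != 0 by apply/eqP => xE; apply: xr; rewrite xE; exact: cube0.
  have ge := avg_gauss_ge gamd x0; rewrite -/(e x) -/e in ge.
  have [Jx|xJ] := lerP (J * b) (sqnorm x).
    by have := Gsub b x (lexx b) Jx; have := e0 x; nra.
  have Me : n%:R <= M * e x.
    rewrite /M /e -mulrA -expRD ler_peMr ?ler0n// -expR0 ler_expR.
    have g0 : 0 <= gam by lra.
    by have := ler_wpM2l g0 (ltW xJ); lra.
  have := Gloss b x (lexx b); nra.
- move=> x; rewrite eG.
  have := Gloss b x (lexx b).
  have : 3 * n%:R / 4 + M <= C1 / r%:R ^+ d.
    rewrite ler_pdivlMr//.
    apply: (@le_trans _ _ ((3 * n%:R / 4 + M) * q ^+ d)).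
      by rewrite ler_wpM2l ?lerXn2r ?nnegrE//; lra.
    by rewrite le_max lexx orbT.
  have := e1 x; have : 0 <= avg e x by exact: avg_ge0.
  set c := C1 / _; nra.
- move=> x; have /andP[Gf _] := Gge b x (lexx b).
  apply: (@le_trans _ _ (G b x)); last by rewrite lerDl mulr_ge0// ltW.
  apply: le_trans Gf.
  have : ker n b * ker n (sqnorm x + r%:R ^+ 2) <= f b x.
    rewrite -kerM; last by lra.
    by apply: le_ker; have := N0 x; nra.
  have : c2 <= ker n b / 2 by rewrite /c2 ge_min lexx orbT.
  have := ker_ge0 n (sqnorm x + r%:R ^+ 2 : R).
  nra.
- move=> x; have /andP[_ Gf] := Gge b x (lexx b).
  apply: (@le_trans _ _ (ker n q^-1 * (1 + M) * ker n (sqnorm x + r%:R ^+ 2))).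
    rewrite [leRHS]mulrAC; apply: (@le_trans _ _ (ker n (sqnorm x + 1) * (1 + M))).
      rewrite mulrDr mulr1; apply: lerD; first exact: le_trans Gf (fl x).
      by rewrite [leRHS]mulrC ler_wpM2l// ltW.
    by rewrite ler_wpM2r// addr_ge0// ltW.
  by rewrite ler_wpM2r ?ker_ge0// le_max lexx orbT.
Qed.

End SubharmonicBump.

(** * Expectations along the walk *)

Section WalkMean.
Variables (R : realType) (d : nat).
Hypothesis d_gt0 : (0 < d)%N.
Local Notation V := 'rV[int]_d.
Implicit Types (F G : seq V -> R) (x y z : V) (s : seq V).

(* Expectation of [F [:: S_0; ...; S_n]] for the walk started at [x]. *)
Fixpoint walk_mean n F x : R :=
  if n is n'.+1 then avg (walk_mean n' (fun s => F (x :: s))) x else F [:: x].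

(** What is retained about the paths averaged by [walk_mean]: the length, and a box around the start
    that makes the union over cubes finite. *)
Definition near_path n x s :=
  size s = n.+1 /\ forall z, z \in s -> forall i, `|z 0 i - x 0 i| <= n%:Z.

Lemma near_path_step n x e s :
  near_path n (x + unit_step e) s -> near_path n.+1 x (x :: s).
Proof.
move=> [ss h]; split=> [|z]; first by rewrite /= ss.
rewrite inE => /predU1P[-> i|/h{}h i]; first by rewrite subrr normr0.
rewrite (_ : z 0 i - x 0 i = (z 0 i - (x + unit_step e) 0 i) + unit_step e 0 i).
  apply: (le_trans (ler_normD _ _)); rewrite -(addn1 n) PoszD lerD ?h//.
  by rewrite mxE normrMn normrX normrN1 expr1n; case: (_ == _).
by rewrite [(x + _) 0 i]mxE; ring.
Qed.

Lemma le_walk_mean_in n F G x : (forall s, near_path n x s -> F s <= G s) ->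
  walk_mean n F x <= walk_mean n G x.
Proof.
elim: n F G x => [|n IH] F G x h /=.
  apply: h; split=> // z; rewrite inE => /eqP -> i.
  by rewrite subrr normr0.
rewrite /avg ler_wpM2l ?invr_ge0 ?ler0n//; apply: ler_sum => e _.
apply: IH => s /near_path_step; exact: h.
Qed.

Lemma le_walk_mean n F G x : (forall s, F s <= G s) ->
  walk_mean n F x <= walk_mean n G x.
Proof. by move=> h; apply: le_walk_mean_in => s _; exact: h. Qed.

Lemma eq_walk_mean_in n F G x : (forall s, near_path n x s -> F s = G s) ->
  walk_mean n F x = walk_mean n G x.
Proof.
by move=> h; apply/eqP; rewrite eq_le; apply/andP; split; apply: le_walk_mean_in
  => s hs; rewrite h.
Qed.

Lemma eq_walk_mean n F G x : F =1 G -> walk_mean n F x = walk_mean n G x.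
Proof. by move=> h; apply: eq_walk_mean_in => s _; exact: h. Qed.

Lemma walk_meanZ n (c : R) F x :
  walk_mean n (fun s => c * F s) x = c * walk_mean n F x.
Proof.
elim: n F x => [|n IH] F x //=.
by rewrite -avgZ; apply: eq_avg => y; rewrite IH.
Qed.

Lemma walk_meanD n F G x :
  walk_mean n (fun s => F s + G s) x = walk_mean n F x + walk_mean n G x.
Proof.
elim: n F G x => [|n IH] F G x //=.
by rewrite -avgD; apply: eq_avg => y; rewrite IH.
Qed.

Lemma walk_mean_cst n (c : R) x : walk_mean n (fun=> c) x = c.
Proof.
elim: n x => [|n IH] x //=.
by rewrite (eq_avg (g := fun=> c)) ?avg_cst// => y; exact: IH.
Qed.

Lemma walk_mean_sum n I (r : seq I) (F : I -> seq V -> R) x :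
  walk_mean n (fun s => \sum_(i <- r) F i s) x =
  \sum_(i <- r) walk_mean n (F i) x.
Proof.
elim: r => [|i r IH].
  rewrite big_nil (@eq_walk_mean n _ (fun=> 0)) ?walk_mean_cst// => s.
  by rewrite big_nil.
rewrite big_cons -IH -walk_meanD; apply: eq_walk_mean => s.
by rewrite big_cons.
Qed.

Lemma walk_mean_ge0 n F x : (forall s, 0 <= F s) -> 0 <= walk_mean n F x.
Proof. by move=> h; rewrite -[leLHS](walk_mean_cst n 0 x); exact: le_walk_mean. Qed.

(** A Feynman-Kac weight: a multiplicative potential along the whole path, last site included, and a
    terminal function. *)
Definition tilt (w g : V -> R) s : R := (\prod_(z <- s) w z) * g (last 0 s).

Lemma walk_mean_tiltS n (w g : V -> R) x :
  walk_mean n.+1 (tilt w g) x = w x * avg (walk_mean n (tilt w g)) x.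
Proof.
rewrite -avgZ; apply: eq_avg => y; rewrite -walk_meanZ.
apply: eq_walk_mean_in => -[|a s] [// _ _].
by rewrite /tilt big_cons mulrA.
Qed.

(** The supersolution inequality gains a factor c per site. Since the last site also carries w, the
    terminal function is compared with avg psi and not with psi. *)
Lemma walk_mean_tilt_le n (w g psi : V -> R) (c : R) x :
  (forall y, 0 <= w y) -> 0 <= c -> (forall y, g y <= avg psi y) ->
  (forall y, w y * avg psi y <= c * psi y) ->
  walk_mean n (tilt w g) x <= c ^+ n.+1 * psi x.
Proof.
move=> w0 c0 gpsi wpsi; elim: n x => [|n IH] x.
  rewrite /= /tilt big_seq1 /= expr1.
  by apply: le_trans (wpsi x); rewrite ler_wpM2l.
rewrite walk_mean_tiltS; apply: (@le_trans _ _ (w x * avg (fun y => c ^+ n.+1 * psi y) x)).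
  by rewrite ler_wpM2l//; apply: le_avg => y; exact: IH.
by rewrite avgZ mulrCA [c ^+ n.+2]exprSr -mulrA ler_wpM2l// exprn_ge0.
Qed.

(** With w = h / avg h, the weight divided by h x is the density of the Doob transform by h, of
    total mass 1. *)
Lemma walk_mean_tilt_eq n (w h : V -> R) x :
  (forall y, w y * avg h y = h y) ->
  walk_mean n (tilt w (avg h)) x = h x.
Proof.
move=> wh; elim: n x => [|n IH] x; first by rewrite /= /tilt big_seq1 /= wh.
by rewrite walk_mean_tiltS (eq_avg (g := h)).
Qed.

End WalkMean.

(** * The law of finite trajectories as a path average *)

Section Law.
Variables (R : realType) (d : nat).
Hypothesis d_gt0 : (0 < d)%N.
Variable W : simple_random_walk R d.
Local Notation V := 'rV[int]_d.
Implicit Types (x y z : V) (s : seq V) (w : srw_space W).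

Definition traj n w : seq V := [seq srw_pos k w | k <- iota 0 n.+1].

Lemma size_traj n w : size (traj n w) = n.+1.
Proof. by rewrite size_map size_iota. Qed.

Lemma nth_traj n w k : (k <= n)%N -> nth 0 (traj n w) k = srw_pos k w.
Proof. by move=> kn; rewrite (nth_map 0%N) ?size_iota// nth_iota. Qed.

Lemma trajE n s : size s = n.+1 ->
  [set w | traj n w = s] =
  [set w | forall k, (k <= n)%N -> srw_pos k w = nth 0 s k].
Proof.
move=> ss; apply/seteqP; split=> w /= h.
  by move=> k kn; rewrite -h nth_traj.
apply: (@eq_from_nth _ 0); first by rewrite size_traj ss.
by move=> k; rewrite size_traj ltnS => kn; rewrite nth_traj// h.
Qed.

Lemma measurable_traj n s : measurable [set w | traj n w = s].
Proof.
have [ss|ss] := eqVneq (size s) n.+1; last first.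
  rewrite (_ : [set _ | _] = set0) ?measurable0//.
  by apply/seteqP; split=> // w /= h; rewrite -h size_traj eqxx in ss.
rewrite trajE//.
have -> : [set w | forall k, (k <= n)%N -> srw_pos k w = nth 0 s k] =
   \bigcap_(k in [set k | (k <= n)%N]) (srw_pos k @^-1` [set nth 0 s k] : set (srw_space W)).
  by apply/seteqP; split=> w /= h k kn; exact: h.
by apply: bigcap_measurableType => k _; exact: srw_measurable.
Qed.

Lemma measurable_traj_event n (Q : set (seq V)) :
  measurable [set w | Q (traj n w)].
Proof.
have -> : [set w | Q (traj n w)] =
    \bigcup_(s : seq V) [set w | traj n w = s /\ Q s].
  by apply/seteqP; split=> w /= => [Qw|[s _ [->]]//]; exists (traj n w).
apply: countable_bigcupT_measurable => [|s]; first exact: countableP.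
have [Qs|Qs] := pselect (Q s).
  rewrite (_ : [set w | _] = [set w | traj n w = s]); first exact: measurable_traj.
  by apply/seteqP; split=> w /= => [[]|].
by rewrite (_ : [set w | _] = set0)//; apply/seteqP; split=> w /= => [[]|].
Qed.

Fixpoint paths n x : seq (seq V) :=
  if n is n'.+1 then
    flatten [seq [seq x :: s | s <- paths n' (x + unit_step e)] |
              e <- index_enum ('I_d * bool)%type]
  else [:: [:: x]].

Lemma unit_step_inj : injective (@unit_step d).
Proof.
move=> [i b] [j c] /rowP h; have := h i; rewrite !mxE /= eqxx mulr1n.
have [<-|] := eqVneq i j; rewrite ?mulr1n ?mulr0n.
  by case: b {h}; case: c => //; rewrite ?expr1 ?expr0.
by case: b {h}; rewrite ?expr1 ?expr0.
Qed.

Lemma head_paths n x s : s \in paths n x -> head 0 s = x.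
Proof.
case: n => [|n] /=; first by rewrite inE => /eqP ->.
by case/flatten_mapP => e _ /mapP[t _ ->].
Qed.

Lemma size_paths n x s : s \in paths n x -> size s = n.+1.
Proof.
elim: n x s => [|n IH] x s /=; first by rewrite inE => /eqP ->.
by case/flatten_mapP => e _ /mapP[t /IH <- ->].
Qed.

Lemma uniq_paths n x : uniq (paths n x).
Proof.
elim: n x => [|n IH] x //=.
have := index_enum_uniq ('I_d * bool)%type; elim: (index_enum _) => //= e l IHl.
move=> /andP[el ul]; rewrite cat_uniq IHl// andbT; apply/andP; split.
  by rewrite map_inj_uniq// => s t [].
apply/hasPn => s /flatten_mapP[e' e'l /mapP[t tp ->]].
apply/negP => /mapP[t' t'p [tt']]; subst t'.
have := head_paths tp; rewrite (head_paths t'p) => /addrI /unit_step_inj ee.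
by rewrite ee e'l in el.
Qed.

Lemma srw_step_unit x e : srw_step R x (x + unit_step e) = (2 * d)%:R^-1.
Proof.
rewrite /srw_step (_ : \sum_(i < d) _ = 1) ?eqxx// (bigD1 e.1)//= big1.
  rewrite addr0 !mxE eqxx mulr1n addrAC subrr add0r.
  by rewrite normrX normrN1 expr1n.
by move=> i /negPf ie; rewrite !mxE ie mulr0n addr0 subrr normr0.
Qed.

Lemma law_path n x s : s \in paths n x ->
  srw_law W x [set w | traj n w = s] = ((2 * d)%:R ^- n)%:E.
Proof.
move=> sp; rewrite trajE ?(size_paths sp)// srw_fdd; congr EFin.
rewrite nth0 (head_paths sp) eqxx mul1r.
elim: n x s sp => [|n IH] x s /=.
  by rewrite inE => /eqP ->; rewrite big_ord0 expr0 invr1.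
case/flatten_mapP => e _ /mapP[t tp ->].
rewrite big_ord_recl /= nth0 (head_paths tp) srw_step_unit.
by rewrite (IH _ _ tp) exprS invfM.
Qed.

Lemma walk_mean_paths n (F : seq V -> R) x :
  walk_mean n F x = (2 * d)%:R ^- n * \sum_(s <- paths n x) F s.
Proof.
elim: n F x => [|n IH] F x /=.
  by rewrite big_seq1 expr0 invr1 mul1r.
rewrite /avg (eq_bigr _ (fun e _ => IH _ _)).
rewrite -mulr_sumr mulrA exprS invfM; congr (_ * _).
rewrite big_flatten big_map; apply: eq_bigr => e _.
by rewrite big_map.
Qed.

(** Sums the probabilities (2d)^(-n) of the enumerated paths satisfying Q; that no other path is
    charged is not known yet. *)
Lemma law_traj_ge n x (Q : set (seq V)) :
  ((walk_mean n (fun s => `[< Q s >]%:R) x)%:E <=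
   srw_law W x [set w | Q (traj n w)])%E.
Proof.
rewrite walk_mean_paths mulr_sumr.
have : {subset paths n x <= paths n x} by [].
have := uniq_paths n x; move: {1 2 4}(paths n x) => l ul lp.
suff : (\sum_(s <- l) (2 * d)%:R ^- n * `[< Q s >]%:R)%:E =
   srw_law W x [set w | Q (traj n w) /\ traj n w \in l].
  move=> ->; apply: le_measure; rewrite ?inE; last by move=> w /= [].
    exact: (@measurable_traj_event n [set s | Q s /\ s \in l]).
  exact: measurable_traj_event.
elim: l ul lp => [_ _|s l IH /= /andP[sl ul] lp].
  rewrite big_nil (_ : [set w | _] = set0) ?measure0//.
  by apply/seteqP; split=> w /= => [[]|].
rewrite big_cons EFinD IH//; last by move=> t tl; rewrite lp// inE tl orbT.
have -> : [set w | Q (traj n w) /\ traj n w \in s :: l] =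
  [set w | Q s /\ traj n w = s] `|` [set w | Q (traj n w) /\ traj n w \in l].
  apply/seteqP; split=> w /=.
    move=> [Qw]; rewrite inE => /predU1P[ws|wl]; last by right.
    by left; rewrite -ws.
  by move=> [[Qs ->]|[Qw wl]]; rewrite inE ?eqxx ?wl ?orbT.
rewrite measureU.
- congr (_ + _)%E; case: asboolP => Qs.
    rewrite mulr1 -(law_path (lp s _)) ?inE ?eqxx//.
    by congr (srw_law _ _ _); apply/seteqP; split=> w /= => [|[]].
  rewrite mulr0 (_ : [set w | _] = set0) ?measure0//.
  by apply/seteqP; split=> w /= => [[]|].
- exact: (@measurable_traj_event n [set t | Q s /\ t = s]).
- exact: (@measurable_traj_event n [set s | Q s /\ s \in l]).
- apply/seteqP; split=> w //= [[_ ws] [_]].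
  by rewrite ws (negbTE sl).
Qed.

(** The lower bounds for Q and for its complement add up to 1, which forces equality in both. *)
Lemma law_traj n x (Q : set (seq V)) :
  srw_law W x [set w | Q (traj n w)] =
  (walk_mean n (fun s => `[< Q s >]%:R) x)%:E.
Proof.
apply/eqP; rewrite eq_le law_traj_ge andbT.
have := law_traj_ge n x (~` Q).
have -> : [set w | (~` Q) (traj n w)] = ~` [set w | Q (traj n w)] by [].
rewrite probability_setC; last exact: measurable_traj_event.
have -> : walk_mean n (fun s => `[< (~` Q) s >]%:R) x =
   1 - walk_mean n (fun s => `[< Q s >]%:R) x :> R.
  rewrite -[X in _ = X - _](walk_mean_cst d_gt0 n 1 x) -[X in _ = _ - X]mul1r -mulNr.
  rewrite -walk_meanZ -walk_meanD; apply: eq_walk_mean => s.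
  have [Qs|Qs] := pselect (Q s).
    rewrite (asboolT Qs) (asboolF (fun nQ : (~` Q) s => nQ Qs)) /=.
    by rewrite mulN1r subrr.
  by rewrite (asboolF Qs) (asboolT (Qs : (~` Q) s)) /= mulr0 addr0.
have : srw_law W x [set w | Q (traj n w)] \is a fin_num.
  by apply: fin_num_measure; exact: measurable_traj_event.
move: (srw_law _ _ _) => [p| |]//= _.
by rewrite -EFinB !lee_fin; lra.
Qed.

End Law.

(** * Equilibrium measure and capacity *)

Section Equilibrium.
Variables (R : realType) (n : nat).
Hypothesis n_gt0 : (0 < n)%N.
Local Notation d := (n.+2).
Local Notation V := 'rV[int]_d.
Implicit Types (x y z : V) (s : seq V) (F : V -> R).
Local Notation sqnorm := (sqnorm R).
Let d_gt0 : (0 < d)%N. Proof. by []. Qed.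

Section Escape.
Variable L : set V.

Definition avoids s := all (fun z => z \notin L) s.
Definition no_hit m : V -> R := walk_mean m (fun s => (avoids s)%:R).
(** [behead] forgets the starting point, as a return time only looks at times n >= 1. *)
Definition escape m : V -> R := walk_mean m (fun s => (avoids (behead s))%:R).

Lemma escapeS m x : escape m.+1 x = avg (no_hit m) x.
Proof. by []. Qed.

Lemma no_hitS m x : no_hit m.+1 x = (x \notin L)%:R * avg (no_hit m) x.
Proof.
rewrite /no_hit /= -avgZ; apply: eq_avg => y; rewrite -walk_meanZ.
by apply: eq_walk_mean => s; rewrite /avoids /= -mulnb natrM.
Qed.

(** The Green potential truncated at time m: the sum of the iterates avg^k F over k <= m. *)
Fixpoint potential m F x : R :=
  if m is m'.+1 then F x + avg (potential m' F) x else F x.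

(* Decompose according to the last visit to [L] before time [m]. *)
Lemma potential_le1 (e : V -> R) : (forall m x, x \in L -> e x <= escape m x) ->
  (forall x, x \notin L -> e x = 0) ->
  forall m x, potential m e x <= 1 - no_hit m x.
Proof.
move=> eL e0; elim=> [|m IH] x.
  rewrite /= /no_hit /= /avoids /= andbT.
  have [xL|xL] := boolP (x \in L); first by rewrite subr0 (eL 0%N).
  by rewrite e0// subrr.
have avIH : avg (potential m e) x <= 1 - avg (no_hit m) x.
  rewrite -[X in X - _](avg_cst d_gt0 1 x) -avgB; exact: le_avg.
rewrite no_hitS /=; have [xL|xL] /= := boolP (x \in L).
  by rewrite mul0r subr0; have := eL m.+1 x xL; rewrite escapeS; lra.
by rewrite mul1r e0// add0r.
Qed.

Lemma no_hit_ge0 m x : 0 <= no_hit m x.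
Proof. by apply: walk_mean_ge0 => // s; rewrite ler0n. Qed.

Lemma escape_probability_le (W : simple_random_walk R d) m x :
  0 <= fine (srw_law W x [set w | return_time L w = +oo%E]) <= escape m x.
Proof.
pose A k := [set w : srw_space W | avoids (behead (traj k w))].
have retE : [set w : srw_space W | return_time L w = +oo%E] = \bigcap_k A k.
  apply/seteqP; split=> w /=.
    move=> rt k _; apply/allP => z zt; apply/negP; rewrite inE => zL.
    have [j jk zE] : exists2 j, (j < k)%N & z = srw_pos j.+1 w.
      move/(nthP 0): zt => [j]; rewrite size_behead size_traj => jk.
      by rewrite nth_behead nth_traj// => <-; exists j.
    suff : (return_time L w <= j.+1%:R%:E)%E by rewrite rt leye_eq.
    by apply: ereal_inf_lbound; exists j.+1 => //=; split=> //; rewrite -zE.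
  move=> h; apply/ereal_inf_pinfty => _ /= [j [j0 Lj] <-]; exfalso.
  case: j j0 Lj => // j _ Lj.
  have hj : srw_pos j.+1 w \in behead (traj j.+1 w).
    apply/(nthP 0); exists j; first by rewrite size_behead size_traj.
    by rewrite nth_behead nth_traj.
  by have /negP := allP (h j.+1 I) _ hj; apply; rewrite inE.
have Am k : measurable (A k).
  exact: (@measurable_traj_event _ _ W k [set s | avoids (behead s)]).
have mb : measurable (\bigcap_k A k) by exact: bigcapT_measurable.
rewrite retE fine_ge0 ?measure_ge0//=.
rewrite -lee_fin fineK; last by apply: fin_num_measure.
have -> : (escape m x)%:E = srw_law W x (A m).
  rewrite (law_traj d_gt0 W m x [set s | avoids (behead s)]); congr EFin.
  by apply: eq_walk_mean => s /=; rewrite asboolb.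
by apply: le_measure; rewrite ?inE//; exact: bigcap_inf.
Qed.

End Escape.

Lemma iter_avg_ge0 F m x : (forall y, 0 <= F y) -> 0 <= iter m (@avg R d) F x.
Proof.
move=> F0; elim: m x => [|m IH] x //=; exact: avg_ge0.
Qed.

Lemma le_iter_avg F (G : V -> R) m x : (forall y, F y <= G y) ->
  iter m (@avg R d) F x <= iter m (@avg R d) G x.
Proof. by move=> FG; elim: m x => [|m IH] x //=; exact: le_avg. Qed.

(** A form of transience: u_k = avg^k F x decreases and satisfies u_k <= eps / 2 + K (u_k -
    u_(k+1)), and summation telescopes to m u_m <= m eps / 2 + K (u_0 - u_m). *)
Lemma iter_avg_vanish F : (forall x, 0 <= F x) -> (forall x, avg F x <= F x) ->
  (forall eps, 0 < eps ->
     exists K : R, forall x, F x <= eps + K * (F x - avg F x)) ->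
  forall x eps, 0 < eps -> exists m, iter m (@avg R d) F x <= eps.
Proof.
move=> F0 Fsup h x eps eps0.
have [K hK] := h (eps / 2) (divr_gt0 eps0 (ltr0Sn _ _)).
pose u k := iter k (@avg R d) F x.
have u0 k : 0 <= u k by exact: iter_avg_ge0.
have uS k : u k.+1 <= u k.
  by rewrite /u iterSr; exact: le_iter_avg.
have uK k : u k <= eps / 2 + K * (u k - u k.+1).
  rewrite /u; move: x {u u0 uS}; elim: k => [|k IH] x //.
  apply: le_trans (le_avg x IH) _.
  by rewrite avgD avgZ avgB avg_cst.
have sumK m : m%:R * u m <= m%:R * (eps / 2) + K * (u 0%N - u m).
  elim: m => [|m IH]; first by rewrite !mul0r add0r subrr mulr0.
  have mS : (m.+1%:R : R) = m%:R + 1 by rewrite -natr1.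
  have um : m.+1%:R * u m.+1 <= m.+1%:R * u m by rewrite ler_wpM2l.
  by have := uK m; rewrite mS in um *; lra.
pose m := (Num.truncn (2 * `|K| * u 0%N / eps)).+1.
exists m; rewrite -/(u m).
have mB : 2 * `|K| * u 0%N / eps < m%:R by exact: truncnS_gt.
have m0 : 0 < (m%:R : R) by rewrite ltr0n.
rewrite -(ler_pM2l m0); apply: le_trans (sumK m) _.
have Ku : K * (u 0%N - u m) <= `|K| * u 0%N.
  apply: (@le_trans _ _ (`|K| * (u 0%N - u m))).
    rewrite ler_wpM2r ?ler_norm// subr_ge0.
    by elim: (m) => // k; exact: le_trans (uS k).
  by rewrite ler_wpM2l// gerBl.
move: mB; rewrite ltr_pdivrMr//; lra.
Qed.

(** Stands for the fact that the Green potential of the equilibrium measure is at most 1. With the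
    bump at r = 1 as Green function, the weighted sum Phi of translates satisfies Phi <= C1 e' + avg
    Phi. Iterating bounds Phi by C1 times a truncated potential, itself at most 1, plus a remainder
    that vanishes by comparison with the superharmonic F. *)
Lemma equilibrium_kernel_le : exists K : R, 0 < K /\
  forall (W : simple_random_walk R d) (Y : seq V) z, uniq Y ->
  \sum_(y <- Y) fine (srw_law W y [set w | return_time [set` Y] w = +oo%E]) *
    ker n (sqnorm (z - y) + 1) <= K.
Proof.
have [C1 [c2 [C2 [C10 c20 C20 /(_ 1%N isT)[g [ga gb gc gd]]]]]] :=
  subharmonic_bump R n_gt0.
have [b [c [b1 c0 /(_ 1%N isT)[fa _]]]] := superharmonic_ker R n_gt0.
rewrite expr1n mulr1 in fa; rewrite expr1n in gb; rewrite expr1n in gc; rewrite expr1n in gd.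
exists (C1 / c2); split; first exact: divr_gt0.
move=> W Y z uY; pose e y := fine (srw_law W y [set w | return_time [set` Y] w = +oo%E]).
have [e0 eesc] : (forall y, 0 <= e y) /\ (forall m y, e y <= escape [set` Y] m y).
  split=> [y|m y]; first by have /andP[] := escape_probability_le [set` Y] W 0 y.
  by have /andP[] := escape_probability_le [set` Y] W m y.
pose e' y := if y \in Y then e y else 0.
have pot1 m x : potential m e' x <= 1.
  have h := @potential_le1 [set` Y] e' _ _ m x.
  apply: le_trans (h _ _) _.
  - move=> k y; rewrite /e' inE /= => ->; exact: eesc.
  - by move=> y; rewrite /e'; case: ifP => // yY; rewrite notin_setE /= yY.
  - by rewrite gerBl no_hit_ge0.
pose Phi x := \sum_(y <- Y) e y * g (x - y).
pose f x := ker n (sqnorm x + b).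
pose F x := \sum_(y <- Y) e y * f (x - y).
have avgs G x : avg (fun u => \sum_(y <- Y) e y * G (u - y)) x =
    \sum_(y <- Y) e y * avg G (x - y).
  rewrite avg_sum; apply: eq_bigr => y _.
  by rewrite avgZ avg_shift.
have PhiS x : Phi x <= C1 * e' x + avg Phi x.
  rewrite /Phi avgs -lerBlDr -sumrB.
  (* The cube of side 1 is a single point, so only the bump at x itself can lose at x. *)
  have cube1 y : cube 1 0 y -> y = 0.
    move=> /(@cubeP R) h; apply/rowP => i; have := h i; rewrite !mxE subr0.
    rewrite -[2]/(2%:~R) -rmorphM -[- 1%:R]/((-1)%:~R) -[1%:R]/(1%:~R).
    by rewrite ler_int ltr_int; lia.
  have bd y : y != x -> e y * g (x - y) - e y * avg g (x - y) <= 0.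
    move=> yx; rewrite -mulrBr; apply: mulr_ge0_le0 => //; rewrite subr_le0.
    by apply: ga => /cube1/eqP; rewrite subr_eq0 eq_sym; exact/negP.
  rewrite /e'; case: ifP => xY.
    rewrite (bigD1_seq x)//= -[leRHS]addr0; apply: lerD.
      rewrite -mulrBr mulrC ler_wpM2r//; have := gb (x - x).
      by rewrite divr1; lra.
    by apply: sumr_le0 => y; exact: bd.
  rewrite mulr0 big_seq; apply: sumr_le0 => y yY; apply: bd.
  by apply: contraFN xY => /eqP <-.
have Phi_iter m x : Phi x <= C1 * potential m e' x + iter m.+1 (@avg R d) Phi x.
  elim: m x => [|m IH] x //=; apply: le_trans (PhiS x) _.
  by rewrite mulrDr -addrA lerD2l -avgZ -avgD; apply: le_avg.
have E0 : 0 <= \sum_(y <- Y) e y by apply: sumr_ge0.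
have N0 x : 0 <= sqnorm x by exact: sqnorm_ge0.
have f0 x : 0 <= f x by exact: ker_ge0.
have F0 x : 0 <= F x by apply: sumr_ge0 => y _; rewrite mulr_ge0.
have fsup x : avg f x <= f x.
  by apply: le_trans (fa x) _; rewrite gerBl (mulr_ge0 (ltW c0))// divr_ge0 ?ker_ge0 ?sqr_ge0.
have Fsup x : avg F x <= F x.
  by rewrite /F avgs; apply: ler_sum => y _; rewrite ler_wpM2l.
(* Where s >= S the kernel is at most t^n <= eps; elsewhere it is at most S^2 / c times its own
   loss. *)
have feps eps : 0 < eps -> exists K, forall x, f x <= eps + K * (f x - avg f x).
  move=> eps0; pose t := Num.min eps 1.
  have t0 : 0 < t by rewrite lt_min eps0 ltr01.
  pose S := t ^- 2.
  have S0 : 0 < S by rewrite invr_gt0 exprn_gt0.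
  exists (S ^+ 2 / c) => x; set s := sqnorm x + b.
  have s0 : 0 < s by rewrite /s; have := N0 x; lra.
  have fd : f x / s ^+ 2 <= (f x - avg f x) / c.
    by rewrite ler_pdivlMr// mulrC; have := fa x; rewrite -/(f x) -/s; lra.
  have [Ss|sS] := lerP S s.
    have : f x <= eps.
      apply: (@le_trans _ _ (ker n S)); first exact: le_ker.
      rewrite /S -exprVn kerX2 ?invr_ge0 ?(ltW t0)// -exprVn invrK.
      apply: (@le_trans _ _ t); last by rewrite ge_min lexx.
      by rewrite ler_iXnr// ?(ltW t0)// ge_min lexx orbT.
    have : 0 <= S ^+ 2 / c * (f x - avg f x).
      by rewrite mulr_ge0 ?divr_ge0 ?sqr_ge0 ?subr_ge0// ltW.
    lra.
  have : f x <= S ^+ 2 * (f x / s ^+ 2).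
    rewrite mulrCA ler_peMr// ler_pdivlMr ?exprn_gt0// mul1r.
    by rewrite lerXn2r ?nnegrE// ltW.
  have : S ^+ 2 * (f x / s ^+ 2) <= S ^+ 2 * ((f x - avg f x) / c).
    by rewrite ler_wpM2l ?sqr_ge0.
  lra.
have Feps eps : 0 < eps -> exists K, forall x, F x <= eps + K * (F x - avg F x).
  move=> eps0; have E1 : 0 < \sum_(y <- Y) e y + 1 by lra.
  have [K hK] := feps _ (divr_gt0 eps0 E1); exists K => x.
  rewrite /F avgs; apply: (@le_trans _ _
    (\sum_(y <- Y) e y * (eps / (\sum_(y <- Y) e y + 1) + K * (f (x - y) - avg f (x - y))))).
    by apply: ler_sum => y _; rewrite ler_wpM2l.
  rewrite -sumrB mulr_sumr; under eq_bigr do rewrite mulrDr.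
  rewrite big_split /=; apply: lerD; last first.
    by apply: ler_sum => y _; rewrite -mulrBr mulrCA.
  rewrite -mulr_suml mulrA ler_pdivrMr// mulrC ler_wpM2l ?(ltW eps0)//; lra.
have PhiF x : Phi x <= C2 * ker n b^-1 * F x.
  rewrite /Phi /F mulr_sumr; apply: ler_sum => y _; rewrite mulrCA ler_wpM2l//.
  apply: le_trans (gd _) _; rewrite -mulrA ler_wpM2l ?(ltW C20)//.
  rewrite -kerM ?invr_ge0; last by lra.
  apply: le_ker; rewrite mulrC.
    by rewrite divr_gt0//; have := N0 (x - y); lra.
  by rewrite ler_pdivrMr; have := N0 (x - y); nra.
have kb0 : 0 < C2 * ker n b^-1.
  by rewrite mulr_gt0// ker_gt0// invr_gt0; lra.
have iterZ (a : R) m x : iter m (@avg R d) (fun y => a * F y) x = a * iter m (@avg R d) F x.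
  elim: m x => [|m IH] x //=; rewrite -avgZ; exact: eq_avg.
have PhiC1 : Phi z <= C1.
  apply/ler_addgt0Pr => eps eps0.
  have [m hm] := iter_avg_vanish F0 Fsup Feps z (divr_gt0 eps0 kb0).
  have hm' : iter m.+1 (@avg R d) F z <= eps / (C2 * ker n b^-1).
    apply: le_trans hm; rewrite iterSr; exact: le_iter_avg.
  apply: le_trans (Phi_iter m z) _; apply: lerD.
    by rewrite ler_piMr// ltW.
  apply: le_trans (le_iter_avg m.+1 z PhiF) _.
  by rewrite iterZ mulrC -ler_pdivlMr.
rewrite ler_pdivlMr//; apply: le_trans PhiC1.
rewrite mulr_suml; apply: ler_sum => y _; rewrite -/(e y).
by rewrite -mulrA ler_wpM2l// [leLHS]mulrC; exact: gc.
Qed.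

End Equilibrium.

(** * Spread-out sets of cubes *)

Section SpreadSubset.
Variables (R : realType) (T : eqType) (k : T -> T -> R).
Hypothesis k_ge0 : forall x y, 0 <= k x y.
Hypothesis k_sym : forall x y, k x y = k y x.
Implicit Types (q : T -> R) (U Y : seq T).

(** Number of points minus interaction energy, each unordered pair being counted once. *)
Let score U : R :=
  (size U)%:R - (\sum_(x <- U) \sum_(y <- U | y != x) k x y) / 2.

Let score_perm U U' : perm_eq U U' -> score U = score U'.
Proof.
move=> p; rewrite /score (perm_size p) (perm_big _ p)/=; congr (_ - _ / 2).
by apply: eq_bigr => x _; rewrite (perm_big _ p).
Qed.

Let score_cons a U : a \notin U -> score (a :: U) = score U + 1 - \sum_(y <- U) k a y.
Proof.
move=> aU; rewrite /score /= !big_cons eqxx /= -natr1.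
have -> : \sum_(y <- U | y != a) k a y = \sum_(y <- U) k a y.
  rewrite big_seq_cond [RHS]big_seq; apply: eq_bigl => y.
  by case: (boolP (y \in U)) => //= yU; apply: contraNneq aU => <-.
have -> : \sum_(x <- U) \sum_(y <- a :: U | y != x) k x y =
  \sum_(y <- U) k a y + \sum_(x <- U) \sum_(y <- U | y != x) k x y.
  rewrite -big_split/= big_seq [RHS]big_seq; apply: eq_bigr => x xU.
  by rewrite big_cons ifT 1?k_sym//; apply: contraNneq aU => ->.
lra.
Qed.

(** Removing a point whose interaction with the others exceeds 1 does not lower the score; removals
    stop at a set where no such point is left. *)
Let stable_subset U : uniq U -> exists U', [/\ uniq U', {subset U' <= U},
  score U <= score U' & forall x, x \in U' -> \sum_(y <- U' | y != x) k x y <= 1].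
Proof.
have [m] := ubnP (size U); elim: m U => // m IH U; rewrite ltnS => Um uU.
have [h|] := pselect (forall x, x \in U -> \sum_(y <- U | y != x) k x y <= 1).
  by exists U; split.
move=> /existsNP[a /not_implyP[aU /negP]]; rewrite -ltNge => ka.
have p := perm_to_rem aU.
have uW : uniq (rem a U) by exact: rem_uniq.
have aW : a \notin rem a U by rewrite mem_rem_uniq// inE eqxx.
have [|U' [u1 u2 u3 u4]] := IH (rem a U) _ uW.
  by rewrite size_rem// (leq_trans _ Um)// prednK//; case: (U) aU.
exists U'; split=> //; first by move=> x /u2; exact: mem_rem.
apply: le_trans u3; rewrite (score_perm p) score_cons//.
suff : 1 <= \sum_(y <- rem a U) k a y by lra.
apply: ltW; apply: lt_le_trans ka _.
rewrite (perm_big _ p)/= big_cons eqxx /= big_mkcond; apply: ler_sum => y _.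
by case: ifP => // _; exact: k_ge0.
Qed.

(* The relaxation of [score] to weights is affine in each weight, so it is
   maximal at indicator functions. *)
Lemma spread_subset Y q : uniq Y -> (forall x, 0 <= q x <= 1) ->
  (forall x, x \in Y -> \sum_(y <- Y) q y * k x y <= 1) ->
  exists U, [/\ uniq U, {subset U <= Y}, \sum_(x <- Y) q x <= 2 * (size U)%:R
    & forall x, x \in U -> \sum_(y <- U | y != x) k x y <= 1].
Proof.
move=> uY q01 qk.
pose Phi q := \sum_(x <- Y) q x -
  (\sum_(x <- Y) \sum_(y <- Y | y != x) q x * q y * k x y) / 2.
have rounding (l : seq T) : exists q', [/\ forall x, 0 <= q' x <= 1, Phi q <= Phi q' &
    forall x, x \in l -> q' x = (q' x == 1)%:R].
  elim: l => [|a l [q' [b1 b2 b3]]]; first by exists q; split.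
  pose t := q' a.
  pose q_ (c : R) x := if x == a then c else q' x.
  (* Affine in q' a because the diagonal y = x is left out, so one of the values 0 and 1 does at
     least as well. *)
  have PhiE : Phi q' = (1 - t) * Phi (q_ 0) + t * Phi (q_ 1).
    rewrite /Phi !mulrBr !mulrA !(mulr_sumr, mulr_suml).
    rewrite addrACA -opprD -!big_split/=; congr (_ - _).
      by apply: eq_bigr => x _; rewrite /q_; case: eqP => [->|_]; rewrite -/t; ring.
    apply: eq_bigr => x _; rewrite !(mulr_sumr, mulr_suml) -!big_split/=.
    apply: eq_bigr => y yx; rewrite /q_.
    have [xa|xa] := eqVneq x a; have [ya|ya] := eqVneq y a.
    - by rewrite xa ya eqxx in yx.
    - by rewrite xa -/t; ring.
    - by rewrite ya -/t; ring.
    - by ring.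
  have /andP[t0 t1] : 0 <= t <= 1 := b1 a.
  have q_01 c : c = 0 \/ c = 1 -> [/\ forall x, 0 <= q_ c x <= 1 &
      forall x, x \in a :: l -> q_ c x = (q_ c x == 1)%:R].
    move=> c01; split=> x; rewrite /q_; case: eqP => // xa.
    - by case: c01 => ->; rewrite lexx ler01.
    - by move=> _; case: c01 => ->; rewrite ?eqxx// eq_sym oner_eq0.
    - by rewrite inE => /predU1P[//|]; exact: b3.
  move: t PhiE t0 t1 => t PhiE t0 t1.
  have [le01|le10] := lerP (Phi (q_ 0)) (Phi (q_ 1)).
    have [c1 c2] := q_01 1 (or_intror erefl); exists (q_ 1); split=> //.
    by apply: le_trans b2 _; rewrite PhiE; nra.
  have [c1 c2] := q_01 0 (or_introl erefl); exists (q_ 0); split=> //.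
  by apply: le_trans b2 _; rewrite PhiE; nra.
have [q' [b1 b2 b3]] := rounding Y.
pose U0 := [seq x <- Y | q' x == 1].
have sumU (F : T -> R) : \sum_(x <- Y) q' x * F x = \sum_(x <- U0) F x.
  rewrite big_filter [RHS]big_mkcond; apply: eq_big_seq => x xY.
  by rewrite (b3 x xY); case: eqP => // _; rewrite ?eqxx ?mul1r// eq_sym oner_eq0 mul0r.
have PhiU : Phi q' = score U0.
  rewrite /Phi /score; congr (_ - _ / 2).
    under eq_bigr do rewrite -[q' _]mulr1.
    by rewrite sumU big_const_seq count_predT iter_addr_0.
  rewrite -sumU; apply: eq_bigr => x _; rewrite mulr_sumr.
  rewrite big_filter_cond (eq_bigl (fun y => (y != x) && (q' y == 1))); last first.
    by move=> y; rewrite andbC.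
  rewrite [RHS]big_mkcondr /= big_seq_cond [RHS]big_seq_cond.
  apply: eq_bigr => y /andP[yY _]; rewrite (b3 y yY) -mulrA.
  by case: eqP => // _; rewrite ?eqxx ?mul1r// eq_sym oner_eq0 mul0r mulr0.
have [U [u1 u2 u3 u4]] := stable_subset (filter_uniq _ uY : uniq U0).
exists U; split=> //; first by move=> x /u2; rewrite mem_filter => /andP[].
have sU : score U <= (size U)%:R.
  by rewrite /score gerBl divr_ge0// sumr_ge0// => x _; rewrite sumr_ge0.
(* The constraint on q bounds the double sum by the mass, so Phi q keeps at least half the mass. *)
have : (\sum_(x <- Y) q x) / 2 <= Phi q.
  have -> : (\sum_(x <- Y) q x) / 2 = \sum_(x <- Y) q x - (\sum_(x <- Y) q x) / 2.
    by lra.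
  rewrite /Phi lerD2l lerN2 ler_wpM2r// big_seq [leRHS]big_seq; apply: ler_sum => x xY.
  have /andP[q0 _] := q01 x.
  rewrite -[leRHS]mulr1; apply: le_trans (ler_wpM2l q0 (qk x xY)).
  rewrite mulr_sumr big_mkcond; apply: ler_sum => y _.
  case: ifP => _; first by rewrite mulrA.
  by rewrite !mulr_ge0//; have /andP[] := q01 y.
rewrite PhiU in b2; lra.
Qed.

End SpreadSubset.

(** * Lattice points in boxes *)

Section Box.
Variable d : nat.
Local Notation V := 'rV[int]_d.
Implicit Types (x y z : V) (Y : seq V).

Definition box_point (k : nat) z (c : {ffun 'I_d -> 'I_(2 * k + 1)}) : V :=
  \row_i (z 0 i - k%:Z + (c i)%:Z).

Lemma box_pointP k z y : (forall i, `|y 0 i - z 0 i| <= k%:Z) ->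
  exists c : {ffun 'I_d -> 'I_(2 * k + 1)}, y = box_point z c.
Proof.
move=> h.
have hc i : (`|(y 0 i - z 0 i + k%:Z)%R| < 2 * k + 1)%N.
  by have := h i; lia.
exists [ffun i => Ordinal (hc i)]; apply/rowP => i; rewrite mxE ffunE /=.
by have := h i; lia.
Qed.

Lemma box_size k z Y : uniq Y ->
  (forall y, y \in Y -> forall i, `|y 0 i - z 0 i| <= k%:Z) ->
  (size Y <= (2 * k + 1) ^ d)%N.
Proof.
move=> uY h; rewrite -[X in (_ ^ X)%N]card_ord -[X in (X ^ _)%N]card_ord.
rewrite -card_ffun -(size_codom (@box_point k z)); apply: uniq_leq_size => //.
move=> y /h/box_pointP[c ->]; exact: codom_f.
Qed.

Definition supnorm x : nat := \max_i absz (x 0%R i).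

Lemma supnorm_le x k : (supnorm x <= k)%N -> forall i, `|x 0 i| <= k%:Z.
Proof. by move=> /bigmax_leqP h i; have := h i isT; lia. Qed.

Lemma supnorm_sqnorm (R : realType) x :
  (supnorm x)%:R ^+ 2 <= sqnorm R x.
Proof.
rewrite /supnorm; have [|d0] := posnP #|'I_d|.
  move=> /card0_eq d0; rewrite big1 => [|i _]; first by rewrite expr0n sqnorm_ge0.
  by have := d0 i; rewrite inE.
have [i ->] := @bigop.eq_bigmax _ (fun i => absz (x 0%R i)) d0.
apply: le_trans (sqr_coord_le R x i).
by rewrite -[leRHS]real_normK ?num_real// -intr_norm natr_absz.
Qed.

End Box.

(** * Nice sets of cube indices *)

Section NiceSubset.
Variables (R : realType) (n : nat).
Hypothesis n_gt0 : (0 < n)%N.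
Local Notation d := (n.+2).
Local Notation V := 'rV[int]_d.
Implicit Types (x y z : V) (U Y : seq V).
Local Notation sqnorm := (sqnorm R).

Lemma one_subX_le (t : R) m : 0 <= t <= 1 -> 1 - t ^+ m <= m%:R * (1 - t).
Proof.
move=> /andP[t0 t1]; elim: m => [|m IH]; first by rewrite expr0 subrr mul0r.
have m0 : 0 <= m%:R * (1 - t) * (1 - t) by rewrite !mulr_ge0// subr_ge0.
by rewrite exprS -natr1; have := ler_wpM2l t0 IH; lra.
Qed.

(** The worst case is N points filling a box of radius tau = N^(1/d), over which |y|^(-n) sums to
    order tau^2. Each layer k < J = floor tau contributes at most a constant times k + 1, and the
    remaining term N h(J) is at most tau^2. *)
Lemma ker_sum_le : exists C : R, 0 < C /\ forall Y z, uniq Y -> Y != [::] ->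
  \sum_(y <- Y) ker n (sqnorm (y - z) + 1) <=
     C * ((size Y)%:R `^ (d%:R^-1)) ^+ 2.
Proof.
pose c : R := ker n 2^-1.
have c0 : 0 < c by rewrite ker_gt0// invr_gt0.
pose C : R := c * (n%:R * 2 ^+ d + 1).
exists C; split.
  by rewrite /C mulr_gt0// ltr_pwDr// mulr_ge0// exprn_ge0.
move=> Y z uY Y0; set N : R := (size Y)%:R.
have N1 : 1 <= N by rewrite ler1n lt0n size_eq0.
set tau := N `^ _.
have tau1 : 1 <= tau by rewrite -[leLHS](powRr0 N) ler_powR// invr_ge0.
have tau0 : 0 <= tau by lra.
have taud : tau ^+ d = N.
  rewrite -powR_mulrn// /tau -powRrM mulVf ?pnatr_eq0// powRr1//; lra.
pose J := Num.truncn tau.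
have /andP[Jtau tauJ] : J%:R <= tau < J.+1%:R by exact: truncn_itv.
pose h (i : nat) : R := i.+1%:R ^- n.
have h0 i : 0 <= h i by rewrite invr_ge0 exprn_ge0.
have hS i : 0 <= h i - h i.+1 <= n%:R / i.+1%:R ^+ n.+1.
  pose t : R := i.+1%:R / i.+2%:R.
  have i1 : 0 < (i.+1%:R : R) by [].
  have i2 : (i.+2%:R : R) = i.+1%:R + 1 by rewrite natr1.
  have tE : 1 - t = i.+2%:R^-1 by rewrite /t i2; field; lra.
  have t01 : 0 <= t <= 1.
    by rewrite /t divr_ge0//= ler_pdivrMr// mul1r ler_nat.
  have -> : h i - h i.+1 = h i * (1 - t ^+ n).
    by rewrite mulrBr mulr1 /h /t expr_div_n mulrA mulVf ?mul1r// expf_neq0// gt_eqF.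
  have /andP[t0 t1] := t01.
  apply/andP; split; first by rewrite mulr_ge0// subr_ge0 exprn_ile1.
  apply: le_trans (ler_wpM2l (h0 i) (one_subX_le n t01)) _.
  rewrite tE /h exprSr invfM mulrCA ler_wpM2l// ler_wpM2l ?invr_ge0 ?exprn_ge0//.
  by rewrite lef_pV2 ?posrE// ler_nat.
(* Abel summation of the decreasing profile h, cut at J. *)
have hbound i : h i <= \sum_(k < J) (i <= k)%:R * (h k - h k.+1) + h J.
  have [iJ|Ji] := leqP i J; last first.
    apply: (@le_trans _ _ (h J)).
      rewrite lef_pV2 ?posrE ?exprn_gt0// lerXn2r ?nnegrE// ler_nat.
      exact: leqW.
    rewrite lerDr; apply: sumr_ge0 => k _; rewrite mulr_ge0//.
    by have /andP[] := hS k.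
  have -> : \sum_(k < J) (i <= k)%:R * (h k - h k.+1) = h i - h J.
    rewrite -(big_mkord xpredT (fun k => (i <= k)%:R * (h k - h k.+1))).
    rewrite (big_cat_nat (n := i))//= big_nat_cond big1 ?add0r.
      rewrite big_nat_cond (eq_bigr (fun k => - (h k.+1 - h k))).
        by rewrite -big_nat_cond sumrN telescope_sumr// opprB.
      by move=> k /andP[/andP[ik _] _]; rewrite ik mul1r opprB.
    by move=> k /andP[/andP[_ ki] _]; rewrite leqNgt ki mul0r.
  by rewrite subrK.
have kerh y : ker n (sqnorm y + 1) <= c * h (supnorm y).
  have := supnorm_sqnorm R y; set i := supnorm y => iy.
  rewrite /c /h -kerX2// -kerM ?invr_ge0//; apply: le_ker.
    by rewrite mulr_gt0 ?invr_gt0// exprn_gt0.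
  rewrite mulrC ler_pdivrMr// -natr1.
  have := sqr_ge0 (i%:R - 1 : R); lra.
apply: (@le_trans _ _ (\sum_(y <- Y) c *
    (\sum_(k < J) (supnorm (y - z) <= k)%:R * (h k - h k.+1) + h J))).
  apply: ler_sum => y _; apply: le_trans (kerh _) _.
  by rewrite ler_wpM2l ?(ltW c0).
rewrite -mulr_sumr big_split /= exchange_big /= /C -mulrA ler_wpM2l ?(ltW c0)//.
rewrite mulrDl mul1r; apply: lerD; last first.
  rewrite big_const_seq count_predT iter_addr_0 -mulr_natl -/N /h.
  rewrite ler_pdivrMr ?exprn_gt0// -taud -addn2 exprD mulrC ler_wpM2l ?sqr_ge0//.
  by rewrite lerXn2r ?nnegrE// ltW.
apply: (@le_trans _ _ (\sum_(k < J) n%:R * 2 ^+ d * J%:R)).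
  apply: ler_sum => k _; rewrite -mulr_suml.
  have cnt : \sum_(y <- Y) ((supnorm (y - z)%R <= k)%N%:R : R) <=
      2 ^+ d * k.+1%:R ^+ d.
    have -> : \sum_(y <- Y) ((supnorm (y - z)%R <= k)%N%:R : R) =
       (size [seq y <- Y | (supnorm (y - z)%R <= k)%N])%:R.
      rewrite size_filter -sum1_count natr_sum [RHS]big_mkcond.
      by apply: eq_bigr => y _; case: leqP.
    rewrite -exprMn -natrM -natrX ler_nat.
    apply: (@leq_trans ((2 * k + 1) ^ d)); last by rewrite leq_exp2r//; lia.
    apply: (@box_size _ k z); first exact: filter_uniq.
    move=> y; rewrite mem_filter => /andP[/supnorm_le yk _] i.
    by have := yk i; rewrite !mxE.
  have /andP[d0 d1] := hS k.
  apply: le_trans (ler_wpM2r d0 cnt) _.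
  apply: le_trans (ler_wpM2l _ d1) _; first by rewrite mulr_ge0 ?exprn_ge0.
  have -> : 2 ^+ d * k.+1%:R ^+ d * (n%:R / k.+1%:R ^+ n.+1) =
      n%:R * 2 ^+ d * k.+1%:R :> R.
    by rewrite [k.+1%:R ^+ d]exprS; field; rewrite expf_neq0//= gt_eqF.
  apply: ler_wpM2l; first by rewrite mulr_ge0 ?exprn_ge0.
  by rewrite ler_nat.
rewrite sumr_const card_ord -[leLHS]mulr_natr -mulrA.
apply: ler_wpM2l; first by rewrite mulr_ge0 ?exprn_ge0.
by rewrite -expr2 lerXn2r ?nnegrE.
Qed.

(** The points are indices, y standing for the cube centred at r y, so the notion does not depend on
    r. In the bound 2 the diagonal term takes 1. *)
Definition nice U :=
  forall x, x \in U -> \sum_(y <- U) ker n (sqnorm (x - y) + 1) <= 2.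

Lemma nice_rounding Y (q : V -> R) : uniq Y -> (forall x, 0 <= q x <= 1) ->
  (forall x, x \in Y -> \sum_(y <- Y) q y * ker n (sqnorm (x - y) + 1) <= 1) ->
  exists U, [/\ uniq U, {subset U <= Y}, nice U &
    \sum_(x <- Y) q x <= 2 * (size U)%:R].
Proof.
move=> uY q01 qk; pose k x y : R := ker n (sqnorm (x - y) + 1).
have [||//|U [u1 u2 u3 u4]] := @spread_subset R V k _ _ Y q uY q01.
- by move=> x y; exact: ker_ge0.
- by move=> x y; rewrite /k sqnormB.
exists U; split=> // x xU; rewrite (bigD1_seq x)//= subrr sqnorm0 add0r ker1.
have -> : 2 = 1 + 1 :> R by lra.
by rewrite lerD2l; exact: u4.
Qed.

(** By [ker_sum_le] the constant weight 1 / (C N^(2/d)) is a feasible fractional solution, of mass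
    N^(1-2/d) / C. *)
Lemma nice_subset_volume : exists c : R, 0 < c /\ forall Y, uniq Y -> Y != [::] ->
  exists U, [/\ uniq U, {subset U <= Y}, nice U &
    c * (size Y)%:R `^ (1 - 2 / d%:R) <= (size U)%:R].
Proof.
have [C0 [C00 hC]] := ker_sum_le; pose C := C0 + 1.
have C1 : 1 <= C by rewrite /C; lra.
exists ((2 * C)^-1); split; first by rewrite invr_gt0; lra.
move=> Y uY Y0; set N : R := (size Y)%:R.
have N1 : 1 <= N by rewrite ler1n lt0n size_eq0.
pose tau := N `^ (d%:R^-1).
have tau1 : 1 <= tau by rewrite -[leLHS](powRr0 N) ler_powR// invr_ge0.
have tauE : N `^ (1 - 2 / d%:R) = N / tau ^+ 2.
  have N0 : N != 0 by rewrite gt_eqF//; lra.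
  rewrite powRB ?N0 ?implybT//.
  rewrite powRr1; last by lra.
  by congr (_ / _); rewrite mulrC powRrM powR_mulrn ?powR_ge0.
have Ct : 1 <= C * tau ^+ 2 by rewrite mulr_ege1// exprn_ege1.
have Ct0 : 0 < C * tau ^+ 2 by lra.
pose q (x : V) : R := (C * tau ^+ 2)^-1.
have [||U [u1 u2 u3 u4]] := @nice_rounding Y q uY.
- by move=> x; rewrite invr_ge0 (ltW Ct0) invf_le1.
- move=> x _; rewrite -mulr_sumr mulrC ler_pdivrMr ?mul1r//.
  under eq_bigr do rewrite sqnormB.
  apply: le_trans (hC Y x uY Y0) _; rewrite -/N -/tau ler_wpM2r ?sqr_ge0//.
  by rewrite /C; lra.
exists U; split=> //; rewrite tauE.
move: u4; rewrite big_const_seq count_predT iter_addr_0 -[_ *+ size Y]mulr_natl -/N /q.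
have -> : (2 * C)^-1 * (N / tau ^+ 2) = N * (C * tau ^+ 2)^-1 / 2.
  by field; apply/andP; split; rewrite gt_eqF//; lra.
lra.
Qed.

End NiceSubset.

(** * Upper tail of the number of heavy cubes *)

Section HeavyNice.
Variables (R : realType) (n : nat).
Hypothesis n_gt0 : (0 < n)%N.
Local Notation d := (n.+2).
Local Notation V := 'rV[int]_d.
Implicit Types (x y z : V) (U Y s : seq V) (r m u : nat) (rho : R).
Local Notation sqnorm := (sqnorm R).
Let d_gt0 : (0 < d)%N. Proof. by []. Qed.

Definition cube_time r y s : R :=
  \sum_(z <- s) (`[< cube r (r%:Z *: y) z >])%:R.

Lemma seq_argmin (F : V -> R) U : U != [::] ->
  exists2 y0, y0 \in U & forall y, y \in U -> F y0 <= F y.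
Proof.
elim: U => // a [|b U] IH _.
  by exists a; rewrite ?mem_head// => y; rewrite inE => /eqP ->.
have [//|y0 y0U h] := IH.
have [le_a|lt_a] := lerP (F a) (F y0).
  exists a; rewrite ?mem_head// => y; rewrite inE => /predU1P[->//|/h].
  exact: le_trans.
exists y0; first by rewrite inE y0U orbT.
by move=> y; rewrite inE => /predU1P[->|/h//]; exact: ltW.
Qed.

(** Niceness only speaks of points of U. For general z, let y0 in U minimise |z - r y|; then r |y0 -
    y| <= 2 |z - r y| for y in U, which reduces the sum to the one at y0. *)
Lemma nice_ker_le r U z (b : R) : (0 < r)%N -> 1 <= b -> nice R U ->
  \sum_(y <- U) ker n (sqnorm (z - r%:Z *: y) + b * r%:R ^+ 2) <=
    2 ^+ n.+1 / r%:R ^+ n.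
Proof.
move=> r0 b1 nU.
have r1 : (1 : R) <= r%:R by rewrite ler1n.
have r2 : 0 < (r%:R : R) ^+ 2 by rewrite exprn_gt0//; lra.
have [->|U0] := eqVneq U [::].
  by rewrite big_nil divr_ge0 ?exprn_ge0.
have [y0 y0U hy0] := seq_argmin (fun y => sqnorm (z - r%:Z *: y)) U0.
apply: (@le_trans _ _ (\sum_(y <- U)
   (2 ^+ n / r%:R ^+ n) * ker n (sqnorm (y0 - y) + 1))); last first.
  rewrite -mulr_sumr [2 ^+ n.+1]exprSr [leRHS]mulrAC; apply: ler_wpM2l; last exact: nU.
  by rewrite divr_ge0 ?exprn_ge0.
rewrite big_seq [leRHS]big_seq; apply: ler_sum => y yU.
have k2 : 2 ^+ n / r%:R ^+ n = ker n ((r%:R / 2) ^+ 2) :> R.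
  by rewrite kerX2 ?divr_ge0// expr_div_n invf_div.
rewrite k2 -kerM ?sqr_ge0//; have Ny := sqnorm_ge0 R (y0 - y).
apply: le_ker; first by rewrite mulr_gt0 ?exprn_gt0 ?divr_gt0//; lra.
have : r%:R ^+ 2 * sqnorm (y0 - y) <= 4 * sqnorm (z - r%:Z *: y).
  have -> : r%:R ^+ 2 * sqnorm (y0 - y) = sqnorm (r%:Z *: (y0 - y)).
    by rewrite sqnormZ.
  have -> : r%:Z *: (y0 - y) = (z - r%:Z *: y) - (z - r%:Z *: y0).
    by rewrite scalerBr; apply/rowP => i; rewrite !mxE; ring.
  apply: le_trans (sqnormD_le R _ _) _; rewrite sqnormN.
  by have := hy0 y yU; lra.
rewrite expr_div_n; set a := r%:R ^+ 2 in r2 *; set N := sqnorm _; nra.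
Qed.

(** Khas'minskii in exponential form: psi = 1 + h / H, with values in [1, 2], is a supersolution for
    the weight exp(th occ), so the total time multiplied by th has exponential moment at most 2.
    Markov's inequality concludes. *)
Lemma nice_cubes_tail : exists c : R, 0 < c /\
  forall r U t m x, (0 < r)%N -> nice R U ->
  walk_mean m (fun s => (t <= \sum_(y <- U) cube_time r y s)%R%:R) x <=
    2 * expR (- (c * t / r%:R ^+ 2)).
Proof.
have [b [c [b1 c0 hsup]]] := superharmonic_ker R n_gt0.
exists (c / 2 ^+ n.+2); split; first by rewrite divr_gt0// exprn_gt0.
move=> r U t m x r0 nU; have [fsup fcube] := hsup r r0.
have r1 : (1 : R) <= r%:R by rewrite ler1n.
have rk k : 0 < (r%:R : R) ^+ k by rewrite exprn_gt0//; lra.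
pose f z := ker n (sqnorm z + b * r%:R ^+ 2).
pose h z := \sum_(y <- U) f (z - r%:Z *: y).
pose occ z : R := \sum_(y <- U) (`[< cube r (r%:Z *: y) z >])%:R.
pose H : R := 2 ^+ n.+1 / r%:R ^+ n.
have H0 : 0 < H by rewrite divr_gt0// exprn_gt0.
have hH z : h z <= H by exact: nice_ker_le.
have h0 z : 0 <= h z by apply: sumr_ge0 => y _; exact: ker_ge0.
have occ0 z : 0 <= occ z by apply: sumr_ge0 => y _; exact: ler0n.
have havg z : avg h z <= h z - c / r%:R ^+ d * occ z.
  rewrite /h avg_sum /occ mulr_sumr -sumrB; apply: ler_sum => y _.
  rewrite (avg_shift f); case: asboolP => hz.
    by rewrite mulr1; apply: fcube; move/cube_shift: hz.
  rewrite mulr0 subr0; apply: le_trans (fsup _) _.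
  rewrite gerBl; apply: mulr_ge0; first exact: ltW.
  by rewrite divr_ge0 ?ker_ge0 ?sqr_ge0.
(* Of order r^(-2). One step lowers h / H by at least 2 th occ, and psi <= 2 turns this into a
   factor 1 - th occ. *)
pose th : R := c / r%:R ^+ d / (2 * H).
have th0 : 0 <= th.
  by apply: ltW; apply: divr_gt0; [exact: divr_gt0 | exact: mulr_gt0].
pose w z := expR (th * occ z).
pose psi z := 1 + h z / H.
have psi1 z : 1 <= psi z by rewrite lerDl divr_ge0// ltW.
have psi2 z : psi z <= 2.
  have : h z / H <= 1 by rewrite ler_pdivrMr// mul1r.
  by rewrite /psi; lra.
have wpsi z : w z * avg psi z <= 1 * psi z.
  rewrite mul1r /psi avgD avg_cst//.
  have -> : avg (fun y => h y / H) z = avg h z / H.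
    by rewrite [RHS]mulrC -avgZ; apply: eq_avg => y; rewrite mulrC.
  pose u := th * occ z.
  have u0 : 0 <= u by rewrite mulr_ge0.
  have : 1 + avg h z / H <= psi z * expR (- u).
    apply: (@le_trans _ _ (psi z * (1 - u))).
      have : avg h z / H <= h z / H - 2 * u.
        have -> : h z / H - 2 * u = (h z - c / r%:R ^+ d * occ z) / H.
          by rewrite /u /th; field; rewrite !gt_eqF//; lra.
        by rewrite ler_wpM2r// invr_ge0 ltW.
      have := psi2 z; rewrite /psi; set q := h z / H; nra.
    by rewrite ler_wpM2l ?(le_trans ler01)// expR_ge1Dx.
  move=> /(ler_wpM2l (expR_ge0 u)); rewrite mulrCA -expRD subrr expR0 mulr1.
  by [].
have wge0 z : 0 <= w z by exact: expR_ge0.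
have one_avg z : (1 : R) <= avg psi z.
  by rewrite -[leLHS](avg_cst d_gt0 1 z); exact: le_avg.
have := @walk_mean_tilt_le R d m w (fun=> 1) psi 1 x wge0 ler01 one_avg wpsi.
rewrite expr1n mul1r => tl.
apply: (@le_trans _ _ (expR (- (th * t)) * walk_mean m (tilt w (fun=> 1)) x)).
  rewrite -walk_meanZ; apply: le_walk_mean => s.
  rewrite /tilt mulr1 -expR_sum -mulr_sumr.
  have -> : \sum_(z <- s) occ z = \sum_(y <- U) cube_time r y s.
    by rewrite /occ exchange_big.
  case: (lerP t) => [tT|_] /=; last by rewrite mulr_ge0 ?expR_ge0.
  by rewrite -expRD -[leLHS]expR0 ler_expR; have := ler_wpM2l th0 tT; lra.
have -> : c / 2 ^+ n.+2 * t / r%:R ^+ 2 = th * t.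
  rewrite /th /H [2 ^+ n.+2]exprS -(addn2 n) exprD.
  by field; rewrite !expf_neq0 ?gt_eqF//; lra.
rewrite mulrC ler_wpM2r ?expR_ge0//; exact: le_trans tl _.
Qed.

Definition heavy_nice r rho u s := exists U,
  [/\ uniq U, size U = u, nice R U &
    forall y, y \in U -> rho * r%:R ^+ d <= cube_time r y s].

Lemma near_path_cube m r y s : (0 < r)%N -> near_path m 0 s ->
  0 < cube_time r y s -> forall i, `|y 0 i - 0| <= m.+1%:Z.
Proof.
move=> r0 [_ hs] ct i; rewrite subr0.
have [z zs zc] : exists2 z, z \in s & cube r (r%:Z *: y) z.
  apply: contrapT => nz; move: ct; rewrite /cube_time big_seq big1 ?ltxx// => z zs.
  by rewrite asboolF// => zc; apply: nz; exists z.
have := hs z zs i; rewrite mxE subr0 => zi.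
have /(@cubeP R)/(_ i) := zc; rewrite mxE.
move: zi; move: (z 0 i) (y 0 i) => a b zi /andP[h1 h2].
have {}h1 : - r%:Z <= 2 * (a - r%:Z * b) by rewrite -(ler_int R) rmorphM rmorphN.
have {}h2 : 2 * (a - r%:Z * b) < r%:Z by rewrite -(ltr_int R) rmorphM.
nia.
Qed.

(** Union bound over u-tuples of indices within sup-distance m + 1 of the origin, at most m^(4 d u)
    in number. *)
Lemma heavy_nice_tail : exists c C : R, [/\ 0 < c, 0 < C &
  forall m r rho u, (2 <= m)%N -> (0 < r)%N -> (0 < u)%N -> 0 < rho ->
  C * ln m%:R <= rho * r%:R ^+ n ->
  walk_mean m (fun s => (`[< heavy_nice r rho u s >])%:R) 0 <=
    expR (- (c * rho * r%:R ^+ n * u%:R))].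
Proof.
have [c [c0 tail]] := nice_cubes_tail.
(* The entropy costs 4 d u ln m and the factor 2 at most as much again; this C makes the total at
   most half of c rho r^n u. *)
exists (c / 2), (16 * d%:R / c); split; [lra|by rewrite divr_gt0// mulr_gt0|].
move=> m r rho u m2 r0 u0 rho0 hC.
have r1 : (1 : R) <= r%:R by rewrite ler1n.
have rk k : 0 < (r%:R : R) ^+ k by rewrite exprn_gt0//; lra.
pose T := {ffun 'I_d -> 'I_(2 * m.+1 + 1)}.
pose pts (t : u.-tuple T) := map (box_point 0) t.
pose good (t : u.-tuple T) s : bool := `[< nice R (pts t) >] &&
  (u%:R * (rho * r%:R ^+ d) <= \sum_(y <- pts t) cube_time r y s)%R.
have sub : walk_mean m (fun s => (`[< heavy_nice r rho u s >])%:R) 0 <=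
    walk_mean m (fun s => \sum_(t : u.-tuple T) (good t s)%:R) 0 :> R.
  apply: le_walk_mean_in => s ns; case: asboolP => [|_]; last exact: sumr_ge0.
  move=> [U [uU sU nU hU]].
  have hp y : y \in U -> exists c : T, y = box_point 0 c.
    move=> yU; apply: box_pointP => i; rewrite !mxE.
    have /(near_path_cube r0 ns)/(_ i) : 0 < cube_time r y s.
      by apply: lt_le_trans (hU y yU); rewrite mulr_gt0.
    by rewrite ?subr0.
  pose code y : T := if pselect (exists c : T, y = box_point 0 c) is left h
    then projT1 (cid h) else [ffun=> ord0].
  have codeK y : y \in U -> box_point 0 (code y) = y.
    move=> /hp yc; rewrite /code; case: pselect => // h.
    by case: (cid h).
  have st : size (map code U) == u by rewrite size_map sU.
  pose t : u.-tuple T := Tuple st.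
  have ptsE : pts t = U.
    by rewrite /pts /= -map_comp map_id_in// => y yU /=; exact: codeK.
  rewrite (bigD1 t)//= -[leLHS]addr0 lerD ?sumr_ge0//.
  have key : u%:R * (rho * r%:R ^+ d) <= \sum_(y <- U) cube_time r y s.
    have -> : u%:R * (rho * r%:R ^+ d) = \sum_(y <- U) rho * r%:R ^+ d.
      by rewrite big_const_seq count_predT iter_addr_0 sU mulr_natl.
    rewrite big_seq [leRHS]big_seq.
    by apply: ler_sum => y; exact: hU.
  by rewrite /good ptsE asboolT//= key.
apply: le_trans sub _; rewrite walk_mean_sum//.
pose B : R := 2 * expR (- (c * (u%:R * (rho * r%:R ^+ d)) / r%:R ^+ 2)).
have B0 : 0 <= B by rewrite mulr_ge0 ?expR_ge0.
apply: (@le_trans _ _ (\sum_(t : u.-tuple T) B)).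
  apply: ler_sum => t _; rewrite /good.
  case: asboolP => [nt|_] /=; first exact: tail.
  by rewrite walk_mean_cst.
rewrite sumr_const card_tuple card_ffun !card_ord -[leLHS]mulr_natl.
have m1 : (1 : R) < m%:R by rewrite ltr1n.
have lnm0 : 0 < ln (m%:R : R) by rewrite ln_gt0.
have m0 : 0 < (m%:R : R) by lra.
have u1 : (1 : R) <= u%:R by rewrite ler1n.
have d1 : (1 : R) <= d%:R by rewrite ler1n.
have e4 : (((2 * m.+1 + 1) ^ d) ^ u)%:R <= expR (4 * d%:R * u%:R * ln m%:R) :> R.
  have -> : 4 * d%:R * u%:R * ln m%:R = (4 * d * u)%:R * ln (m%:R : R).
    by rewrite !natrM.
  rewrite expRM_natl lnK ?posrE// -natrX ler_nat -expnM -mulnA (expnM m).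
  rewrite leq_exp2r ?muln_gt0 ?u0//.
  have m8 : (m * 2 ^ 3 <= m ^ 4)%N by rewrite (expnS m 3) leq_mul// leq_exp2r.
  by apply: leq_trans m8; lia.
have e2 : 2 <= expR (4 * d%:R * u%:R * ln m%:R) :> R.
  apply: (@le_trans _ _ (m%:R : R)); first by rewrite ler_nat.
  rewrite -[leLHS](@lnK R) ?posrE// ler_expR ler_peMl ?(ltW lnm0)//; nra.
apply: (@le_trans _ _ (expR (4 * d%:R * u%:R * ln m%:R) *
  (expR (4 * d%:R * u%:R * ln m%:R) *
   expR (- (c * (u%:R * (rho * r%:R ^+ d)) / r%:R ^+ 2))))).
  by apply: ler_pM => //; rewrite ler_wpM2r ?expR_ge0.
rewrite -!expRD ler_expR.
have -> : c * (u%:R * (rho * r%:R ^+ d)) / r%:R ^+ 2 = c * u%:R * (rho * r%:R ^+ n).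
  by rewrite -(addn2 n) exprD; field; rewrite gt_eqF//; lra.
have : 16 * d%:R * ln m%:R <= c * (rho * r%:R ^+ n).
  by move: hC; rewrite mulrAC ler_pdivrMr// mulrC [leRHS]mulrC.
move=> /(ler_wpM2r (ler0n R u)).
lra.
Qed.

End HeavyNice.

(** * Finite lists for the heavy cubes and their union *)

Section HeavySeq.
Variables (R : realType) (n : nat).
Local Notation d := (n.+2).
Local Notation V := 'rV[int]_d.
Implicit Types (x y z : V) (U Y s : seq V) (r m : nat) (rho : R).

(** The cubes centred at r Z^d tile the lattice; in each coordinate the tile of z is floor (z / r +
    1/2). *)
Definition cube_index r z : V := \row_i divz (2 * z 0 i + r%:Z) (2 * r%:Z).

Lemma cube_indexP r y z : (0 < r)%N ->
  cube r (r%:Z *: y) z <-> y = cube_index r z.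
Proof.
move=> r0; have cP y' : cube r (r%:Z *: y') z <->
    forall i, 0 <= 2 * z 0 i + r%:Z - y' 0 i * (2 * r%:Z) < 2 * r%:Z.
  split.
    move=> /(@cubeP R) h i; have := h i; rewrite mxE.
    move: (z 0 i) (y' 0 i) => a b /andP[h1 h2].
    have {}h1 : - r%:Z <= 2 * (a - r%:Z * b) by rewrite -(ler_int R) rmorphM rmorphN.
    have {}h2 : 2 * (a - r%:Z * b) < r%:Z by rewrite -(ltr_int R) rmorphM.
    nia.
  move=> h; apply/(@cubeP R) => i; have := h i; rewrite mxE.
  move: (z 0 i) (y' 0 i) => a b h'.
  have : (- r%:Z <= 2 * (a - r%:Z * b)) && (2 * (a - r%:Z * b) < r%:Z) by nia.
  by rewrite -(ler_int R) -(ltr_int R) !rmorphM rmorphN.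
split=> [/cP h|->].
  apply/rowP => i; rewrite mxE; have := h i; move: (z 0 i) (y 0 i) => a b h'.
  have r0' : 0 < 2 * r%:Z by lia.
  apply/eqP; rewrite eq_le; apply/andP; split.
    by rewrite lez_divRL//; lia.
  by rewrite -ltzD1 ltz_divLR//; nia.
apply/cP => i; rewrite mxE; move: (2 * z 0 i + r%:Z) => a.
have r0' : 2 * r%:Z != 0 by lia.
rewrite {1 3}(divz_eq a (2 * r%:Z)) addrAC subrr add0r modz_ge0//=.
by apply: ltz_pmod; lia.
Qed.

(** When rho > 0 a heavy cube has been visited, so searching among the tiles of visited sites loses
    nothing. *)
Definition heavy_seq r rho s : seq V :=
  [seq y <- undup (map (cube_index r) s) | rho * r%:R ^+ d <= cube_time R r y s].

Lemma uniq_heavy_seq r rho s : uniq (heavy_seq r rho s).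
Proof. by rewrite filter_uniq// undup_uniq. Qed.

Lemma mem_heavy_seq r rho s y : (0 < r)%N -> 0 < rho ->
  (y \in heavy_seq r rho s) = (rho * r%:R ^+ d <= cube_time R r y s).
Proof.
move=> r0 rho0; rewrite mem_filter andbC; apply/andP/idP => [[]//|hy]; split=> //.
rewrite mem_undup; apply/mapP; apply: contrapT => nz.
have : 0 < cube_time R r y s.
  by apply: lt_le_trans hy; rewrite mulr_gt0// exprn_gt0// ltr0n.
rewrite /cube_time big_seq big1 ?ltxx// => z zs.
by rewrite asboolF// => /(cube_indexP _ _ r0) yE; apply: nz; exists z.
Qed.

Lemma set_size_seq (X : seq V) : uniq X -> set_size [set` X] = size X.
Proof.
move=> uX; rewrite /set_size; apply: perm_size; apply: uniq_perm => // x.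
by rewrite in_fset_set ?mem_setE//; exact: finite_seq.
Qed.

Lemma local_time_setE (W : simple_random_walk R d) m (w : srw_space W) r y :
  (local_time_set m w (cube r (r%:Z *: y)))%:R = cube_time R r y (traj m w).
Proof.
set L := cube _ _; set s := traj m w.
have ltE z : local_time m w z = (\sum_(u <- s) (u == z))%N.
  by rewrite /local_time /s /traj big_map /index_iota subn0.
clearbody s; rewrite /local_time_set -(fsbig_widen (L `&` [set` undup s]) L); first last.
- move=> z /= [Lz nz]; rewrite ltE big_seq big1// => u us.
  by case: eqP => // uz; exfalso; apply: nz; rewrite uz in us; split; rewrite ?mem_undup.
- by move=> z [].
rewrite fsbig_mkcondl -fsbig_seq ?undup_uniq//= natr_sum.
rewrite /cube_time -/L.
under [RHS]eq_big_seq => u us.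
  rewrite (_ : (_)%:R = \sum_(z <- undup s) (if z \in L then (u == z)%:R else 0)).
    over.
  rewrite (bigD1_seq u) ?mem_undup ?undup_uniq//= eqxx big1 ?addr0.
    by rewrite (_ : (u \in L) = `[< L u >])//; case: asboolP.
  by move=> z zu; rewrite eq_sym (negbTE zu); case: ifP.
rewrite exchange_big /=; apply: eq_bigr => z _.
case: ifP => zL; last by rewrite big1.
by rewrite ltE natr_sum.
Qed.

Lemma heavyE (W : simple_random_walk R d) m (w : srw_space W) r rho :
  (0 < r)%N -> 0 < rho ->
  heavy m r rho w = [set` [seq r%:Z *: y | y <- heavy_seq r rho (traj m w)]].
Proof.
move=> r0 rho0; apply/seteqP; split=> x /=.
  move=> [[y ->]]; rewrite local_time_setE => hy.
  by apply: map_f; rewrite mem_heavy_seq.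
move=> /mapP[y]; rewrite mem_heavy_seq// => hy ->; split; first by exists y.
by rewrite local_time_setE.
Qed.

Lemma scale_inj r : (0 < r)%N -> injective (fun y : V => r%:Z *: y).
Proof.
move=> r0 x y /rowP h; apply/rowP => i; have := h i; rewrite !mxE.
by move=> /mulfI; apply; rewrite -lt0n in r0 *.
Qed.

Lemma set_size_heavy (W : simple_random_walk R d) m (w : srw_space W) r rho :
  (0 < r)%N -> 0 < rho ->
  set_size (heavy m r rho w) = size (heavy_seq r rho (traj m w)).
Proof.
move=> r0 rho0; rewrite heavyE// set_size_seq ?size_map//.
by rewrite map_inj_uniq ?uniq_heavy_seq//; exact: scale_inj.
Qed.

Definition cube_seq r x : seq V :=
  [seq z <- undup (codom (@box_point d r x)) | `[< cube r x z >]].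

Lemma uniq_cube_seq r x : uniq (cube_seq r x).
Proof. by rewrite filter_uniq// undup_uniq. Qed.

Lemma mem_cube_seq r x z : (z \in cube_seq r x) = `[< cube r x z >].
Proof.
rewrite mem_filter andb_idr// => /asboolP zc; rewrite mem_undup.
have [c ->] : exists c : {ffun 'I_d -> 'I_(2 * r + 1)}, z = box_point x c.
  apply: box_pointP => i; have /(@cubeP R)/(_ i) := zc.
  move: (z 0 i - x 0 i) => a /andP[h1 h2].
  have {}h1 : - r%:Z <= 2 * a by rewrite -(ler_int R) rmorphM rmorphN.
  have {}h2 : 2 * a < r%:Z by rewrite -(ltr_int R) rmorphM.
  lia.
exact: codom_f.
Qed.

(** The r consecutive offsets starting at - floor (r / 2) fit the half-open cube whatever the parity
    of r. *)
Lemma size_cube_seq r x : (r ^ d <= size (cube_seq r x))%N.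
Proof.
pose pt (c : {ffun 'I_d -> 'I_r}) : V := \row_i (x 0 i - (r./2)%:Z + (c i)%:Z).
have pt_inj : injective pt.
  move=> c c' /rowP h; apply/ffunP => i; apply: val_inj => /=.
  by have := h i; rewrite !mxE => /addrI [].
rewrite -[X in (X ^ _)%N]card_ord -[X in (_ ^ X)%N]card_ord -card_ffun.
rewrite -(size_codom pt); apply: uniq_leq_size.
  by rewrite map_inj_uniq// enum_uniq.
move=> z /codomP[c ->]; rewrite mem_cube_seq; apply/asboolP/(@cubeP R) => i.
rewrite mxE; have := ltn_ord (c i); have := odd_double_half r.
move: (x 0 i) (nat_of_ord (c i)) r./2 => a k h hr kr.
have : (- r%:Z <= 2 * (a - h%:Z + k%:Z - a)) && (2 * (a - h%:Z + k%:Z - a) < r%:Z).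
  by move: hr; case: (odd r); lia.
by rewrite -(ler_int R) -(ltr_int R) !rmorphM rmorphN.
Qed.

Definition region_seq r rho s : seq V :=
  flatten [seq cube_seq r (r%:Z *: y) | y <- heavy_seq r rho s].

Lemma mem_region_seq r rho s z : reflect
  (exists2 y, y \in heavy_seq r rho s & cube r (r%:Z *: y) z)
  (z \in region_seq r rho s).
Proof.
apply: (iffP flatten_mapP) => -[y yh zc]; exists y => //.
  by move: zc; rewrite mem_cube_seq => /asboolP.
by rewrite mem_cube_seq; exact/asboolP.
Qed.

Lemma uniq_region_seq r rho s : (0 < r)%N -> uniq (region_seq r rho s).
Proof.
move=> r0; rewrite /region_seq; have := uniq_heavy_seq r rho s.
elim: (heavy_seq _ _ _) => //= y Y IH /andP[yY uY].
rewrite cat_uniq uniq_cube_seq IH// andbT /=.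
apply/hasPn => z /flatten_mapP[y' y'Y]; rewrite !mem_cube_seq => /asboolP.
move=> /(cube_indexP _ _ r0) y'E; apply/asboolP => /(cube_indexP _ _ r0) yE.
by rewrite yE -y'E y'Y in yY.
Qed.

Lemma heavy_regionE (W : simple_random_walk R d) m (w : srw_space W) r rho :
  (0 < r)%N -> 0 < rho ->
  heavy_region m r rho w = [set` region_seq r rho (traj m w)].
Proof.
move=> r0 rho0; rewrite /heavy_region heavyE//; apply/seteqP; split=> z /=.
  by move=> [_ /= /mapP[y yh ->] zc]; apply/mem_region_seq; exists y.
move=> /mem_region_seq[y yh zc]; exists (r%:Z *: y) => //=.
exact: map_f.
Qed.

Lemma size_region_seq r rho s :
  (r ^ d * size (heavy_seq r rho s) <= size (region_seq r rho s))%N.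
Proof.
rewrite /region_seq; elim: (heavy_seq _ _ _) => [|y Y IH]; first by rewrite muln0.
by rewrite /= size_cat mulnS leq_add// size_cube_seq.
Qed.

End HeavySeq.

(** * Upper tail and capacity estimates *)

Section UpperTail.
Variables (R : realType) (n : nat).
Hypothesis n_gt0 : (0 < n)%N.
Local Notation d := (n.+2).
Local Notation V := 'rV[int]_d.
Implicit Types (x y z : V) (U Y s : seq V) (r m : nat) (rho : R).
Local Notation sqnorm := (sqnorm R).

Lemma nice_take u U : nice R U -> nice R (take u U).
Proof.
move=> nU x /mem_take xU; apply: le_trans (nU x xU).
rewrite -[in leRHS](cat_take_drop u U) big_cat /= lerDl.
by apply: sumr_ge0 => y _; exact: ker_ge0.
Qed.

Definition nice_heavy r rho (t : R) s := exists U,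
  [/\ uniq U, nice R U, {subset U <= heavy_seq r rho s} & t <= (size U)%:R].

Lemma nice_heavy_tail : exists c C : R, [/\ 0 < c, 0 < C &
  forall (W : simple_random_walk R d) m r rho (t : R),
  (2 <= m)%N -> (0 < r)%N -> 0 < rho -> 0 < t ->
  C * ln m%:R <= rho * r%:R ^+ n ->
  (srw_law W 0 [set w | nice_heavy r rho t (traj m w)] <=
    (expR (- (c * rho * r%:R ^+ n * t)))%:E)%E].
Proof.
have [c [C [c0 C0 tail]]] := heavy_nice_tail R n_gt0.
exists (c / 2), C; split=> //; first by rewrite divr_gt0.
move=> W m r rho t m2 r0 rho0 t0 hC.
rewrite law_traj// lee_fin.
(* Niceness is hereditary, so U may be cut to an integer size u with t <= 2 u; the maximum with 1
   covers t < 1. *)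
pose u := maxn 1 (Num.truncn t).
have u0 : (0 < u)%N by rewrite /u; lia.
have rn : 0 <= rho * r%:R ^+ n by rewrite mulr_ge0 ?exprn_ge0 ?(ltW rho0).
have tu : t <= 2 * u%:R.
  have t1 : t < (Num.truncn t).+1%:R by exact: truncnS_gt.
  apply: ltW; apply: lt_le_trans t1 _.
  by rewrite -natrM ler_nat /u; lia.
apply: le_trans (le_trans (tail m r rho u m2 r0 u0 rho0 hC) _); last first.
  rewrite ler_expR lerN2.
  have -> : c / 2 * rho * r%:R ^+ n * t = c * (rho * r%:R ^+ n) * (t / 2) by field.
  rewrite -(mulrA c rho); apply: ler_wpM2l; last by lra.
  by rewrite mulr_ge0 ?(ltW c0).
apply: le_walk_mean => s; case: asboolP => [|_]; last exact: ler0n.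
move=> [U [uU nU hU tU]]; rewrite asboolT//; exists (take u U).
have uS : (u <= size U)%N.
  rewrite /u geq_max; apply/andP; split.
    by rewrite -(ltr0n R); exact: lt_le_trans tU.
  by rewrite -(ler_nat R); apply: le_trans tU; rewrite truncn_le ltW.
split; [exact: take_uniq|exact: size_takel|exact: nice_take|].
by move=> y /mem_take /hU; rewrite mem_heavy_seq.
Qed.

Lemma measurable_nice_heavy (W : simple_random_walk R d) m r rho t :
  measurable [set w : srw_space W | nice_heavy r rho t (traj m w)].
Proof. exact: (measurable_traj_event (R := R)). Qed.

Lemma measurable_many_heavy (W : simple_random_walk R d) m r rho L :
  (0 < r)%N -> 0 < rho ->
  measurable [set w : srw_space W | (L < set_size (heavy m r rho w))%N].
Proof.
move=> r0 rho0.
rewrite (_ : [set w | _] = [set w | (L < size (heavy_seq r rho (traj m w)))%N]).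
  exact: (@measurable_traj_event R d W m [set s | (L < size (heavy_seq r rho s))%N]).
by apply/seteqP; split=> w /=; rewrite set_size_heavy.
Qed.

Lemma exponent_ge0 : 0 <= 1 - 2 / d%:R :> R.
Proof. by rewrite subr_ge0 ler_pdivrMr// mul1r ler_nat. Qed.

Lemma many_heavy_upper : exists c C : R, [/\ 0 < c, 0 < C &
  forall (W : simple_random_walk R d) m r rho L,
  (2 <= m)%N -> (0 < r)%N -> (0 < L)%N -> 0 < rho ->
  C * ln m%:R <= rho * r%:R ^+ n ->
  (srw_law W 0 [set w | (L < set_size (heavy m r rho w))%N] <=
    (expR (- (c * rho * r%:R ^+ n * L%:R `^ (1 - 2 / d%:R))))%:E)%E].
Proof.
have [c [C [c0 C0 tail]]] := nice_heavy_tail.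
have [e [e0 sub]] := nice_subset_volume R n_gt0.
exists (c * e), C; split=> //; first exact: mulr_gt0.
move=> W m r rho L m2 r0 L0 rho0 hC.
have t0 : 0 < e * L%:R `^ (1 - 2 / d%:R) by rewrite mulr_gt0// powR_gt0// ltr0n.
apply: le_trans (le_trans (tail W m r rho _ m2 r0 rho0 t0 hC) _); last first.
  by rewrite lee_fin ler_expR le_eqVlt; apply/orP; left; apply/eqP; ring.
apply: le_measure; rewrite ?inE.
- exact: measurable_many_heavy.
- exact: measurable_nice_heavy.
move=> w /=; rewrite set_size_heavy// => Lh.
have [|U [uU sU nU hU]] := sub _ (uniq_heavy_seq r rho (traj m w)).
  by rewrite -size_eq0 -lt0n; exact: leq_ltn_trans Lh.
exists U; split=> //; apply: le_trans hU; rewrite ler_wpM2l ?(ltW e0)//.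
by apply: ge0_ler_powR; rewrite ?nnegrE ?exponent_ge0// ler_nat ltnW.
Qed.

Lemma capacity_region (W : simple_random_walk R d) m r rho (w : srw_space W) :
  (0 < r)%N -> 0 < rho ->
  capacity W (heavy_region m r rho w) =
  \sum_(y <- heavy_seq r rho (traj m w)) \sum_(z <- cube_seq r (r%:Z *: y))
     fine (srw_law W z [set w' |
       return_time [set` region_seq r rho (traj m w)] w' = +oo%E]).
Proof.
move=> r0 rho0; rewrite heavy_regionE// /capacity -fsbig_seq ?uniq_region_seq//.
by rewrite /region_seq big_flatten big_map.
Qed.

(** The weight of a cube is its equilibrium mass times a constant over r^n; feasibility is
    [equilibrium_kernel_le] evaluated at the centre r x. *)
Lemma nice_subset_capacity : exists c : R, 0 < c /\
  forall (W : simple_random_walk R d) m r rho (w : srw_space W),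
  (0 < r)%N -> 0 < rho -> exists U,
  [/\ uniq U, {subset U <= heavy_seq r rho (traj m w)}, nice R U &
    c * capacity W (heavy_region m r rho w) / r%:R ^+ n <= (size U)%:R].
Proof.
have [K [K0 hK]] := equilibrium_kernel_le R n_gt0.
(* For z in the cube of y, |r x - z|^2 + 1 <= (2 + d) r^2 (|x - y|^2 + 1). *)
pose a : R := ker n (2 + d%:R).
have a0 : 0 < a by rewrite ker_gt0// ltr_pwDl.
exists (a / K / 2); split; first by rewrite !divr_gt0.
move=> W m r rho w r0 rho0; rewrite capacity_region//.
set s := traj m w; set Y := heavy_seq r rho s.
pose e z := fine (srw_law W z [set w' |
  return_time [set` region_seq r rho s] w' = +oo%E]).
have e0 z : 0 <= e z by rewrite fine_ge0// measure_ge0.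
have r1 : (1 : R) <= r%:R by rewrite ler1n.
have rk k : 0 < (r%:R : R) ^+ k by rewrite exprn_gt0//; lra.
have d20 : 0 <= 2 + d%:R :> R by apply: addr_ge0; exact: ler0n.
pose E y := \sum_(z <- cube_seq r (r%:Z *: y)) e z.
have E0 y : 0 <= E y by apply: sumr_ge0.
pose al := a / K / r%:R ^+ n.
have al0 : 0 < al by rewrite !divr_gt0.
have pot x : \sum_(y <- Y) al * E y * ker n (sqnorm (x - y) + 1) <= 1.
  have := hK W (region_seq r rho s) (r%:Z *: x) (uniq_region_seq _ _ r0).
  rewrite /region_seq big_flatten big_map -/Y => hKx.
  have : \sum_(y <- Y) (a / r%:R ^+ n * E y * ker n (sqnorm (x - y) + 1)) <= K.
    apply: le_trans hKx; apply: ler_sum => y _.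
    rewrite /E mulrAC mulr_sumr big_seq [leRHS]big_seq; apply: ler_sum => z.
    rewrite (mem_cube_seq R) => /asboolP zc; rewrite mulrC; apply: ler_wpM2l; first exact: e0.
    have kr : a / r%:R ^+ n = ker n ((2 + d%:R) * r%:R ^+ 2).
      by rewrite (kerM n _ d20) kerX2 ?ler0n.
    have N0 := sqnorm_ge0 R (x - y).
    rewrite kr -kerM ?(mulr_ge0 d20) ?(ltW (rk _))//; apply: le_ker.
      by have := sqnorm_ge0 R (r%:Z *: x - z); lra.
    have : sqnorm (r%:Z *: x - z) <=
        2 * (r%:R ^+ 2 * sqnorm (x - y)) + 2 * (d%:R / 4 * r%:R ^+ 2).
      have -> : r%:Z *: x - z = r%:Z *: (x - y) + (r%:Z *: y - z).
        by rewrite scalerBr; apply/rowP => i; rewrite !mxE; ring.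
      apply: le_trans (sqnormD_le R _ _) _; rewrite sqnormZ lerD2l ler_wpM2l//.
      by rewrite (sqnormB R (r%:Z *: y)); apply: sqnorm_cube; move/cube_shift: zc.
    have := rk 2%N; have := exprn_ege1 2 r1; set q := r%:R ^+ 2; set N := sqnorm _.
    have d0 : (0 : R) <= d%:R by [].
    have := mulr_ge0 d0 N0; rewrite -/N => dN q1 q0 hN.
    have := mulr_ge0 (ltW q0) dN; have := mulr_ge0 (ltW q0) d0; lra.
  have -> : \sum_(y <- Y) al * E y * ker n (sqnorm (x - y) + 1) =
    K^-1 * \sum_(y <- Y) (a / r%:R ^+ n * E y * ker n (sqnorm (x - y) + 1)).
    by rewrite mulr_sumr; apply: eq_bigr => y _; rewrite /al; ring.
  by move=> hS; rewrite [leLHS]mulrC ler_pdivrMr// mul1r.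
pose q y := if y \in Y then al * E y else 0.
have uY : uniq Y by exact: uniq_heavy_seq.
have sumq (F : V -> R) : \sum_(y <- Y) q y * F y = \sum_(y <- Y) al * E y * F y.
  by apply: eq_big_seq => y yY; rewrite /q yY.
have [||U [u1 u2 u3 u4]] := @nice_rounding R n Y q uY.
(* The bound q x <= 1 comes from the constraint at x itself, whose diagonal term is q x. *)
- move=> x; rewrite /q; case: ifP => xY; last by rewrite lexx ler01.
  rewrite mulr_ge0 ?(ltW al0)//=; apply: le_trans (pot x).
  rewrite (bigD1_seq x)//= subrr sqnorm0 add0r ker1 mulr1 lerDl.
  apply: sumr_ge0 => y _; apply: mulr_ge0 (ker_ge0 _ _).
  exact: mulr_ge0 (ltW al0) (E0 y).
- by move=> x _; rewrite (sumq (fun y => ker n (sqnorm (x - y) + 1))).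
exists U; split=> //.
have -> : a / K / 2 * (\sum_(y <- Y) E y) / r%:R ^+ n = (\sum_(y <- Y) q y) / 2.
  under [in RHS]eq_bigr do rewrite -[q _]mulr1.
  rewrite sumq; under [in RHS]eq_bigr do rewrite mulr1.
  by rewrite -mulr_sumr /al; field; rewrite !gt_eqF.
by rewrite ler_pdivrMr// mulrC.
Qed.

Lemma measurable_capacity_event (W : simple_random_walk R d) m r rho (F : nat -> R) :
  (0 < r)%N -> 0 < rho ->
  measurable [set w : srw_space W | capacity W (heavy_region m r rho w) <=
    F (set_size (heavy_region m r rho (w : srw_space W)))].
Proof.
move=> r0 rho0.
rewrite (_ : [set w | _] = [set w | capacity W [set` region_seq r rho (traj m w)] <=
    F (set_size [set` region_seq r rho (traj m w)])]).
  exact: (@measurable_traj_event R d W m [set s |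
    capacity W [set` region_seq r rho s] <= F (set_size [set` region_seq r rho s])]).
by apply/seteqP; split=> w /=; rewrite heavy_regionE.
Qed.

(** On this event, with V the heavy region, there is a nice set of heavy cubes of size at least e A
    |V|^(1-2/d) / r^n, and |V| >= r^d L cancels r^n. *)
Lemma capacity_tail : exists c C : R, [/\ 0 < c, 0 < C &
  forall (A : R) (W : simple_random_walk R d) m r rho L, 0 < A ->
  (2 <= m)%N -> (0 < r)%N -> (0 < L)%N -> 0 < rho ->
  C * ln m%:R <= rho * r%:R ^+ n ->
  (srw_law W 0 ([set w | (L < set_size (heavy m r rho w))%N] `\`
      [set w | (capacity W (heavy_region m r rho w) <=
         A * (set_size (heavy_region m r rho w))%:R `^ (1 - 2 / d%:R))%R]) <=
    (expR (- (c * A * rho * r%:R ^+ n * L%:R `^ (1 - 2 / d%:R))))%:E)%E].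
Proof.
have [c [C [c0 C0 tail]]] := nice_heavy_tail.
have [e [e0 sub]] := nice_subset_capacity.
exists (c * e), C; split=> //; first exact: mulr_gt0.
move=> A W m r rho L A0 m2 r0 L0 rho0 hC.
have t0 : 0 < e * A * L%:R `^ (1 - 2 / d%:R).
  by rewrite !mulr_gt0// powR_gt0// ltr0n.
apply: le_trans (le_trans (tail W m r rho _ m2 r0 rho0 t0 hC) _); last first.
  by rewrite lee_fin ler_expR le_eqVlt; apply/orP; left; apply/eqP; ring.
apply: le_measure; rewrite ?inE.
- apply: measurableD; first exact: measurable_many_heavy.
  exact: (measurable_capacity_event W m (fun k => A * k%:R `^ (1 - 2 / d%:R))).
- exact: measurable_nice_heavy.
move=> w [/=]; rewrite set_size_heavy// => Lh /negP; rewrite -ltNge => cap.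
have [U [uU sU nU hU]] := sub W m r rho w r0 rho0.
exists U; split=> //; apply: le_trans hU.
have rk k : 0 < (r%:R : R) ^+ k by rewrite exprn_gt0// ltr0n.
rewrite ler_pdivlMr// -!mulrA ler_wpM2l ?(ltW e0)//; apply: le_trans (ltW cap).
rewrite ler_wpM2l ?(ltW A0)// heavy_regionE// set_size_seq ?uniq_region_seq//.
apply: (@le_trans _ _ ((r ^ d * L)%:R `^ (1 - 2 / d%:R))).
  rewrite natrM powRM ?ler0n// mulrC ler_wpM2r ?powR_ge0//.
  rewrite natrX -powR_mulrn ?ler0n// -powRrM mulrBr mulr1 mulrCA mulfV ?pnatr_eq0//.
  by rewrite mulr1 -natrB// -powR_mulrn ?ler0n// subSS subSS subn0.
apply: ge0_ler_powR; rewrite ?nnegrE ?exponent_ge0 ?ler0n// ler_nat.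
apply: leq_trans (size_region_seq r rho (traj m w)).
by rewrite leq_mul2l ltnW ?orbT.
Qed.

End UpperTail.

(** * Lower tail: Gaussian tilting *)

Section GaussianRatio.
Variables (R : realType) (n : nat).
Local Notation d := (n.+2).
Local Notation V := 'rV[int]_d.
Implicit Types (x : V).
Local Notation sqnorm := (sqnorm R).

Lemma expR_pair_ge (v : R) : 2 + v ^+ 2 / 4 <= expR (- v) + expR v.
Proof.
wlog v0 : v / 0 <= v.
  move=> h; have [v0|v0] := lerP 0 v; first exact: h.
  by have := h (- v); rewrite opprK sqrrN oppr_ge0 (addrC (expR v)); apply; exact: ltW.
have e2 : (1 + v / 2) ^+ 2 <= expR v.
  have -> : expR v = expR (v / 2) ^+ 2.
    by rewrite -expRM_natl mulrC divfK.
  by rewrite lerXn2r ?nnegrE ?expR_ge0 ?expR_ge1Dx//; lra.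
have := expR_ge1Dx (- v); lra.
Qed.

Lemma expR_pair_le (v : R) : `|v| <= 1/2 -> expR (- v) + expR v <= 2 + 4 * v ^+ 2.
Proof.
have h (w : R) : `|w| <= 1/2 -> expR w <= 1 + w + 2 * w ^+ 2.
  rewrite ler_norml => /andP[w1 w2].
  have e0 : 0 < expR (- w) by exact: expR_gt0.
  have e1 : 1 - w <= expR (- w) by exact: expR_ge1Dx.
  have -> : expR w = (expR (- w))^-1 by rewrite expRN invrK.
  rewrite -[leLHS]mul1r ler_pdivrMr//.
  have w20 : 0 <= w ^+ 2 by rewrite sqr_ge0.
  have p0 : 0 <= 1 + w + 2 * w ^+ 2 by nra.
  apply: le_trans (ler_wpM2l p0 e1); nra.
by move=> hv; have := h v hv; have := h (- v); rewrite normrN sqrrN => /(_ hv); lra.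
Qed.

Lemma avg_gauss_lower (g : R) x : 0 <= g <= 1 ->
  expR (- (g * sqnorm x)) * ((1 - g) * (1 + g ^+ 2 * sqnorm x / (2 * d%:R))) <=
  avg (fun y => expR (- (g * sqnorm y))) x.
Proof.
move=> /andP[g0 g1]; rewrite avg_gauss; apply: ler_wpM2l; first exact: expR_ge0.
have d0 : (0 : R) < d%:R by rewrite ltr0n.
have d0' : (d%:R : R) != 0 by rewrite gt_eqF.
have S : 2 * d%:R + g ^+ 2 * sqnorm x <=
   \sum_i (expR (- (2 * g * (x 0 i)%:~R)) + expR (2 * g * (x 0 i)%:~R)).
  have -> : 2 * d%:R + g ^+ 2 * sqnorm x =
      \sum_i (2 + (2 * g * (x 0 i)%:~R) ^+ 2 / 4).
    rewrite big_split sumr_const card_ord; congr (_ + _).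
      by rewrite mulr_natr.
    by rewrite /sqnorm mulr_sumr; apply: eq_bigr => i _; field.
  by apply: ler_sum => i _; exact: expR_pair_ge.
have eg : 1 - g <= expR (- g) by exact: expR_ge1Dx.
rewrite natrM [leRHS]mulrAC.
have -> : 1 + g ^+ 2 * sqnorm x / (2 * d%:R) =
   (2 * d%:R + g ^+ 2 * sqnorm x) / (2 * d%:R).
  by field; have := ler0n R n; lra.
rewrite mulrA; apply: ler_wpM2r; first by rewrite invr_ge0 mulr_ge0// ltW.
apply: ler_pM => //; first by lra.
by rewrite addr_ge0 ?mulr_ge0 ?sqr_ge0 ?sqnorm_ge0// ltW.
Qed.

Lemma avg_gauss_upper (g : R) x : 0 <= g -> 16 * (g ^+ 2 * sqnorm x) <= 1 ->
  avg (fun y => expR (- (g * sqnorm y))) x <=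
  expR (- (g * sqnorm x)) * ((1 + 8 * (g ^+ 2 * sqnorm x) / d%:R) / (1 + g)).
Proof.
move=> g0 hx; rewrite avg_gauss; apply: ler_wpM2l; first exact: expR_ge0.
have d0 : (0 : R) < d%:R by rewrite ltr0n.
have d0' : (d%:R : R) != 0 by rewrite gt_eqF.
have S : \sum_i (expR (- (2 * g * (x 0 i)%:~R)) + expR (2 * g * (x 0 i)%:~R)) <=
   2 * d%:R + 16 * (g ^+ 2 * sqnorm x).
  have -> : 2 * d%:R + 16 * (g ^+ 2 * sqnorm x) =
      \sum_i (2 + 4 * (2 * g * (x 0 i)%:~R) ^+ 2).
    rewrite big_split sumr_const card_ord; congr (_ + _).
      by rewrite mulr_natr.
    by rewrite /sqnorm !mulr_sumr; apply: eq_bigr => i _; ring.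
  apply: ler_sum => i _; apply: expR_pair_le.
  rewrite -ler_sqr ?nnegrE// real_normK ?num_real//.
  have := ler_wpM2l (sqr_ge0 g) (sqr_coord_le R x i).
  set a := _%:~R; lra.
have eg : expR (- g) <= (1 + g)^-1.
  rewrite expRN lef_pV2 ?posrE ?expR_gt0//; last by lra.
  exact: expR_ge1Dx.
rewrite natrM [leLHS]mulrAC ler_pdivrMr ?mulr_gt0//.
have -> : (1 + 8 * (g ^+ 2 * sqnorm x) / d%:R) / (1 + g) * (2 * d%:R) =
  (1 + g)^-1 * (2 * d%:R + 16 * (g ^+ 2 * sqnorm x)).
  by field; have := ler0n R n; lra.
apply: ler_pM => //; rewrite ?expR_ge0//.
by apply: sumr_ge0 => i _; rewrite addr_ge0 ?expR_ge0.
Qed.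

End GaussianRatio.

(** * Growth of the tilting Gaussian and a subsolution away from the origin *)

Section TiltedWalk.
Variables (R : realType) (n : nat).
Hypothesis n_gt0 : (0 < n)%N.
Local Notation d := (n.+2).
Local Notation V := 'rV[int]_d.
Implicit Types (x y : V) (u : R).
Local Notation sqnorm := (sqnorm R).

Definition gauss u x : R := expR (- (u * sqnorm x)).

Lemma gauss_gt0 u x : 0 < gauss u x. Proof. exact: expR_gt0. Qed.

(* The generator of the walk tilted by [gauss u] kills at rate
   [1 - growth u], which is positive near the origin and negative far away. *)
Definition growth u x := avg (gauss u) x / gauss u x.

Lemma growthE u x : avg (gauss u) x = growth u x * gauss u x.
Proof. by rewrite /growth divfK// gt_eqF// gauss_gt0. Qed.

Lemma growth_ge u x : 0 <= u <= 1 -> 1 - u <= growth u x.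
Proof.
move=> u01; rewrite /growth ler_pdivlMr ?gauss_gt0// mulrC.
apply: le_trans (avg_gauss_lower x u01); apply: ler_wpM2l; first exact: expR_ge0.
have /andP[u0 u1] := u01; rewrite ler_peMr ?subr_ge0// lerDl.
by rewrite divr_ge0 ?mulr_ge0 ?sqr_ge0 ?sqnorm_ge0 ?ler0n.
Qed.

Lemma growth_le_near u x : 0 < u <= 1/4 -> u * sqnorm x <= 1/4 ->
  growth u x <= 1 - u / 4.
Proof.
move=> /andP[u0 u1] ux; rewrite /growth ler_pdivrMr ?gauss_gt0// mulrC.
set N := sqnorm x in ux *.
have uuN : u ^+ 2 * N <= u / 4 by rewrite expr2 -mulrA; nra.
have h16 : 16 * (u ^+ 2 * sqnorm x) <= 1 by rewrite -/N; lra.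
apply: le_trans (avg_gauss_upper (ltW u0) h16) _.
apply: ler_wpM2l; first exact: expR_ge0.
have d3 : (3 : R) <= d%:R by rewrite ler_nat.
rewrite -/N ler_pdivrMr; last by lra.
have : 8 * (u ^+ 2 * N) / d%:R <= 2 * u / 3.
  rewrite ler_pdivrMr; last by lra.
  by nra.
have uu : u * u <= u / 4 by nra.
set w := _ / d%:R; lra.
Qed.

Lemma growth_le u x : 0 < u -> 8 * 8 * d%:R * u <= 1 -> u * sqnorm x <= 4 * d%:R ->
  growth u x <= 1 + 32 * u.
Proof.
move=> u0 u1 ux; rewrite /growth ler_pdivrMr ?gauss_gt0// mulrC.
set N := sqnorm x in ux *.
have d0 : (0 : R) < d%:R by rewrite ltr0n.
have uuN : u ^+ 2 * N <= 4 * d%:R * u by rewrite expr2 -mulrA mulrC ler_wpM2r// ltW.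
have h16 : 16 * (u ^+ 2 * sqnorm x) <= 1 by rewrite -/N; lra.
apply: le_trans (avg_gauss_upper (ltW u0) h16) _.
apply: ler_wpM2l; first exact: expR_ge0.
rewrite -/N ler_pdivrMr; last by lra.
have : 8 * (u ^+ 2 * N) / d%:R <= 32 * u by rewrite ler_pdivrMr//; lra.
set w := _ / d%:R; nra.
Qed.

Lemma growth_ge_far u x : 0 < u <= 1/4 -> 4 * d%:R <= u * sqnorm x ->
  1 + u / 2 <= growth u x.
Proof.
move=> /andP[u0 u1] ux; rewrite /growth ler_pdivlMr ?gauss_gt0// mulrC.
have u01 : 0 <= u <= 1 by apply/andP; split; lra.
apply: le_trans (avg_gauss_lower x u01); apply: ler_wpM2l; first exact: expR_ge0.
have d0 : (0 : R) < d%:R by rewrite ltr0n.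
have : 2 * u <= u ^+ 2 * sqnorm x / (2 * d%:R).
  rewrite ler_pdivlMr ?mulr_gt0// expr2 -mulrA.
  by have := ler_wpM2l (ltW u0) ux; lra.
set w := _ / (2 * d%:R); nra.
Qed.

(** For u |x|^2 <= 4 d the growth l differs from 1 by at most 32 u, too little against the relative
    gain v >= 180 u of the narrow Gaussian g2. *)
Let near_zone (u eta g2 l a v : R) : 0 < u -> 0 < eta -> 0 < g2 -> 4 * u <= 1 ->
  9 * 20 * u <= v -> g2 * (1 + v) <= a -> 1 - u <= l -> l <= 1 + 32 * u ->
  eta / 2 <= g2 -> l * (g2 - eta) + eta / (8 * 9) * u * (1 + l) <= a - eta.
Proof.
move=> u0 eta0 g20 u1 gu2 sub l0 l1 ge.
have b1 : `|(l - 1) * (g2 - eta)| <= 32 * u * (3 * g2).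
  rewrite normrM; apply: ler_pM => //; rewrite ler_norml; apply/andP; split; lra.
have b2 := ler_wpM2l (ltW g20) gu2.
have b3 : eta / (8 * 9) * u * (1 + l) <= u * g2.
  have : eta / (8 * 9) * (1 + l) <= eta / (8 * 9) * 11 by apply: ler_wpM2l; lra.
  move=> h; have {h} : eta / (8 * 9) * (1 + l) <= g2 by lra.
  by move=> /(ler_wpM2l (ltW u0)); lra.
have b4 : 0 <= u * g2 by rewrite mulr_ge0// ltW.
move: b1; rewrite ler_norml => /andP[_ b1].
clear -b1 b2 b3 b4 sub; lra.
Qed.

(** Here l > 1 multiplies the negative number g2 - eta <= - eta / 2, which alone yields the required
    gain. *)
Let far_zone (u eta g2 l a v : R) : 0 < u -> 0 < eta -> 0 < g2 -> 4 * u <= 1 ->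
  0 < v -> g2 * (1 + v) <= a -> 1 + u / 2 <= l -> g2 <= eta / 2 ->
  l * (g2 - eta) + eta / (8 * 9) * u * (1 + l) <= a - eta.
Proof.
move=> u0 eta0 g20 u1 v0 sub l1 ge.
have b1 : (l - 1) * (eta / 2) <= (l - 1) * (eta - g2).
  by apply: ler_wpM2l; lra.
have ul : u * (1 + l) <= 5 * (l - 1).
  have : 0 <= (l - 1) * (1 - 4 * u) by rewrite mulr_ge0; lra.
  by clear -u0 l1; lra.
have b2 : eta / (8 * 9) * (u * (1 + l)) <= eta / (8 * 9) * (5 * (l - 1)).
  by apply: ler_wpM2l => //; lra.
have b3 : 0 <= g2 * v by rewrite mulr_ge0// ltW.
have b4 : 0 <= eta * (l - 1) by rewrite mulr_ge0//; lra.
clear -b1 b2 b3 b4 sub; lra.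
Qed.

(** The relation gam sig = 12 d gives the narrow Gaussian a relative gain of at least gam u once u
    |x|^2 >= sig. The constant eta is twice its value at u |x|^2 = 4 d, so the difference is at most
    - eta / 2 beyond that radius, where [growth] exceeds 1. *)
Lemma far_subsolution (sig gam u eta : R) x :
  0 < sig <= 1/5 -> gam * sig = 12 * d%:R -> 0 < u -> 2 * gam * u <= 1 ->
  eta = 2 * expR (- (4 * gam * d%:R)) -> sig <= u * sqnorm x ->
  growth u x * (gauss (gam * u) x - eta) + eta / (8 * 9) * u * (1 + growth u x) <=
  avg (fun y => gauss (gam * u) y - eta) x.
Proof.
move=> /andP[sig0 sig5] gs u0 gu etaE sx.
have d3 : (3 : R) <= d%:R by rewrite ler_nat.
have gam0 : 0 < gam by rewrite -(pmulr_lgt0 _ sig0) gs; lra.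
have gam1 : 12 * 5 * d%:R <= gam.
  have : gam * sig <= gam * (1/5) by rewrite ler_wpM2l// ltW.
  lra.
have gu0 : 0 < gam * u by exact: mulr_gt0.
have gu2 : 9 * 20 * u <= gam * u by apply: ler_wpM2r; [exact: ltW|lra].
have u64 : 8 * 8 * d%:R * u <= 1.
  by have := ler_wpM2r (ltW u0) gam1; lra.
have u14 : 0 < u <= 1/4 by rewrite u0/=; lra.
have u01 : 0 <= u <= 1 by apply/andP; split; lra.
have eta0 : 0 < eta by rewrite etaE mulr_gt0// expR_gt0.
have g20 := gauss_gt0 (gam * u) x.
have g01 : 0 <= gam * u <= 1 by apply/andP; split; lra.
rewrite avgB avg_cst//.
have sub : gauss (gam * u) x * (1 + gam * u) <= avg (gauss (gam * u)) x.
  apply: le_trans (avg_gauss_lower x g01).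
  apply: ler_wpM2l; first exact: expR_ge0.
  have : 6 * (gam * u) <= (gam * u) ^+ 2 * sqnorm x / (2 * d%:R).
    rewrite ler_pdivlMr; last by lra.
    have := ler_wpM2l (ltW (mulr_gt0 gu0 gam0)) sx.
    have -> : gam * u * gam * sig = gam * u * (gam * sig) by ring.
    by rewrite gs expr2; lra.
  have v12 : 2 * (gam * u) <= 1 by lra.
  move: (gam * u) gu0 v12 (_ / (2 * d%:R)) => v v0 v12 w vw.
  have p1 : 0 <= (1 - v) * (w - 6 * v) by rewrite mulr_ge0//; lra.
  have p2 : 0 <= v * (1 - 2 * v) by rewrite mulr_ge0//; lra.
  clear -p1 p2 v0; lra.
have l0 : 1 - u <= growth u x by exact: growth_ge.
have lA : u * sqnorm x <= 4 * d%:R -> growth u x <= 1 + 32 * u.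
  exact: growth_le.
have lB : 4 * d%:R <= u * sqnorm x -> 1 + u / 2 <= growth u x.
  exact: growth_ge_far.
have gA : u * sqnorm x <= 4 * d%:R -> eta / 2 <= gauss (gam * u) x.
  move=> /(ler_wpM2l (ltW gam0)) h; rewrite etaE [leLHS]mulrC mulKf// /gauss.
  by rewrite ler_expR lerN2; lra.
have gB : 4 * d%:R <= u * sqnorm x -> gauss (gam * u) x <= eta / 2.
  move=> /(ler_wpM2l (ltW gam0)) h; rewrite etaE [leRHS]mulrC mulKf// /gauss.
  by rewrite ler_expR lerN2; lra.
have u1 : 4 * u <= 1 by move: u14 => /andP[]; lra.
have [zA|/ltW zB] := lerP (u * sqnorm x) (4 * d%:R).
  by apply: near_zone sub _ (lA zA) (gA zA).
by apply: far_zone sub (lB zB) (gB zB).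
Qed.

End TiltedWalk.

(** * Scales and one-step inequalities for the supersolution *)

Section BumpScales.
Variable R : realType.

(** The decay del acts on l (A h - Th) <= A + A l; hence the slack eps (1 + l) demanded of the
    subsolution. *)
Lemma off_cube_step (A l Th avTh h avh eps del : R) : 0 < l -> 1 <= A ->
  avh = l * h -> avh <= 1 -> -1 <= Th -> l * Th + eps * (1 + l) <= avTh ->
  del * A = eps -> 0 <= del ->
  l^-1 * (A * avh - avTh) <= (1 - del) * (A * h - Th).
Proof.
move=> l0 A1 avhE avh1 Th1 avThE delE del0.
rewrite ler_pdivrMl//.
have lTh : - (l * Th) <= A * l.
  by apply: (@le_trans _ _ l); [nra|rewrite ler_peMl// ltW].
have Aavh : A * avh <= A by rewrite ler_piMr//; lra.
have p : del * (A * avh - l * Th) <= del * (A + A * l).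
  by apply: ler_wpM2l => //; lra.
have E : l * ((1 - del) * (A * h - Th)) =
    A * avh - l * Th - del * (A * avh - l * Th) by rewrite avhE; ring.
have E2 : del * (A + A * l) = eps * (1 + l) by rewrite -delE; ring.
by rewrite E; rewrite E2 in p; lra.
Qed.

(** On the cube the bump may lose c in one step. A factor exp(2 z) absorbs this, and the killing
    exp(-3 z) leaves exp(-z), enough for the decay 1 - del. *)
Lemma cube_step (A l Th avTh h avh c z del : R) : 1/2 <= l <= 1 ->
  avh = l * h -> 1 <= A * h - Th -> 0 <= Th -> Th - c <= avTh -> 0 <= c <= z ->
  0 <= del <= 1/2 -> del <= z / 2 ->
  expR (- (3 * z)) * (l^-1 * (A * avh - avTh)) <= (1 - del) * (A * h - Th).
Proof.
move=> /andP[l2 l1] avhE psi1 Th0 avThE /andP[c0 cz] /andP[del0 del2] delz.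
set psi := A * h - Th in psi1 *.
have l0 : 0 < l by lra.
have z0 : 0 <= z by lra.
have step : l^-1 * (A * avh - avTh) <= psi * expR (2 * z).
  rewrite ler_pdivrMl//.
  have lTh : l * Th <= Th by rewrite ler_piMl.
  have ub : A * avh - avTh <= l * psi + c.
    have -> : l * psi = A * avh - l * Th by rewrite avhE /psi; ring.
    lra.
  apply: le_trans ub _.
  have e : 1 + 2 * z <= expR (2 * z) by exact: expR_ge1Dx.
  have lp : 1/2 <= l * psi by nra.
  have zl : z <= 2 * z * (l * psi) by have := ler_wpM2l z0 lp; lra.
  have lp0 : 0 <= l * psi by lra.
  by have := ler_wpM2l lp0 e; lra.
apply: le_trans (ler_wpM2l (expR_ge0 _) step) _.
rewrite mulrCA -expRD mulrC; apply: ler_wpM2r; first by lra.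
rewrite (_ : - (3 * z) + 2 * z = - z); last by ring.
rewrite expRN; apply: (@le_trans _ _ (1 + z)^-1).
  by rewrite lef_pV2 ?posrE ?expR_gt0 ?expR_ge1Dx//; lra.
rewrite -[leLHS]mul1r ler_pdivrMr; last by lra.
have : del * z <= z / 2 by have := ler_wpM2r z0 del2; lra.
lra.
Qed.

Variable n : nat.
Hypothesis n_gt0 : (0 < n)%N.
Local Notation d := (n.+2).
Local Notation V := 'rV[int]_d.
Implicit Types (x y : V).
Local Notation sqnorm := (sqnorm R).

(* Near the origin the rescaled bump exceeds [kap + 1] times its typical size
   at scale [Q]; at distance [Q / 2] it has dropped below [kap - 1] times it. *)
Lemma bump_window (c2 C2 : R) : 0 < c2 -> 0 < C2 -> exists kap sig : R,
  [/\ 1 <= kap, 0 < sig <= 1/5 & forall (r Q u b : R) (x z : V),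
    0 < r -> r <= Q -> u = (Q ^+ 2)^-1 -> u * r ^+ 2 <= sig / 2 ->
    u * sqnorm z <= sig / 4 ->
    c2 * ker n (sqnorm (x - z) + r ^+ 2) <= b ->
    b <= C2 * ker n (sqnorm (x - z) + r ^+ 2) ->
    [/\ u * sqnorm x < sig -> (kap + 1) * (r / Q) ^+ n <= r ^+ n * b,
       1/4 < u * sqnorm x -> r ^+ n * b <= (kap - 1) * (r / Q) ^+ n &
       r ^+ n * b <= C2]].
Proof.
(* Beyond u |x|^2 = 1/4 one has |x - z| >= Q / 4, so the rescaled bump is at most C2 4^n = kap - 1
   times (r / Q)^n. *)
move=> c20 C20; pose kap : R := C2 * 4 ^+ n + 1.
have kap1 : 1 <= kap by rewrite /kap lerDr mulr_ge0 ?exprn_ge0// ltW.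
pose a : R := (kap + 1) / c2 + 1.
have a1 : 1 <= a by rewrite /a lerDr divr_ge0 ?(ltW c20)//; lra.
have a2 : 1 <= a ^+ 2 by rewrite exprn_ege1.
have ca : kap + 1 <= c2 * a.
  by rewrite /a mulrDr mulrCA divff ?mulr1 ?gt_eqF//; lra.
have kapE : kap - 1 = C2 * 4 ^+ n by rewrite /kap addrK.
clearbody kap; clearbody a.
(* Keeps |x - z|^2 + r^2 below (Q / a)^2, where the rescaled bump is at least c2 a^n >= kap + 1
   times (r / Q)^n. *)
pose sig : R := (5 * a ^+ 2)^-1.
have sig0 : 0 < sig by rewrite /sig invr_gt0; lra.
have sig5 : sig <= 1/5.
  rewrite /sig -[leRHS]invrK lef_pV2 ?posrE ?invr_gt0; lra.
have siga : 5 * sig = a^-1 ^+ 2.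
  by rewrite /sig exprVn; field; rewrite gt_eqF; lra.
clearbody sig.
exists kap, sig; split=> //; first by rewrite sig0.
move=> r Q u b x z r0 rQ uE ur uz blo bhi.
have Q0 : 0 < Q by exact: lt_le_trans rQ.
have Q20 : 0 < Q ^+ 2 by rewrite exprn_gt0.
have u0 : 0 < u by rewrite uE invr_gt0.
have rn0 : 0 <= r ^+ n by rewrite exprn_ge0// ltW.
have om0 : 0 <= (r / Q) ^+ n by rewrite exprn_ge0// divr_ge0// ltW.
have r20 : 0 < r ^+ 2 by rewrite exprn_gt0.
have N0 := sqnorm_ge0 R (x - z).
have kerQ s : 0 <= s -> r ^+ n * ker n (s * Q ^+ 2) = ker n s * (r / Q) ^+ n.
  move=> s0; rewrite kerM// kerX2 ?(ltW Q0)// expr_div_n.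
  by rewrite mulrCA.
have u_le s v : u * v <= s -> v <= s * Q ^+ 2.
  by rewrite uE mulrC ler_pdivrMr.
have u_ge s v : s <= u * v -> s * Q ^+ 2 <= v.
  by rewrite uE mulrC ler_pdivlMr.
split=> [xs|xs|].
- apply: le_trans (ler_wpM2l rn0 blo).
  apply: (@le_trans _ _ (c2 * (ker n (5 * sig) * (r / Q) ^+ n))).
    rewrite mulrA; apply: ler_wpM2r => //; rewrite siga.
    rewrite kerX2 ?invr_ge0; last by lra.
    rewrite -exprVn invrK; apply: le_trans ca _.
    by rewrite ler_wpM2l ?ler_eXnr// ltW.
  rewrite -kerQ; last by lra.
  rewrite mulrCA; apply: ler_wpM2l => //; apply: ler_wpM2l; first exact: ltW.
  apply: le_ker; first by lra.
  apply: u_le; have := ler_wpM2l (ltW u0) (sqnormD_le R x (- z)).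
  by rewrite sqnormN; lra.
- apply: le_trans (ler_wpM2l rn0 bhi) _.
  rewrite kapE -mulrA.
  have -> : 4 ^+ n * (r / Q) ^+ n = r ^+ n * ker n (1/16 * Q ^+ 2).
    have e16 : 1/16 = (1/4) ^+ 2 :> R by field.
    rewrite kerQ// e16 kerX2//.
    by rewrite -exprVn; congr (_ ^+ _ * _); field.
  rewrite mulrCA; apply: ler_wpM2l; first exact: ltW.
  apply: ler_wpM2l => //; apply: le_ker; first by rewrite mulr_gt0.
  suff : 1/16 * Q ^+ 2 <= sqnorm (x - z) by lra.
  apply: u_ge; have := ler_wpM2l (ltW u0) (sqnormD_le R (x - z) z).
  by rewrite subrK; lra.
- apply: le_trans (ler_wpM2l rn0 bhi) _.
  have E : r ^+ n * ker n (r ^+ 2) = 1.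
    by rewrite kerX2 ?(ltW r0)// divff// expf_neq0// gt_eqF.
  rewrite mulrCA -[leRHS]mulr1 -E; apply: ler_wpM2l; first exact: ltW.
  by apply: ler_wpM2l => //; apply: le_ker => //; rewrite lerDr.
Qed.

(** As K >= 2 gam = 24 d / sig, the scale Q exceeds the side r m of the box by so much that all its
    cubes sit well inside the zone u |x|^2 < sig, where the bump prevails. *)
Lemma scale_bounds (sig gam K Q u : R) (r m : nat) (y : V) :
  0 < sig <= 1/5 -> gam * sig = 12 * d%:R -> K = 2 * gam + 1 ->
  (0 < r)%N -> (0 < m)%N -> Q = K * r%:R * m%:R -> u = (Q ^+ 2)^-1 ->
  [/\ r%:R <= Q, 0 < u, 2 * gam * u <= 1, d%:R * (u * r%:R ^+ 2) <= sig / 24 &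
    (forall i, 0 <= y 0 i < m%:Z) -> u * sqnorm (r%:Z *: y) <= sig / 24].
Proof.
move=> /andP[sig0 sig5] gamsig KE r0 m0 QE uE.
have r1 : (1 : R) <= r%:R by rewrite ler1n.
have m1 : (1 : R) <= m%:R by rewrite ler1n.
have D3 : (3 : R) <= d%:R by rewrite ler_nat.
have [D DE] : exists D : R, D = d%:R by exists d%:R.
rewrite -DE in D3 gamsig *.
have gam0 : 0 < gam by rewrite -(pmulr_lgt0 _ sig0) gamsig; lra.
have K1 : 1 <= K by rewrite KE; lra.
have K0 : 0 < K by exact: lt_le_trans K1.
have Kr : K <= Q by rewrite QE -mulrA ler_peMr ?mulr_ege1// ltW.
have Q0 : 0 < Q by exact: lt_le_trans Kr.
have Q1 : 1 <= Q by exact: le_trans Kr.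
have Q20 : 0 < Q ^+ 2 by rewrite exprn_gt0.
have u0 : 0 < u by rewrite uE invr_gt0.
have KQ2 : K * (r%:R ^+ 2 * m%:R ^+ 2) <= Q ^+ 2.
  rewrite QE !exprMn -mulrA; apply: ler_wpM2r.
    by rewrite mulr_ge0 ?exprn_ge0.
  by rewrite expr2 ler_peMl// ltW.
have rm2 : u * (r%:R ^+ 2 * m%:R ^+ 2) <= K^-1.
  by rewrite uE mulrC ler_pdivrMr// ler_pdivlMl.
have KD : D * (u * (r%:R ^+ 2 * m%:R ^+ 2)) <= sig / 24.
  apply: (@le_trans _ _ (D / K)); first by apply: ler_wpM2l => //; lra.
  rewrite ler_pdivrMr//.
  have : sig * (2 * gam) <= sig * K by rewrite ler_wpM2l ?(ltW sig0)// KE lerDl.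
  have -> : sig * (2 * gam) = 2 * (gam * sig) by ring.
  rewrite gamsig; lra.
have r20 : (0 : R) <= r%:R ^+ 2 by rewrite exprn_ge0.
have m21 : (1 : R) <= m%:R ^+ 2 by rewrite exprn_ege1.
split=> //.
- by rewrite QE mulrAC ler_peMl ?mulr_ege1//; lra.
- rewrite uE ler_pdivrMr// mul1r; apply: (@le_trans _ _ Q).
    by apply: le_trans Kr; rewrite KE lerDl.
  by rewrite expr2 ler_peMl// ltW.
- apply: le_trans KD; apply: ler_wpM2l; first by lra.
  by apply: ler_wpM2l; [exact: ltW|rewrite ler_peMr].
move=> ym; apply: le_trans KD; rewrite sqnormZ.
have : sqnorm y <= D * m%:R ^+ 2.
  rewrite /sqnorm; have -> : D * m%:R ^+ 2 = \sum_(i < d) (m%:R ^+ 2 : R).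
    by rewrite sumr_const card_ord DE mulr_natl.
  apply: ler_sum => i _; have /andP[y0 yi] := ym i.
  rewrite lerXn2r ?nnegrE ?ler0z//.
  by rewrite -[m%:R]/(m%:Z%:~R) ler_int ltW.
move=> /(ler_wpM2l r20) /(ler_wpM2l (ltW u0)) h.
by apply: le_trans h _; rewrite le_eqVlt; apply/orP; left; apply/eqP; ring.
Qed.

End BumpScales.

(** * The global supersolution for the tilted walk *)

Section TiltedSupersolution.
Variables (R : realType) (n : nat).
Hypothesis n_gt0 : (0 < n)%N.
Local Notation d := (n.+2).
Local Notation V := 'rV[int]_d.
Implicit Types (x y : V).
Local Notation sqnorm := (sqnorm R).
Let d_gt0 : (0 < d)%N. Proof. by []. Qed.

(* [psi = A * gauss u - T], where [T] glues the rescaled bump around the cube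
   to a function of [|x|] that is good away from the origin. *)
Lemma tilted_supersolution : exists K th c B : R,
  [/\ 1 <= K, 0 < th, 0 < c, 0 < B & forall r m : nat, (0 < r)%N -> (0 < m)%N ->
    let Q := K * r%:R * m%:R in
    let u := (Q ^+ 2)^-1 in
    let del := c * r%:R ^+ n / Q ^+ d in
    [/\ 0 < u <= 1/2, 0 <= del <= 1 & forall y, (forall i, 0 <= y 0 i < m%:Z) ->
      exists psi : V -> R, [/\ forall x, gauss u x <= psi x, psi 0 <= B &
        forall x, expR (- (th / r%:R ^+ 2 * (`[< cube r (r%:Z *: y) x >])%:R)) *
          ((growth u x)^-1 * avg psi x) <= (1 - del) * psi x]]].
Proof.
have [C1 [c2 [C2 [C10 c20 C20 bump]]]] := subharmonic_bump R n_gt0.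
have [kap [sig [kap1 sig05 window]]] := bump_window n_gt0 c20 C20.
have /andP[sig0 sig5] := sig05.
have [gam gamE] : exists gam : R, gam = 12 * d%:R / sig by eexists.
have gamsig : gam * sig = 12 * d%:R by rewrite gamE divfK// gt_eqF.
have [eta etaE] : exists eta : R, eta = 2 * expR (- (4 * gam * d%:R)) by eexists.
(* Large enough for psi >= gauss u + 1 where u |x|^2 <= 4 d, given T <= C2 + 1; further out T <=
   0. *)
have [A AE] : exists A : R, A = 1 + 3 * (C2 + 1) * expR (4 * d%:R) by eexists.
have [K KE] : exists K : R, K = 2 * gam + 1 by eexists.
have D3 : (3 : R) <= d%:R by rewrite ler_nat.
have far := fun u x => @far_subsolution R n n_gt0 sig gam u eta x.
have scale := fun Q u => @scale_bounds R n n_gt0 sig gam K Q u.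
have [D DE] : exists D : R, D = d%:R by eexists.
rewrite -DE in D3 gamE gamsig etaE AE far scale.
have gam0 : 0 < gam by rewrite -(pmulr_lgt0 _ sig0) gamsig; lra.
have gam1 : 12 * 5 * D <= gam.
  have : gam * sig <= gam * (1/5) by rewrite ler_wpM2l// ltW.
  lra.
have gD : 3 * gam <= gam * D by rewrite mulrC ler_wpM2l// ltW.
have e1 : 4 * gam * D + 1 <= expR (4 * gam * D) by rewrite addrC expR_ge1Dx.
have eta0 : 0 < eta by rewrite etaE mulr_gt0// expR_gt0.
have eta1 : eta <= 1.
  rewrite etaE expRN ler_pdivrMr ?mul1r ?expR_gt0//; lra.
have eta4 v : v <= 1/4 -> 2 * eta <= expR (- (gam * v)).
  move=> v4; apply: (@le_trans _ _ (expR (- (gam / 4)))); last first.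
    by rewrite ler_expR lerN2; have := ler_wpM2l (ltW gam0) v4; lra.
  rewrite etaE mulrA.
  have -> : - (4 * gam * D) = - (gam / 4) + - (4 * gam * D - gam / 4) by ring.
  rewrite expRD mulrCA ler_piMr ?expR_ge0// expRN ler_pdivrMr ?expR_gt0// mul1r.
  by have := expR_ge1Dx (4 * gam * D - gam / 4); lra.
have eta_far v : 4 * D < v -> expR (- (gam * v)) <= eta.
  move=> v4; apply: (@le_trans _ _ (expR (- (4 * gam * D)))).
    by rewrite ler_expR lerN2; have := ler_wpM2l (ltW gam0) (ltW v4); lra.
  by rewrite etaE ler_peMl ?expR_ge0//; lra.
have A1 : 1 <= A by rewrite AE lerDl mulr_ge0 ?expR_ge0//; lra.
have A0 : 0 < A by exact: lt_le_trans A1.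
have Aexp v : v <= 4 * D -> 1 + 3 * (C2 + 1) <= (A - 1) * expR (- v) + 1.
  move=> vD; rewrite addrC lerD2r AE [1 + _]addrC addrK -mulrA ler_peMr//.
    by lra.
  by rewrite -expRD -[leLHS]expR0 ler_expR; lra.
have K1 : 1 <= K by rewrite KE lerDr mulr_ge0// ltW.
(* The first constant after K makes th / r^2 = 3 z with z = (C1 + 1) / r^2 in [cube_step]; the next
   gives del A = eps in [off_cube_step]; the last bounds psi 0, as T >= -1. *)
exists K, (3 * (C1 + 1)), (eta / (8 * 9) / A), (A + 1); split=> //.
- by rewrite mulr_gt0// addr_gt0.
- by rewrite !divr_gt0.
- by rewrite addr_gt0.
move=> r m r0 m0 Q u del.
have QE : Q = K * r%:R * m%:R by [].
have uE : u = (Q ^+ 2)^-1 by [].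
have delE : del = eta / (8 * 9) / A * r%:R ^+ n / Q ^+ d by [].
clearbody del; clearbody u; clearbody Q.
have [rQ u0 gu Dur Nctr] : [/\ r%:R <= Q, 0 < u, 2 * gam * u <= 1,
    D * (u * r%:R ^+ 2) <= sig / 24 & forall y, (forall i, 0 <= y 0 i < m%:Z) ->
      u * sqnorm (r%:Z *: y) <= sig / 24].
  have sc y := @scale Q u r m y sig05 gamsig KE r0 m0 QE uE.
  by have [s1 s2 s3 s4 _] := sc 0; split=> // y; have [_ _ _ _] := sc y.
have r1 : (1 : R) <= r%:R by rewrite ler1n.
have r20 : (0 : R) < r%:R ^+ 2 by rewrite exprn_gt0//; exact: lt_le_trans r1.
have Q0 : 0 < Q by apply: lt_le_trans rQ; exact: lt_le_trans r1.
have u8 : 8 * u <= 1.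
  have := ler_wpM2r (ltW u0) gam1; have := ler_wpM2r (ltW u0) D3.
  clear -gu; lra.
have ur : 3 * (u * r%:R ^+ 2) <= sig / 24.
  by apply: le_trans Dur; apply: ler_wpM2r => //; rewrite mulr_ge0 ?ltW.
have [om omE] : exists om : R, om = (r%:R / Q) ^+ n by eexists.
have rQ0 : 0 < r%:R / Q by rewrite divr_gt0//; exact: lt_le_trans r1.
have om0 : 0 < om by rewrite omE exprn_gt0.
have om1 : om <= 1 by rewrite omE exprn_ile1 ?(ltW rQ0)// ler_pdivrMr// mul1r.
have [eps epsE] : exists eps : R, eps = om * (eta / (8 * 9) * u) by eexists.
have delA : del * A = eps.
  rewrite epsE delE omE uE expr_div_n -(addn2 n) exprD; field.
  by rewrite !gt_eqF ?exprn_gt0.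
have e68 : 0 <= eta / (8 * 9) * u.
  by rewrite mulr_ge0 ?(ltW u0)//; clear -eta0; lra.
have eps0 : 0 <= eps by rewrite epsE mulr_ge0// ltW.
have epsu : eps <= u.
  rewrite epsE; apply: (@le_trans _ _ (eta / (8 * 9) * u)); first by rewrite ler_piMl.
  by rewrite ler_piMl ?(ltW u0)//; clear -eta0 eta1; lra.
have eps8 : 8 * eps <= u * (om * eta).
  have : 0 <= u * (om * eta) by rewrite !mulr_ge0// ltW.
  by rewrite epsE; clear; lra.
have far2 x : sig <= u * sqnorm x ->
    growth u x * (om * (gauss (gam * u) x - eta)) + eps * (1 + growth u x) <=
    om * avg (fun y => gauss (gam * u) y - eta) x.
  move=> xs; have := far u x sig05 gamsig u0 gu etaE xs.
  by move=> /(ler_wpM2l (ltW om0)); rewrite epsE; clear; lra.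
have del0 : 0 <= del by rewrite -(pmulr_lge0 _ A0) delA.
have delu : del <= u by apply: le_trans epsu; rewrite -delA ler_peMr.
have rn0 : 0 < r%:R ^+ n :> R by rewrite exprn_gt0//; exact: lt_le_trans r1.
have u1r : u <= 1 / r%:R ^+ 2 / 2.
  by rewrite ler_pdivlMr// ler_pdivlMr//; clear -ur sig5 sig0; lra.
have win x z b := @window r%:R Q u b x z (lt_le_trans ltr01 r1) rQ uE.
rewrite -omE in win.
have rnd : r%:R ^+ n * (C1 / r%:R ^+ d) = C1 / r%:R ^+ 2.
  rewrite -(addn2 n) exprD; field.
  by rewrite !expf_neq0 gt_eqF ?(lt_le_trans ltr01 r1).
have [cs [z [csE zE]]] : exists cs z : R,
    cs = C1 / r%:R ^+ 2 /\ z = (C1 + 1) / r%:R ^+ 2.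
  by exists (C1 / r%:R ^+ 2), ((C1 + 1) / r%:R ^+ 2).
rewrite -csE in rnd.
have step_consts : [/\ 0 <= cs <= z, 0 <= del <= 1/2 & del <= z / 2].
  have c0 : 0 <= C1 / r%:R ^+ 2 by rewrite divr_ge0 ?ltW.
  have r2i : 0 <= 1 / r%:R ^+ 2 :> R by rewrite divr_ge0 ?ltW.
  rewrite csE zE mulrDl; split.
  - by rewrite c0/= lerDl -[_^-1]mul1r.
  - by rewrite del0; clear -delu u8 u0; lra.
  - apply: le_trans delu _; apply: le_trans u1r _.
    by clear -c0; set v := 1 / _; lra.
have ur2 : u * r%:R ^+ 2 <= sig / 2 by clear -ur sig0; lra.
have Nsig v : v <= sig / 24 -> v <= sig / 4 by clear -sig0; lra.
have Dur' : D / 4 * (u * r%:R ^+ 2) <= sig / (8 * 9).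
  by rewrite mulrAC; clear -Dur sig0; lra.
have thE : 3 * (C1 + 1) / r%:R ^+ 2 = 3 * z by rewrite zE mulrA.
have bounds : [/\ 0 < u <= 1/2, 0 <= del <= 1, 0 <= u <= 1 & 0 < u <= 1/4].
  by clear -u0 u8 del0 delu; split; apply/andP; split; lra.
rewrite thE; clear thE zE csE epsE omE delE QE uE window scale KE gamE AE K1.
clear gD e1 gam1 rQ gu Dur ur rQ0 e68 epsu u1r delu del0 gamsig etaE far.
split; [by have [] := bounds|by have [] := bounds|].
move=> y /Nctr {}Nctr; have [g [ga gb gc gd]] := bump r r0.
pose ctr : V := r%:Z *: y.
pose G x : R := r%:R ^+ n * g (x - ctr).
have avgG x : avg G x = r%:R ^+ n * avg g (x - ctr).
  by rewrite /G avgZ (avg_shift g).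
have [Gin Gout G_le] : [/\ forall x, u * sqnorm x < sig -> (kap + 1) * om <= G x,
    forall x, 1/4 < u * sqnorm x -> G x <= (kap - 1) * om & forall x, G x <= C2].
  have h x : [/\ u * sqnorm x < sig -> (kap + 1) * om <= G x,
      1/4 < u * sqnorm x -> G x <= (kap - 1) * om & G x <= C2].
    by apply: (win x ctr) => //; exact: Nsig.
  by split=> x; have [h1 h2 h3] := h x; first [exact: h1|exact: h2|exact: h3].
have Gsub x : ~ cube r (r%:Z *: y) x -> G x <= avg G x.
  move=> xc; rewrite avgG /G; apply: ler_wpM2l; first exact: ltW.
  by apply: ga => xc0; exact: xc ((cube_shift r ctr x).2 xc0).
have Gloss x : G x - cs <= avg G x.
  by rewrite avgG /G -rnd -mulrBr; apply: ler_wpM2l; [exact: ltW|exact: gb].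
have Ncube x : cube r (r%:Z *: y) x -> u * sqnorm x < sig.
  move=> /cube_shift /(sqnorm_cube R) /(ler_wpM2l (ltW u0)); rewrite -DE.
  have := ler_wpM2l (ltW u0) (sqnormD_le R (x - ctr) ctr).
  rewrite subrK -/ctr; rewrite -/ctr in Nctr.
  by move: (sqnorm _) (sqnorm _) => N1 N2; clear -Dur' Nctr sig0; lra.
clearbody G; clear avgG ga gb gc gd win rnd rn0 Nctr ur2 Dur' r20 r1 Q0 Nsig.
pose g2 x := gauss (gam * u) x.
have g2E x : g2 x = expR (- (gam * (u * sqnorm x))) by rewrite /g2 /gauss mulrA.
have g20 x : 0 < g2 x by exact: gauss_gt0.
have uN0 x : 0 <= u * sqnorm x by rewrite mulr_ge0 ?sqnorm_ge0// ltW.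
have g21 x : g2 x <= 1.
  by rewrite g2E -[leRHS]expR0 ler_expR oppr_le0 mulr_ge0// ltW.
pose T1 x : R := G x - kap * om.
pose T2 x : R := om * (g2 x - eta).
(* A maximum inherits the inequality of its active branch. T1 is subharmonic off the cube and
   prevails for u |x|^2 < sig; T2 is a subsolution for u |x|^2 >= sig and prevails for u |x|^2 >
   1/4. *)
pose T x := Num.max (T1 x) (T2 x).
have avgT1 x : avg T1 x = avg G x - kap * om by rewrite avgB avg_cst.
have avgT2 x : avg T2 x = om * avg (fun y => g2 y - eta) x by rewrite avgZ.
have avgT_1 x : avg T1 x <= avg T x by apply: le_avg => v; rewrite le_max lexx.
have avgT_2 x : avg T2 x <= avg T x.
  by apply: le_avg => v; rewrite le_max lexx orbT.
have ometa : 0 < om * eta by exact: mulr_gt0.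
have ometa1 : om * eta <= om by rewrite ler_piMr// ltW.
have kapom : 0 <= kap * om.
  by rewrite mulr_ge0 ?(ltW om0)// (le_trans ler01).
have T2_lt x : - (om * eta) < T2 x.
  by rewrite /T2 mulrBr; have := mulr_gt0 om0 (g20 x); clear; lra.
have T2_le x : T2 x <= om.
  rewrite /T2 mulrBr; have := ler_wpM2l (ltW om0) (g21 x); clear -ometa; lra.
have T2near x : u * sqnorm x <= 1/4 -> om * eta <= T2 x.
  move=> xs; rewrite /T2; apply: ler_wpM2l; first exact: ltW.
  by have := eta4 _ xs; rewrite -g2E; clear; lra.
have T21 x : u * sqnorm x < sig -> T2 x <= T1 x.
  by move=> /Gin; have := T2_le x; rewrite /T1; clear; lra.
have T12 x : 1/4 < u * sqnorm x -> T1 x <= T2 x.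
  by move=> /Gout; have := T2_lt x; rewrite /T1; clear -ometa1; lra.
have T_le x : T x <= C2 + 1.
  rewrite ge_max; apply/andP; split; last first.
    by have := T2_le x; clear -om1 C20; lra.
  by have := G_le x; rewrite /T1; clear -kapom; lra.
have T_ge x : -1 <= T x.
  by rewrite le_max; apply/orP; right; have := T2_lt x; clear -ometa1 om1; lra.
have D4 : 1/4 <= 4 * D by clear -D3; lra.
have T_far x : 4 * D < u * sqnorm x -> T x <= 0.
  move=> xs; have x4 : 1/4 < u * sqnorm x by exact: le_lt_trans xs.
  have T20 : T2 x <= 0.
    rewrite /T2; apply: mulr_ge0_le0; first exact: ltW.
    by rewrite subr_le0 g2E; exact: eta_far.
  by rewrite ge_max T20 andbT; exact: le_trans (T12 x x4) T20.
have Gsub1 x : ~ cube r (r%:Z *: y) x -> T1 x <= avg T1 x.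
  by move=> /Gsub; rewrite avgT1 /T1 lerD2r.
have Gloss1 x : T1 x - cs <= avg T1 x.
  by have := Gloss x; rewrite avgT1 /T1 addrAC lerD2r.
have far3 x : sig <= u * sqnorm x ->
    growth u x * T2 x + eps * (1 + growth u x) <= avg T2 x.
  by move=> xs; rewrite avgT2; exact: far2.
clearbody T1 T2; clear avgT1 avgT2 Gin Gout G_le Gsub Gloss eta4 eta_far far2.
pose psi x := A * gauss u x - T x.
have psi_far x : 4 * D < u * sqnorm x -> gauss u x <= psi x.
  move=> /T_far; have := ler_wpM2r (ltW (gauss_gt0 u x)) A1; rewrite /psi.
  by clear; lra.
have psi_near x : u * sqnorm x <= 4 * D -> gauss u x + 1 <= psi x.
  move=> /Aexp; rewrite -/(gauss u x); have := T_le x; rewrite /psi.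
  by clear -C20; lra.
exists psi; split.
- move=> x; have [h|h] := leP (u * sqnorm x) (4 * D); last exact: psi_far.
  by apply: le_trans (psi_near x h); rewrite lerDl.
- have := T_ge 0; rewrite /psi /gauss sqnorm0 mulr0 oppr0 expR0 mulr1.
  by clear; lra.
move=> x.
have avgpsi : avg psi x = A * avg (gauss u) x - avg T x by rewrite /psi avgB avgZ.
have [_ _ u01 u14] := bounds; have [cz del12 delz] := step_consts.
clear bounds step_consts.
have l1 : 7/8 <= growth u x.
  by apply: le_trans (growth_ge x u01); clear -u8; lra.
have l0 : 0 < growth u x by apply: lt_le_trans l1; rewrite divr_gt0.
have avgh : avg (gauss u) x <= 1.
  rewrite -[leRHS](avg_cst d_gt0 1 x); apply: le_avg => v.
  by rewrite /gauss -[leRHS]expR0 ler_expR oppr_le0.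
have l2 := growth_le_near n_gt0 u14 (x := x).
rewrite avgpsi -/(T x); case: asboolP => [xc|xc] /=; last first.
  rewrite mulr0 oppr0 expR0 mul1r.
  apply: (off_cube_step (eps := eps)) => //; first exact: growthE.
    2: by case/andP: del12.
  have [x4|x4] := leP (u * sqnorm x) (1/4); last first.
    have -> : T x = T2 x by apply/max_idPr; exact: T12.
    apply: le_trans (avgT_2 x); apply: far3.
    by apply: ltW; apply: le_lt_trans x4; clear -sig5; lra.
  have [h|h] := leP (T2 x) (T1 x); last first.
    have -> : T x = T2 x by apply/max_idPr; exact: ltW.
    apply: le_trans (avgT_2 x); apply: far3.
    by rewrite leNgt; apply/negP => /T21; rewrite leNgt h.
  have -> : T x = T1 x by exact/max_idPl.
  apply: le_trans (avgT_1 x); apply: le_trans (Gsub1 x xc).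
  (* Here growth <= 1 - u / 4, and T1 >= om eta provides the slack u om eta / 4 >= 2 eps. *)
  have T1x : om * eta <= T1 x by exact: le_trans (T2near x x4) h.
  have T10 : 0 <= T1 x by apply: le_trans T1x; exact: ltW.
  have p1 : growth u x * T1 x <= (1 - u / 4) * T1 x.
    by apply: ler_wpM2r => //; exact: l2.
  have p2 : u * (om * eta) <= u * T1 x by rewrite ler_wpM2l// ltW.
  have p3 : eps * (1 + growth u x) <= eps * 2.
    by apply: ler_wpM2l => //; have := l2 x4; clear -u0; lra.
  by clear -p1 p2 p3 eps8; lra.
have xs := Ncube x xc.
have x4 : u * sqnorm x <= 1/4 by apply: le_trans (ltW xs) _; clear -sig5; lra.
have TE : T x = T1 x by apply/max_idPl; exact: T21.
have psix : 1 <= psi x.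
  apply: le_trans (psi_near x (le_trans x4 D4)).
  by rewrite lerDr; exact/ltW/gauss_gt0.
rewrite mulr1; apply: (cube_step (c := cs)) => //.
- by apply/andP; split; [clear -l1|have := l2 x4; clear -u0]; lra.
- exact: growthE.
- rewrite TE; apply: le_trans (le_trans (T2near x x4) (T21 x xs)).
  exact: ltW.
- by apply: le_trans (avgT_1 x); rewrite TE; exact: Gloss1.
Qed.

End TiltedSupersolution.

(** * Filling every cube of a box *)

Section LowerTail.
Variables (R : realType) (n : nat).
Hypothesis n_gt0 : (0 < n)%N.
Local Notation d := (n.+2).
Local Notation V := 'rV[int]_d.
Implicit Types (x y z : V) (s : seq V) (r m k : nat) (rho : R).
Let d_gt0 : (0 < d)%N. Proof. by []. Qed.

Definition block m : seq V :=
  codom (fun c : {ffun 'I_d -> 'I_m} => (\row_i (c i)%:Z : V)).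

Lemma size_block m : size (block m) = (m ^ d)%N.
Proof. by rewrite size_codom card_ffun !card_ord. Qed.

Lemma uniq_block m : uniq (block m).
Proof.
rewrite map_inj_uniq ?enum_uniq// => c c' /rowP h.
by apply/ffunP => i; apply: val_inj; have := h i; rewrite !mxE => -[].
Qed.

Lemma mem_block m y : y \in block m -> forall i, 0 <= y 0 i < m%:Z.
Proof. by move=> /codomP[c ->] i; rewrite mxE ltz_nat ltn_ord. Qed.

Lemma growth_gt0 (u : R) x : 0 < u <= 1/2 -> 0 < growth u x.
Proof.
move=> /andP[u0 u2]; have u01 : 0 <= u <= 1 by apply/andP; split; lra.
by apply: lt_le_trans (growth_ge x u01); lra.
Qed.

(** The path weight [tilt w0 (avg (gauss u))] has mean 1. If all cubes are heavy it is at most (1 -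
    u)^(-(k+1)); otherwise some cube y is light and it is at most F y, whose mean is bounded by the
    supersolution of y. *)
Lemma all_cubes_lower : exists K th c B : R,
  [/\ 1 <= K, 0 < th, 0 < c, 0 < B & forall r m k rho, (0 < r)%N -> (0 < m)%N ->
    0 < rho ->
    let Q := K * r%:R * m%:R in
    let u := (Q ^+ 2)^-1 in
    let del := c * r%:R ^+ n / Q ^+ d in
    [/\ 0 < u <= 1/2, 0 <= del <= 1 &
    (1 - u) ^+ k.+1 * (1 -
      (m ^ d)%:R * (expR (th * rho * r%:R ^+ n) * ((1 - del) ^+ k.+1 * B))) <=
    walk_mean k (fun s => (all (fun y =>
       rho * r%:R ^+ d <= cube_time R r y s) (block m))%:R) 0]].
Proof.
have [K [th [c [B [K1 th0 c0 B0 sup]]]]] := tilted_supersolution R n_gt0.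
exists K, th, c, B; split=> // r m k rho r0 m0 rho0 Q u del.
have [u12 del01 hpsi] := sup r m r0 m0; rewrite -/Q -/u -/del in u12 del01 hpsi.
split=> //; have /andP[u0 u2] := u12; have /andP[del0 del1] := del01.
have u01 : 0 <= u <= 1 by apply/andP; split; lra.
have r1 : (1 : R) <= r%:R by rewrite ler1n.
have r20 : (0 : R) < r%:R ^+ 2 by rewrite exprn_gt0//; lra.
have l0 x := growth_gt0 x u12.
pose w0 x := (growth u x)^-1.
have w00 x : 0 < w0 x by rewrite invr_gt0.
pose wy y x := expR (- (th / r%:R ^+ 2 * (`[< cube r (r%:Z *: y) x >])%:R)) * w0 x.
have h1 x : avg (gauss u) x <= 1.
  rewrite -[leRHS](avg_cst d_gt0 1 x); apply: le_avg => z.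
  by rewrite /gauss -[leRHS]expR0 ler_expR oppr_le0 mulr_ge0 ?sqnorm_ge0// ltW.
have h0 x : 0 <= avg (gauss u) x.
  by apply: avg_ge0 => // z; exact/ltW/gauss_gt0.
have tot : walk_mean k (tilt w0 (avg (gauss u))) 0 = 1.
  rewrite walk_mean_tilt_eq => [|z]; last by rewrite growthE /w0 mulKf// gt_eqF.
  by rewrite /gauss sqnorm0 mulr0 oppr0 expR0.
pose E s := all (fun y => rho * r%:R ^+ d <= cube_time R r y s) (block m).
(* Exponential Markov inequality for a light cube: F y dominates the weight as soon as the time in
   the cube is below rho r^d. *)
pose F y s := expR (th * rho * r%:R ^+ n) * tilt (wy y) (avg (gauss u)) s.
have tilt_y y s : tilt (wy y) (avg (gauss u)) s =
    expR (- (th / r%:R ^+ 2 * cube_time R r y s)) * tilt w0 (avg (gauss u)) s.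
  rewrite /tilt mulrA; congr (_ * _).
  by rewrite big_split /= -expR_sum sumrN /cube_time mulr_sumr.
have tilt_ge0 t : 0 <= tilt w0 (avg (gauss u)) t.
  by rewrite mulr_ge0// prodr_ge0// => z _; exact: ltW.
have F0 y s : 0 <= F y s.
  by apply: mulr_ge0; rewrite ?expR_ge0// tilt_y; apply: mulr_ge0; rewrite ?expR_ge0.
have good s : size s = k.+1 -> tilt w0 (avg (gauss u)) s <= (1 - u) ^- k.+1.
  move=> ss; rewrite -[leRHS]mulr1; apply: ler_pM => //.
    by apply: prodr_ge0 => z _; exact: ltW.
  rewrite -ss -exprVn -[size s]count_predT -iter_mulr_1 -big_const_seq.
  apply: ler_prod => z _; rewrite ltW//= lef_pV2 ?posrE//; last by lra.
  exact: growth_ge.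
have bad y s : cube_time R r y s < rho * r%:R ^+ d ->
    tilt w0 (avg (gauss u)) s <= F y s.
  move=> ct; rewrite /F tilt_y mulrA -expRD ler_peMl// -[leLHS]expR0 ler_expR.
  have -> : th * rho * r%:R ^+ n = th / r%:R ^+ 2 * (rho * r%:R ^+ d).
    by rewrite -(addn2 n) exprD; field; rewrite gt_eqF//; lra.
  rewrite -mulrBr mulr_ge0 ?subr_ge0 ?(ltW ct)// divr_ge0 ?ltW//.
have main : 1 <= (1 - u) ^- k.+1 * walk_mean k (fun s => (E s)%:R) 0 +
    \sum_(y <- block m) expR (th * rho * r%:R ^+ n) *
       walk_mean k (tilt (wy y) (avg (gauss u))) 0.
  under eq_bigr do rewrite -walk_meanZ.
  rewrite -[leLHS]tot -walk_mean_sum// -walk_meanZ -walk_meanD.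
  apply: le_walk_mean_in => s [ss _].
  change (tilt w0 (avg (gauss u)) s <=
    (1 - u) ^- k.+1 * (E s)%:R + \sum_(y <- block m) F y s).
  have [Es|/allPn[y yb]] := boolP (E s).
    by rewrite mulr1n mulr1 -[leLHS]addr0 lerD ?good// sumr_ge0.
  rewrite -ltNge mulr0n => /bad h; rewrite mulr0 add0r; apply: le_trans h _.
  by rewrite (bigD1_seq y) ?uniq_block//= lerDl sumr_ge0.
have ub : \sum_(y <- block m) expR (th * rho * r%:R ^+ n) *
       walk_mean k (tilt (wy y) (avg (gauss u))) 0 <=
    (m ^ d)%:R * (expR (th * rho * r%:R ^+ n) * ((1 - del) ^+ k.+1 * B)).
  have cst X : (m ^ d)%:R * X = \sum_(y <- block m) X :> R.
    by rewrite big_const_seq count_predT size_block iter_addr_0 mulr_natl.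
  rewrite cst.
  rewrite big_seq [leRHS]big_seq; apply: ler_sum => y /mem_block ym.
  apply: ler_wpM2l; first exact: expR_ge0.
  have [psi [p1 p2 p3]] := hpsi y ym.
  apply: (@le_trans _ _ ((1 - del) ^+ k.+1 * psi 0)); last first.
    by apply: ler_wpM2l => //; rewrite exprn_ge0// subr_ge0.
  apply: walk_mean_tilt_le.
  - by move=> z; rewrite mulr_ge0 ?expR_ge0// ltW.
  - by rewrite subr_ge0.
  - by move=> z; exact: le_avg.
  - by move=> z; rewrite /wy -mulrA; exact: p3.
have u1 : 0 < (1 - u) ^+ k.+1 by rewrite exprn_gt0//; lra.
rewrite -ler_pdivlMl//; move: main ub; set S := \sum_(y <- _) _; set X := _%:R * _.
by move=> main ub; lra.
Qed.

Lemma cube_time_prefix (W : simple_random_walk R d) k N (w : srw_space W) r y :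
  (k <= N)%N -> cube_time R r y (traj k w) <= cube_time R r y (traj N w).
Proof.
move=> kN; rewrite /cube_time /traj -(subnK kN) addnC -addSn iotaD map_cat.
by rewrite big_cat /= lerDl; apply: sumr_ge0 => z _; exact: ler0n.
Qed.

(** Least m with m^d > L: minimality and m >= 2 give m <= 2 (m - 1) <= 2 L^(1/d). *)
Lemma block_side L : (0 < L)%N -> exists m, [/\ (0 < m)%N, (L < m ^ d)%N &
  m%:R <= 2 * (L%:R : R) `^ (d%:R^-1)].
Proof.
move=> L0; have ex : exists m, (L < m ^ d)%N.
  by exists L.+1; rewrite expnS leq_pmulr// expn_gt0.
have m1 := ex_minnP ex; case: m1 => m Lm mmin; exists m.
have m2 : (2 <= m)%N.
  by move: Lm; case: m {mmin} => [|[|m]]//; rewrite ?exp0n ?exp1n//; lia.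
split=> //; first by lia.
have mL : (m.-1 ^ d <= L)%N.
  by rewrite leqNgt; apply/negP => /mmin; lia.
set tau := L%:R `^ _.
have tau0 : 0 <= tau by exact: powR_ge0.
have taud : tau ^+ d = L%:R.
  by rewrite -powR_mulrn// /tau -powRrM mulVf ?pnatr_eq0// powRr1.
have mt : m.-1%:R <= tau.
  by rewrite -(@ler_pXn2r _ d)// ?nnegrE// taud -natrX ler_nat.
apply: (@le_trans _ _ (2 * m.-1%:R)); last by rewrite ler_wpM2l.
by rewrite -natrM ler_nat; lia.
Qed.

Lemma many_heavy_lower : exists c C : R, [/\ 0 < c, 0 < C &
  forall (W : simple_random_walk R d) N r rho L,
  (2 <= N)%N -> (0 < r)%N -> (0 < L)%N -> 0 < rho ->
  C * ln N%:R <= rho * r%:R ^+ n -> C * rho * r%:R ^+ d * L%:R <= N%:R ->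
  ((expR (- (c * rho * r%:R ^+ n * L%:R `^ (1 - 2 / d%:R))))%:E <=
   srw_law W 0 [set w | (L < set_size (heavy N r rho w))%N])%E].
Proof.
have [K [th [c [B [K1 th0 c0 B0 low]]]]] := all_cubes_lower.
(* Over a time K3 rho Q^d the decay is exp(-(th + 1) q) with q = rho r^n; th q cancels the Markov
   factor and exp(-q) remains. *)
pose K3 : R := (th + 1) / c.
have K30 : 0 < K3 by rewrite divr_gt0//; lra.
have K0 : 0 < K by lra.
have ln2 : 0 < ln (2 : R) by rewrite ln_gt0// ltr1n.
(* With M and C0, q >= ln N + M + 1 for N >= 2, so the union over m^d <= 2^d N cubes costs at most M
   / (2 (M + 1)) <= 1/2. *)
pose M : R := 2 ^+ d.+1 * B.
have M0 : 0 < M by rewrite mulr_gt0// exprn_gt0.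
pose C0 : R := (M + 1) / ln 2.
have C00 : 0 < C0 by rewrite divr_gt0//; lra.
have C1K : 0 < K3 * K ^+ d * 2 ^+ d by apply: mulr_gt0; [apply: mulr_gt0|]; rewrite ?exprn_gt0.
have C2K : 0 < 2 * K3 * K ^+ n * 2 ^+ n.
  by apply: mulr_gt0; [apply: mulr_gt0|]; rewrite ?exprn_gt0// mulr_gt0.
(* The summand 2 pays for the off-by-one in k + 1 and for the factor 1/2 >= exp(-1), since q tau^n
   >= 1. The last summand of the second constant ensures k <= N. *)
exists (2 * K3 * K ^+ n * 2 ^+ n + 2), (1 + C0 + K3 * K ^+ d * 2 ^+ d).
split; [lra|lra|].
move=> W N r rho L N2 r0 L0 rho0 hC hN.
have [m [m0 Lm mtau]] := block_side L0.
set Cc := 1 + _ + _ in hC hN.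
have Cc0 : 0 < Cc by rewrite /Cc; lra.
have r1 : (1 : R) <= r%:R by rewrite ler1n.
have m1 : (1 : R) <= m%:R by rewrite ler1n.
have L1 : (1 : R) <= L%:R by rewrite ler1n.
have rk k : 0 < (r%:R : R) ^+ k by rewrite exprn_gt0//; lra.
set q := rho * r%:R ^+ n in hC.
have q0 : 0 < q by rewrite mulr_gt0.
have N0 : (0 : R) < N%:R by rewrite ltr0n ltnW.
have lnN : ln 2 <= ln N%:R :> R by rewrite ler_ln ?posrE ?ler_nat.
have lnN0 : 0 < ln N%:R :> R by lra.
have C0q : C0 * ln 2 = M + 1 by rewrite divfK// gt_eqF.
have hq : ln N%:R + (M + 1) <= q.
  have e1 : C0 * ln 2 <= C0 * ln N%:R by rewrite ler_wpM2l// ltW.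
  have e2 : 0 <= K3 * K ^+ d * 2 ^+ d * ln N%:R by rewrite mulr_ge0// ltW.
  by move: hC; rewrite /Cc !mulrDl mul1r; lra.
have q1 : 1 <= q by lra.
set tau := L%:R `^ _ in mtau.
have tau0 : 0 <= tau by exact: powR_ge0.
have taud : tau ^+ d = L%:R by rewrite -powR_mulrn// /tau -powRrM mulVf ?pnatr_eq0// powRr1.
have taun : L%:R `^ (1 - 2 / d%:R) = tau ^+ n.
  rewrite -powR_mulrn// /tau -powRrM; congr (_ `^ _).
  have -> : n%:R = d%:R - 2 :> R by rewrite -(addn2 n) natrD addrK.
  by rewrite [RHS]mulrC mulrBl divff ?pnatr_eq0.
have mdL : (m ^ d)%:R <= 2 ^+ d * L%:R :> R.
  rewrite natrX -taud -exprMn lerXn2r ?nnegrE// mulr_ge0//.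
have mn : m%:R ^+ n <= 2 ^+ n * tau ^+ n.
  by rewrite -exprMn lerXn2r ?nnegrE// mulr_ge0.
pose Q := K * r%:R * m%:R.
have Q0 : 0 < Q by apply: mulr_gt0; [apply: mulr_gt0|]; rewrite ?ltr0n.
pose k := Num.truncn (K3 * rho * Q ^+ d).
have X0 : 0 < K3 * rho * Q ^+ d.
  by apply: mulr_gt0; [exact: mulr_gt0|exact: exprn_gt0].
have kb : k%:R <= K3 * rho * Q ^+ d < k.+1%:R.
  by rewrite truncn_itv// ltW.
have /andP[k1 k2] := kb.
have [u12 del01 lb] := low r m k rho r0 m0 rho0; rewrite -/Q in u12 del01 lb.
set u := (Q ^+ 2)^-1 in u12 lb; set del := c * r%:R ^+ n / Q ^+ d in del01 lb.
have /andP[u0 u2] := u12; have /andP[del0 del1] := del01.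
have Qd : Q ^+ d = K ^+ d * r%:R ^+ d * (m ^ d)%:R by rewrite /Q !exprMn natrX.
have kN : (k <= N)%N.
  rewrite -(ler_nat R); apply: le_trans k1 _; apply: le_trans hN; rewrite Qd.
  have e1 : K3 * K ^+ d * (rho * r%:R ^+ d) * (m ^ d)%:R <=
     K3 * K ^+ d * (rho * r%:R ^+ d) * (2 ^+ d * L%:R).
    apply: ler_wpM2l => //; apply/ltW/mulr_gt0; apply: mulr_gt0 => //.
    exact: exprn_gt0.
  have e2 : 0 <= (1 + C0) * (rho * r%:R ^+ d * L%:R).
    apply/ltW/mulr_gt0; first exact: addr_gt0.
    by apply: mulr_gt0; [exact: mulr_gt0|rewrite ltr0n].
  by move: e1 e2; rewrite /Cc; clear; lra.
have LN : L%:R <= N%:R :> R.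
  apply: le_trans hN; apply: ler_peMl => //; rewrite -mulrA; apply: mulr_ege1.
    by rewrite /Cc -addrA lerDl; apply/ltW/addr_gt0.
  by rewrite -(addn2 n) exprD mulrA mulr_ege1// exprn_ege1.
have half : (m ^ d)%:R * (expR (th * rho * r%:R ^+ n) * ((1 - del) ^+ k.+1 * B)) <= 1/2.
  have e1 : (1 - del) ^+ k.+1 <= expR (- ((th + 1) * q)).
    apply: (@le_trans _ _ (expR (- del) ^+ k.+1)).
      by rewrite lerXn2r ?nnegrE ?expR_ge0 ?subr_ge0 ?expR_ge1Dx.
    rewrite -expRM_natl ler_expR mulrN lerN2.
    have -> : (th + 1) * q = (K3 * rho * Q ^+ d) * del.
      by rewrite /K3 /del /q; field; rewrite !gt_eqF// exprn_gt0.
    by rewrite ler_wpM2r// ltW.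
  have e2 : expR (th * rho * r%:R ^+ n) * ((1 - del) ^+ k.+1 * B) <= expR (- q) * B.
    rewrite mulrA; apply: ler_wpM2r; first exact: ltW.
    apply: le_trans (ler_wpM2l (expR_ge0 _) e1) _.
    by rewrite -expRD ler_expR -mulrA -/q; clear; lra.
  have e3 : expR (- q) <= (N%:R * (M + 1))^-1.
    rewrite expRN lef_pV2 ?posrE ?expR_gt0//; last by rewrite mulr_gt0// addr_gt0.
    apply: (@le_trans _ _ (expR (ln N%:R + (M + 1)))); last by rewrite ler_expR.
    rewrite expRD lnK ?posrE//; apply: ler_wpM2l; first exact: ltW.
    by have := expR_ge1Dx (M + 1); clear -M0; lra.
  apply: (@le_trans _ _ (2 ^+ d * N%:R * ((N%:R * (M + 1))^-1 * B))).
    apply: ler_pM => //.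
    - by rewrite !mulr_ge0 ?expR_ge0 ?exprn_ge0 ?subr_ge0// ltW.
    - by apply: le_trans mdL _; rewrite ler_wpM2l ?exprn_ge0.
    - by apply: le_trans e2 _; rewrite ler_wpM2r// ltW.
  have fe (p b x : R) : 0 < p -> 0 < b -> 0 < x ->
      p * x * ((x * (2 * p * b + 1))^-1 * b) = 2 * p * b / (2 * p * b + 1) / 2.
    clear; move=> p0 b0 x0; have := mulr_gt0 p0 b0.
    by move=> pb; field; rewrite !gt_eqF//; lra.
  rewrite /M (exprS _ d) fe// ?exprn_gt0// -exprS -/M.
  rewrite ler_pdivrMr// divfK// ler_pdivrMr; last by rewrite addr_gt0.
  by rewrite mul1r lerDl.
have uk : expR (- (2 * K3 * K ^+ n * 2 ^+ n * (q * tau ^+ n) + 1)) <= (1 - u) ^+ k.+1.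
  have e1 : expR (- (2 * u)) <= 1 - u.
    rewrite expRN -[leLHS]mul1r ler_pdivrMr ?expR_gt0//.
    have : (1 - u) * (1 + 2 * u) <= (1 - u) * expR (2 * u).
      by apply: ler_wpM2l; [clear -u2; lra|exact: expR_ge1Dx].
    have : 0 <= u * (1 - 2 * u) by rewrite mulr_ge0 ?(ltW u0)//; clear -u2; lra.
    clear; lra.
  apply: (@le_trans _ _ (expR (- (2 * u)) ^+ k.+1)); last first.
    by rewrite lerXn2r ?nnegrE ?expR_ge0//; clear -u2; lra.
  rewrite -expRM_natl ler_expR mulrN lerN2.
  have e2 : k.+1%:R * (2 * u) <= (K3 * rho * Q ^+ d + 1) * (2 * u).
    by apply: ler_wpM2r; [rewrite mulr_ge0// ltW|rewrite -natr1 lerD2r].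
  have e3 : K3 * rho * Q ^+ d * (2 * u) = 2 * K3 * K ^+ n * (q * m%:R ^+ n).
    have fe (a b x y : R) : 0 < y -> a * b * (x * y) * (2 * y^-1) = 2 * a * (b * x).
      by clear=> ?; field; rewrite gt_eqF.
    rewrite /u -(addn2 n) exprD fe ?exprn_gt0// /Q !exprMn /q.
    by clear; ring.
  have e4 : 2 * K3 * K ^+ n * (q * m%:R ^+ n) <=
      2 * K3 * K ^+ n * (q * (2 ^+ n * tau ^+ n)).
    apply: ler_wpM2l; last by apply: ler_wpM2l; first exact: ltW.
    by apply/ltW/mulr_gt0; [exact: mulr_gt0|exact: exprn_gt0].
  by move: e2 e3 e4; clear -u2; lra.
pose E s := all (fun y => rho * r%:R ^+ d <= cube_time R r y s) (block m).
apply: (@le_trans _ _ (srw_law W 0 [set w | E (traj k w)])); last first.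
  apply: le_measure; rewrite ?inE.
  - exact: (@measurable_traj_event R d W k [set s | E s]).
  - exact: measurable_many_heavy.
  move=> w /= /allP Ew; rewrite set_size_heavy//.
  rewrite (leq_trans Lm)// -size_block; apply: uniq_leq_size; first exact: uniq_block.
  move=> y /Ew hy; rewrite mem_heavy_seq//; apply: le_trans hy _.
  exact: cube_time_prefix.
rewrite (law_traj d_gt0 W k 0 [set s | E s]) lee_fin.
have -> : walk_mean k (fun s => (`[< [set s | E s] s >])%:R) 0 =
   walk_mean k (fun s => (E s)%:R) 0 :> R.
  by apply: eq_walk_mean => s /=; rewrite asboolb.
apply: le_trans lb.
apply: (@le_trans _ _ (expR (- (2 * K3 * K ^+ n * 2 ^+ n * (q * tau ^+ n) + 1)) * (1/2))).
  apply: (@le_trans _ _ (expR (- (2 * K3 * K ^+ n * 2 ^+ n * (q * tau ^+ n) + 1)) * expR (- 1))).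
    rewrite -expRD ler_expR taun.
    have tau1 : 1 <= tau by rewrite -[leLHS](powRr0 L%:R) ler_powR// invr_ge0.
    have : 1 <= q * tau ^+ n by rewrite mulr_ege1// exprn_ege1.
    set X := 2 * K3 * _ * _; set Y := tau ^+ n => qY.
    have -> : (X + 2) * rho * r%:R ^+ n * Y = X * (q * Y) + 2 * (q * Y).
      by rewrite /q; clear; ring.
    by rewrite -opprD lerN2 -addrA lerD2l; clear -qY; lra.
  apply: ler_wpM2l; first exact: expR_ge0.
  rewrite expRN mul1r lef_pV2 ?posrE ?expR_gt0//.
  exact: expR_ge1Dx.
apply: ler_pM uk _; [exact: expR_ge0|by rewrite divr_ge0|].
by move: half; clear; lra.
Qed.

End LowerTail.

(** * Conclusion *)

Lemma cond_prob_bounds (R : realType) disp (T : measurableType disp)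
    (P : probability T R) (A B : set T) (x y : R) :
  measurable A -> measurable B -> (P (B `\` A) <= (expR x)%:E)%E ->
  ((expR y)%:E <= P B)%E -> 1 - expR (x - y) <= cond_prob P A B <= 1.
Proof.
move=> mA mB hx hy; have fin X : measurable X -> P X \is a fin_num.
  by move=> mX; exact: fin_num_measure.
have mAB : measurable (A `&` B) by exact: measurableI.
have mBA : measurable (B `\` A) by exact: measurableD.
have split : fine (P B) = fine (P (A `&` B)) + fine (P (B `\` A)).
  rewrite -fineD ?fin// -measureU//; last first.
    by apply/seteqP; split=> w //= [[Aw _] [_]].
  by rewrite setIC setUIDK.
have b0 : expR y <= fine (P B) by rewrite -lee_fin fineK ?fin.
have e0 : fine (P (B `\` A)) <= expR x by rewrite -lee_fin fineK ?fin.
have z0 : 0 <= fine (P (B `\` A)) by exact: fine_ge0.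
have y0 : 0 < expR y by exact: expR_gt0.
have b1 : 0 < fine (P B) by exact: lt_le_trans b0.
rewrite /cond_prob; apply/andP; split; last first.
  by rewrite ler_pdivrMr// mul1r split lerDl.
rewrite ler_pdivlMr// mulrBl mul1r lerBlDr {1}split lerD2l.
apply: le_trans e0 _; rewrite expRD expRN -mulrA ler_peMr ?expR_ge0//.
by rewrite ler_pdivlMl// mulr1.
Qed.

(** The infimum of the empty set is 0 by convention, so the limit needs an admissible triple for
    every large N. *)
Lemma admissible_near (R : realType) (n : nat) (C : R) : 0 < C ->
  \forall N \near \oo, admissible n.+2 C N 1 (C * ln N%:R) 1.
Proof.
move=> C0; near=> N.
have N2 : (2 <= N)%N by near: N; exact: nbhs_infty_ge.
have N1 : (1 : R) < N%:R by rewrite ltr1n.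
have NC : (2 * (C * C)) ^+ 2 <= N%:R by near: N; exact: nbhs_infty_ger.
split=> //; first by rewrite mulr_gt0// ln_gt0.
  by rewrite expr1n mulr1.
rewrite expr1n !mulr1 mulrA.
have s0 : 0 < Num.sqrt N%:R :> R by rewrite sqrtr_gt0; lra.
have sE : Num.sqrt N%:R ^+ 2 = N%:R :> R by rewrite sqr_sqrtr// ler0n.
have lns : ln N%:R <= 2 * Num.sqrt N%:R :> R.
  rewrite -{1}sE lnXn// -[leLHS]mulr_natl ler_wpM2l//.
  rewrite -ler_expR lnK ?posrE//; apply: le_trans (expR_ge1Dx _).
    by rewrite lerDr.
have sC : 2 * (C * C) <= Num.sqrt N%:R.
  by rewrite -(@ler_pXn2r _ 2)// ?sE// nnegrE ?(ltW s0)// !mulr_ge0// ltW.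
apply: (@le_trans _ _ (C * C * (2 * Num.sqrt N%:R))).
  by rewrite ler_wpM2l// mulr_ge0// ltW.
rewrite -[leRHS]sE expr2 mulrA ler_wpM2r ?(ltW s0)//; lra.
Unshelve. all: by end_near. Qed.

Lemma admissibleW (R : realType) (n : nat) (C C' : R) N r rho L :
  (0 < N)%N -> C' <= C -> admissible n.+2 C N r rho L ->
  admissible n.+2 C' N r rho L.
Proof.
move=> N0 CC [r0 L0 rho0 h1 h2]; split=> //.
  by apply: le_trans h1; rewrite ler_wpM2r// ln_ge0// ler1n.
apply: le_trans h2; rewrite !ler_wpM2r ?exprn_ge0 ?ler0n//; exact: ltW.
Qed.

Theorem theorem1p4 (R : realType) (d : nat) (hd : (3 <= d)%N) :
  exists kl ku C : R,
    [/\ 0 < kl, 0 < ku, 0 < C,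
        forall (W : simple_random_walk R d) (n r : nat) (rho : R) (L : nat),
          (2 <= n)%N -> admissible d C n r rho L ->
          ((expR (- (kl * rho * r%:R ^+ (d - 2) *
                     L%:R `^ (1 - 2 / d%:R))))%:E <=
             srw_law W 0%R [set w | (L < set_size (heavy n r rho w))%N] <=
           (expR (- (ku * rho * r%:R ^+ (d - 2) *
                     L%:R `^ (1 - 2 / d%:R))))%:E)%E
      & exists2 A : R, 0 < A &
          forall W : simple_random_walk R d,
            (fun n : nat =>
               inf [set q : R | exists (r : nat) (rho : R) (L : nat),
                      admissible d C n r rho L /\
                      q = cond_prob (srw_law W 0)
                            [set w | capacity W (heavy_region n r rho w) <=
                               A * (set_size (heavy_region n r rho w))%:R
                                     `^ (1 - 2 / d%:R)]
                            [set w | (L < set_size (heavy n r rho w))%N]])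
              @ \oo --> (1 : R)].
Proof.
case: d hd => [|[|n]]// n_gt0.
have [cl [Cl [cl0 Cl0 lower]]] := many_heavy_lower R n_gt0.
have [cu [Cu [cu0 Cu0 upper]]] := many_heavy_upper R n_gt0.
have [cc [Cc [cc0 Cc0 cap]]] := capacity_tail R n_gt0.
(* The summand 1 provides ln N <= rho r^n, used for the rate 1/N below. *)
pose C := 1 + Cl + Cu + Cc; have C0 : 0 < C by rewrite !addr_gt0.
exists cl, cu, C; rewrite !subSS subn0; split=> //.
  move=> W N r rho L N2 adm; have N0 := ltnW N2.
  apply/andP; split.
    have [|r0 L0 rho0] := @admissibleW _ _ _ Cl _ _ _ _ N0 _ adm.
      by rewrite /C; lra.
    by rewrite !subSS subn0; exact: lower.
  have [|r0 L0 rho0] := @admissibleW _ _ _ Cu _ _ _ _ N0 _ adm.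
    by rewrite /C; lra.
  by rewrite !subSS subn0 => h _; exact: upper.
(* With this A the exponents of the bad and conditioning events differ by rho r^n L^(1-2/d) >= ln N,
   so each conditional probability is at least 1 - 1/N. *)
exists ((cl + 1) / cc) => [|W]; first by rewrite divr_gt0// addr_gt0.
set A := (cl + 1) / cc; have A0 : 0 < A by rewrite divr_gt0// addr_gt0.
pose S N : set R := [set q | exists r rho L, admissible n.+2 C N r rho L /\
  q = cond_prob (srw_law W 0)
        [set w | capacity W (heavy_region N r rho w) <=
           A * (set_size (heavy_region N r rho w))%:R `^ (1 - 2 / n.+2%:R)]
        [set w | (L < set_size (heavy N r rho w))%N]].
have SE N q : (2 <= N)%N -> S N q -> 1 - N%:R^-1 <= q <= 1.
  move=> N2 [r [rho [L [adm ->]]]]; have N0 := ltnW N2.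
  have N0R : (0 : R) < N%:R by rewrite ltr0n.
  have [|r0 L0 rho0 l1 l2] := @admissibleW _ _ _ Cl _ _ _ _ N0 _ adm.
    by rewrite /C; lra.
  have [|_ _ _ c1 _] := @admissibleW _ _ _ Cc _ _ _ _ N0 _ adm.
    by rewrite /C; lra.
  have [|_ _ _ o1 _] := @admissibleW _ _ _ 1 _ _ _ _ N0 _ adm.
    by rewrite /C; lra.
  rewrite !subSS subn0 in l1 c1 o1.
  have := cond_prob_bounds
    (measurable_capacity_event W N
      (fun k => A * k%:R `^ (1 - 2 / n.+2%:R)) r0 rho0)
    (measurable_many_heavy W N L r0 rho0)
    (cap A W N r rho L A0 N2 r0 L0 rho0 c1)
    (lower W N r rho L N2 r0 L0 rho0 l1 l2).
  move=> /andP[h1 ->]; rewrite andbT; apply: le_trans h1.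
  rewrite lerD2l lerN2 -[leRHS]lnK ?posrE ?invr_gt0// ler_expR lnV ?posrE//.
  set T := L%:R `^ _.
  have T1 : 1 <= T.
    by rewrite -[leLHS](powRr0 L%:R) ler_powR ?ler1n// exponent_ge0.
  have -> : - (cc * A * rho * r%:R ^+ n * T) - - (cl * rho * r%:R ^+ n * T) =
      - (rho * r%:R ^+ n * T).
    by rewrite mulrC [cc * A]mulrC divfK ?gt_eqF//; ring.
  rewrite lerN2; apply: le_trans (_ : 1 * ln N%:R <= _); first by rewrite mul1r.
  apply: le_trans o1 _; rewrite ler_peMr//.
  by rewrite mulr_ge0 ?exprn_ge0// ltW.
have Sbnd : \forall N \near \oo, 1 - N%:R^-1 <= inf (S N) <= 1.
  near=> N.
  have N2 : (2 <= N)%N by near: N; exact: nbhs_infty_ge.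
  have [q Sq] : S N !=set0.
    have adm : admissible n.+2 C N 1 (C * ln N%:R) 1.
      by near: N; exact: admissible_near.
    by eexists; exists 1%N, (C * ln N%:R), 1%N; split; [exact: adm|reflexivity].
  have lb : lbound (S N) (1 - N%:R^-1) by move=> p /(SE _ _ N2)/andP[].
  have /andP[_ q1] := SE _ _ N2 Sq.
  rewrite lb_le_inf//; last by exists q.
  by apply: le_trans q1; apply: ge_inf => //; exists (1 - N%:R^-1).
have cv : (1 - N%:R^-1 : R) @[N --> \oo] --> (1 : R).
  rewrite -[X in _ --> X]subr0; apply: cvgB; first exact: cvg_cst.
  rewrite -(cvg_shiftS (fun N : nat => (N%:R^-1 : R))).
  exact: (@cvg_harmonic R).
by apply: (squeeze_cvgr (h := fun=> 1) Sbnd cv); exact: cvg_cst.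
Unshelve. all: by end_near. Qed.
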